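(* Let $G$ be a real reductive group with maximal compact subgroup $K$. The $C^*$-algebra isomorphisms \[ \begin{cases}\alpha_t\circ\lambda_t\colon C^*_r(G_t)\longrightarrow C^*_r(G)& t>0\\ \mathrm{id}\colon C^*_r(G_0)\longrightarrow C^*_r(G_0)& t=0\end{cases} \] define an isomorphism of continuous fields of $C^*$-algebras over $[0,\infty)$ from the continuous field $\{C^*_r(G_t)\}$ constructed from the smooth family $\{G_t\}$ to the mapping cone field for the Mackey embedding $\alpha\colon C^*_r(G_0)\to C^*_r(G)$.
   Context: Mapping cone field. For an embedding of $C^*$-algebras $\alpha\colon A_0\to A$, the mapping cone continuous field has fibers $A$ at $t\neq0$ and $A_0$ at $t=0$; its continuous sections are all set-theoretic sections $\{a_t\}$ for which the function equal to $a_t$ for $t\ne0$ and to $\alpha(a_0)$ at $t=0$ is norm-continuous into $A$. Here it is taken over the parameter space $[0,\infty)$. Groups. A real reductive group $G$ (in the sense of Vogan's book Representations of Real Reductive Lie Groups: a Lie group with reductive Lie algebra $\mathfrak g$, having a faithful finite-dimensional representation, so that in particular $G$ is linear, such that $\mathrm{Ad}_g$ is an inner automorphism of $\mathfrak g\otimes_{\mathbb R}\mathbb C$ for every $g\in G$, the centralizer in $G$ of every Cartan subalgebra of $\mathfrak g$ is abelian, and, for the $K$ and $\mathfrak s$ that follow, $K\times\mathfrak s\to G$, $(k,X)\mapsto k\exp(X)$, is a diffeomorphism) comes with a Cartan involution whose fixed group $K$ is a maximal compact subgroup, a Cartan decomposition $\mathfrak g=\mathfrak k\oplus\mathfrak s$,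 and a non-degenerate $G$-invariant symmetric bilinear form on $\mathfrak g$, positive-definite on $\mathfrak s$ and negative-definite on $\mathfrak k$. Fix a maximal abelian subspace $\mathfrak a\subseteq\mathfrak s$ and an Iwasawa decomposition $G=KAN$; put $M=Z_K(\mathfrak a)$. A standard parabolic subgroup is a closed subgroup $P\supseteq MAN$; it decomposes as $P=L_PN_P=M_PA_PN_P$ with Levi factor $L_P$ (itself real reductive), unipotent radical $N_P\subseteq N$, $M_P$ the smallest closed subgroup of $L_P$ containing all compact subgroups of $L_P$, and $A_P$ (Lie algebra $\mathfrak a_P$) the largest subgroup of $A$ centralizing $L_P$. $\mathfrak K(H)$ denotes the compact operators on $H$. Principal series. For an irreducible square-integrable unitary representation $\sigma$ of $M_P$ on $H_\sigma$ and $\nu\in\mathfrak a_P^*$, let $\sigma\otimes e^{i\nu}\colon ma\mapsto e^{i\nu(\log a)}\sigma(m)$, and let $\pi_{P,\sigma,\nu}=\mathrm{Ind}_P^G(\sigma\otimes e^{i\nu})$ be the unitarily (normalized) parabolically induced representation (left translation on functions with $\varphi(g\ell n)=(\sigma\otimes e^{i\nu})(\ell)^{-1}\delta_P(\ell)^{-1/2}\varphi(g)$, $\delta_P(\ell)=|\det \mathrm{Ad}_\ell|_{\mathfrak n_P}|$), realized by restriction to $K$ on the compact-model Hilbert space $\mathrm{Ind}\,H_\sigma=L^2(K,H_\sigma)^{K\cap L_P}$ of functions with $\varphi(k\ell)=\sigma(\ell)^{-1}\varphi(k)$, $\ell \in K\cap L_P$. Intertwiners. For $w\in N_K(L_P)=N_K(\mathfrak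 a_P)$ put $w(\sigma)=\sigma\circ\mathrm{Ad}_{w^{-1}}$ (on $H_{w(\sigma)}=H_\sigma$) and $w(\nu)=\nu\circ\mathrm{Ad}_{w^{-1}}$. Let $\mathscr A_{w,\sigma,\nu}\colon\mathrm{Ind}\,H_\sigma\to\mathrm{Ind}\,H_{w(\sigma)}$ be the normalized Knapp-Stein unitary intertwining operators: strongly continuous in $\nu$, with $\mathscr A_{w,\sigma,\nu}\pi_{P,\sigma,\nu}(g)=\pi_{P,w(\sigma),w(\nu)}(g)\mathscr A_{w,\sigma,\nu}$ and $\mathscr A_{w_1,w_2(\sigma),w_2(\nu)}\mathscr A_{w_2,\sigma,\nu}=\mathscr A_{w_1w_2,\sigma,\nu}$. Let $W_\sigma=\{w\in N_K(\mathfrak a_P):w(\sigma)\simeq\sigma\}/Z_K(\mathfrak a_P)$, acting on $\mathfrak a_P^*$. For $w\in W_\sigma$ let $\mathscr A'_{w,\sigma,\nu}=E\circ\mathscr A_{w,\sigma,\nu}$ on $\mathrm{Ind}\,H_\sigma$, where $E\colon\mathrm{Ind}\,H_{w(\sigma)}\to\mathrm{Ind}\,H_\sigma$ is induced from a unitary equivalence $w(\sigma)\simeq\sigma$ (well defined up to a scalar of modulus $1$). $W_\sigma$ acts on $C_0(\mathfrak a_P^*,\mathfrak K(\mathrm{Ind}\,H_\sigma))$ by $w(f)(w(\nu))=\mathscr A'_{w,\sigma,\nu}f(\nu)\mathscr A'^{\,*}_{w,\sigma,\nu}$. Let $W_{0,\sigma}\subseteq W_\sigma$ be the normal subgroup of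 those $w$ for which $\mathscr A'_{w,\sigma,0}$ is a scalar multiple of the identity. By Knapp-Stein, Vogan and Delorme the following exist and are fixed: a reduced root system $\overline\Delta_0\subseteq\mathfrak a_P^*$ with Weyl group $W_{0,\sigma}$; positive roots $\overline\Delta_0^+$; a Lie algebra morphism $\varphi\colon\mathfrak{sl}(2,\mathbb R)\times\cdots\times\mathfrak{sl}(2,\mathbb R)\to\mathfrak g$ with restrictions $\varphi_j$ to the factors, integrating to $\Phi_j\colon SL(2,\mathbb R)\to G$, such that $X_j=\varphi_j\left(\begin{smallmatrix}1&0\\0&-1\end{smallmatrix}\right)\in\mathfrak a_P$, the image of $\varphi_j$ commutes with the orthogonal complement of $X_j$ in $\mathfrak a_P$, and $s_j=\Phi_j\left(\begin{smallmatrix}0&-1\\1&0\end{smallmatrix}\right)\in N_K(\mathfrak a_P)$; the group $S_\sigma$ of orthogonal transformations of $\mathfrak a_P^*$ generated by the reflections $\mathrm{Ad}^*_{s_j}$ is abelian; $R_\sigma=\{w\in W_\sigma:w(\overline\Delta_0^+)\subseteq\overline\Delta_0^+\}$ is a subgroup of $S_\sigma$; and $W_\sigma=W_{0,\sigma}\rtimes R_\sigma$. Let $\mathfrak a_{P,+}^*$ be the closed positive Weyl chamber for $W_{0,\sigma}$, and fix a closed convex fundamental domain (intersection of half-spaces) $F\subseteq\mathfrak a_P^*$ for $S_\sigma$. Rescaling automorphisms. Pairs $(P_1,\sigma_1)$, $(P_2,\sigma_2)$ are associate if an element of $K$ conjugates $L_{P_1}$ to $L_{P_2}$ and the class of $\sigma_1$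 to that of $\sigma_2$. Fix one representative $(P,\sigma)$ of each associate class. Then $f\mapsto(\nu\mapsto\pi_{P,\sigma,\nu}(f))$ gives an isomorphism $C^*_r(G)\cong\bigoplus_{[P,\sigma]}C_0(\mathfrak a_{P,+}^*,\mathfrak K(\mathrm{Ind}\,H_\sigma))^{R_\sigma}$ ($c_0$-direct sum). For $t>0$, the automorphism $\alpha_t$ of $C^*_r(G)$ is defined on each summand by $\alpha_t(f)(w(\nu))=\mathscr B_{w,\nu,t}f(t^{-1}w(\nu))\mathscr B_{w,\nu,t}^*$ for $w\in S_\sigma$, $\nu\in F$, $w(\nu)\in\mathfrak a_{P,+}^*$, where $\mathscr B_{w,\nu,t}=\mathscr A_{w,w^{-1}(\sigma),\nu}\mathscr A^*_{w,w^{-1}(\sigma),t^{-1}\nu}$ ($w$ being represented by any element of $N_K(\mathfrak a_P)$). Continuous field. $G_t=G$ for $t\neq0$ and $G_0=K\ltimes(\mathfrak g/\mathfrak k)\cong K\ltimes\mathfrak s$. The disjoint union $\pmb G=\bigsqcup_{t\in\mathbb R}G_t\times\{t\}$ (deformation to the normal cone of $K\subseteq G$) has the smooth structure for which $K\times\mathfrak s\times\mathbb R\to\pmb G$, $(k,X,t)\mapsto(k\exp(tX),t)$ for $t\ne0$ and $(k,X,0)\mapsto((k,X),0)$, is a diffeomorphism, where $(k,X)=k\cdot X\in G_0$. Fix a Haar measure $dg$ on $G$; give $G_t$ ($t\neq0$) the Haar measure $dg_t=|t|^{-\dim(G/K)}dg$ and $G_0$ the Haar measure which is their smooth limit as $t\to0$.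 $C^*_r(G_t)$ is the completion of $C_c^\infty(G_t)$ acting by convolution on $L^2(G_t,dg_t)$. The $C^*_r(G_t)$ form a continuous field whose continuous sections are those sections that, locally near every $t_0$ and for every $\varepsilon>0$, are within $\varepsilon$ in norm of restrictions $\{\xi_t\}$ of smooth compactly supported functions $\xi$ on $\pmb G$. It is restricted to $t\in[0,\infty)$. Mackey embedding. For $t>0$ let $\lambda_t\colon C^*_r(G_t)\to C^*_r(G)$ be the isomorphism given on $C_c^\infty(G_t)$ by $\xi_t\mapsto|t|^{-\dim(G/K)}\xi_t$. The Mackey embedding $\alpha\colon C^*_r(G_0)\to C^*_r(G)$ is the $C^*$-algebra homomorphism $\alpha(\xi_0)=\lim_{t\to0^+}\alpha_t(\lambda_t(\xi_t))$, where $\{\xi_t\}$ is any continuous section over $[0,\infty)$ extending $\xi_0$ (the limit exists and is independent of the extension). *)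

(* Defs.v *)
(* MathComp-Analysis; [R : realType] is the field of real numbers and [R[i]]
   the field of complex numbers.

   Conventions.
   - A subgroup, a closed subspace, ... is a [set] in an ambient type; a
     function attached to it is a function on the ambient type of which only
     the values on that set matter.
   - A Hilbert space or C*-algebra that arises as a completion is given by an
     abstract space with a map from the space being completed, which determines
     it up to a unique isomorphism.
   - Lie algebras are spaces of matrices through a faithful representation.
   - The dual of a_P is identified with a_P through the invariant form B, so
     that nu stands for the functional B(nu, .).  As B is invariant, the
     coadjoint action becomes Ad. *)
Set Warnings "-notation-overridden,-ambiguous-paths".
Set Warnings "-notation-incompatible-prefix".
From HB Require Import structures.
From mathcomp Require Import all_boot all_order all_algebra.
From mathcomp Require Import all_classical all_reals all_analysis.
From mathcomp Require Import complex.
Set Implicit Arguments.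
Unset Strict Implicit.
Unset Printing Implicit Defensive.
Import Order.TTheory GRing.Theory Num.Theory.
Import numFieldNormedType.Exports.
Local Open Scope classical_set_scope.
Local Open Scope ring_scope.

(** * Hilbert spaces and C*-algebras *)

(* Norms in a normed module over [R[i]] take values in [R[i]]. *)
Definition rnorm (R : realType) (V : normedModType R[i]) (v : V) : R :=
  complex.Re `|v|.

Record hilbert (R : realType) := Hilbert {
  hspace :> completeNormedModType R[i];
  hdot : hspace -> hspace -> R[i];
  hdotl : forall (c : R[i]) (u v w : hspace),
    hdot (c *: u + v) w = c * hdot u w + hdot v w;
  hdotC : forall u v : hspace, hdot v u = (hdot u v)^*;
  hdot_norm : forall u : hspace, hdot u u = `|u| ^+ 2 }.

Record cstar (R : realType) := CStar {
  cspace :> completeNormedModType R[i];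
  cmul : cspace -> cspace -> cspace;
  cadj : cspace -> cspace;
  cmulA : associative cmul;
  cmulDl : forall (c : R[i]) (x y z : cspace),
    cmul (c *: x + y) z = c *: cmul x z + cmul y z;
  cmulDr : forall (c : R[i]) (x y z : cspace),
    cmul z (c *: x + y) = c *: cmul z x + cmul z y;
  cadjD : forall (c : R[i]) (x y : cspace),
    cadj (c *: x + y) = c^* *: cadj x + cadj y;
  cadjK : involutive cadj;
  cadjM : forall x y : cspace, cadj (cmul x y) = cmul (cadj y) (cadj x);
  cnormM : forall x y : cspace, `|cmul x y| <= `|x| * `|y|;
  cnorm_star : forall x : cspace, `|cmul (cadj x) x| = `|x| ^+ 2 }.

Definition star_hom (R : realType) (A B : cstar R) (f : A -> B) : Prop :=
  [/\ forall (c : R[i]) (x y : A), f (c *: x + y) = c *: f x + f y,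
      forall x y : A, f (cmul x y) = cmul (f x) (f y) &
      forall x : A, f (cadj x) = cadj (f x)].

(* The isometry is automatic for bijective *-homomorphisms. *)
Definition star_iso (R : realType) (A B : cstar R) (f : A -> B) : Prop :=
  [/\ star_hom f, bijective f & forall x : A, `|f x| = `|x|].

Section Operators.
Context {R : realType} {E1 E2 : hilbert R}.
Implicit Types (V : set E1) (W : set E2) (T : E1 -> E2).

Definition linear_on V T : Prop :=
  forall (c : R[i]) (x y : E1), V x -> V y -> T (c *: x + y) = c *: T x + T y.

Definition unitary_on V W T : Prop :=
  [/\ linear_on V T, T @` V = W &
      forall x y : E1, V x -> V y -> hdot (T x) (T y) = hdot x y].

(* The adjoint of [T : V -> E2]; it takes its values in [V]. *)
Definition adjoint_on V T (y : E2) : E1 :=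
  xget 0 [set x | V x /\ forall z, V z -> hdot (T z) y = hdot z x].

Definition opnorm_le V T (c : R) : Prop :=
  forall x : E1, V x -> rnorm (T x) <= c * rnorm x.

End Operators.

Definition compact_on (R : realType) (E : hilbert R) (V : set E) (T : E -> E) :
    Prop :=
  [/\ linear_on V T, T @` V `<=` V &
      compact (closure (T @` (V `&` [set x | rnorm x <= 1])))].

(** * Integration and reduced group C*-algebras *)

HB.instance Definition _ (T U : ptopologicalType) := Pointed.on (T * U)%type.

Definition borel (T : ptopologicalType) := g_sigma_algebraType (@open T).

Notation borel_measure T R := {measure set (borel T) -> \bar R}.

Section Integration.
Context {R : realType} {T : ptopologicalType}.
Implicit Types (mu : borel_measure T R) (S : set T).

Definition cmeasurable S (f : T -> R[i]) : Prop :=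
  measurable_fun (S : set (borel T)) (fun x : borel T => complex.Re (f x)) /\
  measurable_fun (S : set (borel T)) (fun x : borel T => complex.Im (f x)).

Definition cintegral mu S (f : T -> R[i]) : R[i] :=
  ((Rintegral mu S (fun x => complex.Re (f x)))
     +i* (Rintegral mu S (fun x => complex.Im (f x))))%C.

Definition sqmod (z : R[i]) : R := complex.Re z ^+ 2 + complex.Im z ^+ 2.

Definition sqintegral mu S (f : T -> R[i]) : \bar R :=
  (\int[mu]_(x in S) (sqmod (f x))%:E)%E.

Definition square_integrable mu S (f : T -> R[i]) : Prop :=
  cmeasurable S f /\ (sqintegral mu S f < +oo)%E.

(* Here and below a group is a closed subset [S] of [T] which is a group under
   [mul] and [inv]. *)
Definition left_haar S (mul : T -> T -> T) mu : Prop :=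
  [/\ mu (~` S) = 0%E,
      forall C : set T, compact C -> (mu C < +oo)%E,
      forall U : set T, open U -> U `&` S !=set0 -> (0 < mu (U `&` S))%E &
      forall (x : T) (A : set (borel T)), S x -> measurable A ->
        mu (mul x @^-1` A) = mu A].

Definition convolution S (mul : T -> T -> T) (inv : T -> T) mu
    (f h : T -> R[i]) : T -> R[i] :=
  fun g => cintegral mu S (fun x => f x * h (mul (inv x) g)).

(* [A], with [iota : D -> A], is the completion of the convolution algebra [D]
   in the norm of its action on L^2(S, mu).  Groups are unimodular here, so
   that the involution carries no modular function. *)
Definition reduced_cstar S (mul : T -> T -> T) (inv : T -> T) mu
    (D : set (T -> R[i])) (A : cstar R) (iota : (T -> R[i]) -> A) : Prop :=
  [/\ forall (c : R[i]) f h, D f -> D h ->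
        iota (fun x => c * f x + h x) = c *: iota f + iota h,
      forall f h, D f -> D h ->
        iota (convolution S mul inv mu f h) = cmul (iota f) (iota h),
      forall f, D f -> iota (fun x => (f (inv x))^*) = cadj (iota f),
      forall f (c : R), D f -> 0 <= c ->
        (rnorm (iota f) <= c <->
         forall h, square_integrable mu S h ->
           (sqintegral mu S (convolution S mul inv mu f h)
              <= (c ^+ 2)%:E * sqintegral mu S h)%E) &
      closure (iota @` D) = setT].

End Integration.

(** * Smooth functions *)

Section Smooth.
Context {R : realType} {T : topologicalType}.

(* [D] is a set of flows [R -> T -> T].  When [S] is a Lie group and [D]
   consists of the right translations by its one-parameter subgroups, the
   functions with all iterated derivatives along [D] existing and continuous
   are exactly the smooth ones. *)
Fixpoint Ck (S : set T) (D : set (R -> T -> T)) (k : nat) (f : T -> R) : Prop :=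
  {within S, continuous f} /\
  if k is k'.+1 then
    forall flow, D flow ->
      (forall x, S x -> derivable (fun t : R => f (flow t x)) 0 1) /\
      Ck S D k' (fun x => derive1 (fun t : R => f (flow t x)) 0)
  else True.

Definition smooth S D (f : T -> R) : Prop := forall k, Ck S D k f.

Definition smooth_cs S D (f : T -> R[i]) : Prop :=
  [/\ smooth S D (fun x => complex.Re (f x)),
      smooth S D (fun x => complex.Im (f x)) &
      exists C : set T, [/\ compact C, C `<=` S &
        forall x, S x -> ~ C x -> f x = 0]].

End Smooth.

(** * Lie groups with a faithful finite-dimensional representation *)

HB.mixin Record isTopGroup G of Topological G & Group G := {
  topmul_continuous : continuous (fun p : G * G => (p.1 * p.2)%g);
  topinv_continuous : continuous (fun x : G => (x^-1)%g) }.

#[short(type="topGroupType")]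
HB.structure Definition TopGroup :=
  {G of isTopGroup G & PointedTopological G & Group G}.

Section LieAlgebras.
Context {R : realType} {n : nat}.
Implicit Types (X Y Z : 'M[R]_n) (g I J h V : set 'M[R]_n).

Definition brk (K : pzRingType) (X Y : 'M[K]_n) : 'M[K]_n := X *m Y - Y *m X.

Definition subspace V : Prop :=
  V 0 /\ forall (c : R) X Y, V X -> V Y -> V (c *: X + Y).

Definition ideal g I : Prop :=
  [/\ subspace I, I `<=` g & forall X Y, g X -> I Y -> I (brk X Y)].

Definition reductive g : Prop := forall I, ideal g I ->
  exists J, [/\ ideal g J, I `&` J = [set 0] &
    forall X, g X -> exists Y Z, [/\ I Y, J Z & X = Y + Z]].

Definition cartan_subalgebra g h : Prop :=
  [/\ subspace h, h `<=` g,
      forall X Y, h X -> h Y -> h (brk X Y),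
      exists m, forall (Xs : m.-tuple 'M[R]_n) Y,
        (forall i, h (tnth Xs i)) -> h Y -> foldr (@brk R) Y Xs = 0 &
      forall X, g X -> (forall Y, h Y -> h (brk X Y)) -> h X].

Definition cplx_mx X : 'M[R[i]]_n := map_mx (fun r : R => r%:C%C) X.

Definition complexification g : set 'M[R[i]]_n :=
  [set Z | exists X Y, [/\ g X, g Y & Z = cplx_mx X + 'i%C *: cplx_mx Y]].

Definition exp_op (K : numFieldType) (V : normedModType K) (D : V -> V)
    (x : V) : V :=
  limn (series (fun k => (k`!%:R)^-1 *: iter k D x)).

(* [T] is the restriction to [g] of an element of the group generated by the
   exp(ad Z), Z in the complexification of [g]. *)
Definition inner_automorphism g (T : 'M[R]_n -> 'M[R]_n) : Prop :=
  exists Zs : seq 'M[R[i]]_n, [set` Zs] `<=` complexification g /\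
    forall X, g X ->
      cplx_mx (T X) =
        foldr (fun Z W : 'M[R[i]]_n => exp_op (brk Z) W) (cplx_mx X) Zs.

Definition mxspace V : {vspace 'M[R]_n} :=
  xget 0%VS [set U : {vspace 'M[R]_n} | forall X, X \in U <-> V X].

Definition mxdim V : nat := \dim (mxspace V).

Definition absdet_on V (T : 'M[R]_n -> 'M[R]_n) : R :=
  `|\det (\matrix_(i < mxdim V, j < mxdim V)
            coord (vbasis (mxspace V)) j (T (vbasis (mxspace V))`_i))|.

End LieAlgebras.

Section LinearGroups.
Context {R : realType} {G : topGroupType} {n : nat} (rho : G -> 'M[R]_n).
Implicit Types (x y : G) (H C : set G) (X Y : 'M[R]_n).

Definition faithful_representation : Prop :=
  [/\ rho 1%g = 1%:M, forall x y, rho (x * y)%g = rho x *m rho y,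
      injective rho & continuous rho].

Definition subgroup H : Prop :=
  [/\ H 1%g, forall x y, H x -> H y -> H (x * y)%g &
      forall x, H x -> H (x^-1)%g].

Definition one_param (c : R -> G) : Prop :=
  continuous c /\ forall s t : R, c (s + t) = (c s * c t)%g.

Definition generated_by (c : R -> G) X : Prop :=
  one_param c /\ is_derive (0 : R) (1 : R) (fun t : R => rho (c t)) X.

Definition lie H : set 'M[R]_n :=
  [set X | exists c, generated_by c X /\ forall t, H (c t)].

Definition gexp X : G :=
  xget 1%g [set x | exists c, generated_by c X /\ c 1 = x].

Definition Ad x X : 'M[R]_n := rho x *m X *m rho (x^-1)%g.

(* A topological group is a Lie group when the exponential map restricts to a
   homeomorphism between neighbourhoods of 0 and 1. *)
Definition lie_group : Prop :=
  [/\ subspace (lie setT),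
      exists2 U, nbhs (0 : 'M[R]_n) U &
        forall X Y, U X -> U Y -> lie setT X -> lie setT Y ->
          gexp X = gexp Y -> X = Y,
      {within lie setT, continuous gexp} &
      forall U, nbhs (0 : 'M[R]_n) U ->
        nbhs (1%g : G) (gexp @` (U `&` lie setT))].

Definition group_flows : set (R -> G -> G) :=
  [set flow | exists2 c, one_param c & flow = fun t x => (x * c t)%g].

Definition product_flows (K : set G) (s : set 'M[R]_n) :
    set (R -> G * 'M[R]_n -> G * 'M[R]_n) :=
  [set flow | exists c Y, [/\ one_param c, forall t, K (c t), s Y &
    flow = fun t p => ((p.1 * c t)%g, p.2 + t *: Y)]].

Definition product_time_flows (K : set G) (s : set 'M[R]_n) :
    set (R -> G * 'M[R]_n * R -> G * 'M[R]_n * R) :=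
  [set flow | exists c Y (r : R), [/\ one_param c, forall t, K (c t), s Y &
    flow = fun t q => (((q.1.1 * c t)%g, q.1.2 + t *: Y), q.2 + t * r)]].

End LinearGroups.

(** * Real reductive groups *)

Section RootSystems.
Context {R : realType} {n : nat} (B : 'M[R]_n -> 'M[R]_n -> R).
Implicit Types Delta Pos : set 'M[R]_n.

Definition positive_system Delta Pos : Prop :=
  [/\ Pos `<=` Delta,
      forall X, Delta X -> Pos X \/ Pos (- X),
      forall X, Pos X -> ~ Pos (- X) &
      forall X Y, Pos X -> Pos Y -> Delta (X + Y) -> Pos (X + Y)].

Definition reflection (X Y : 'M[R]_n) : 'M[R]_n :=
  Y - (2 * B X Y / B X X) *: X.

Definition reduced_root_system Delta : Prop :=
  [/\ finite_set Delta, ~ Delta 0,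
      forall X Y, Delta X -> Delta Y -> Delta (reflection X Y),
      forall X Y, Delta X -> Delta Y ->
        exists z : int, 2 * B X Y / B X X = z%:~R &
      forall X (c : R), Delta X -> Delta (c *: X) -> c = 1 \/ c = -1].

Definition restricted_root (g a : set 'M[R]_n) : set 'M[R]_n :=
  [set X | [/\ a X, X <> 0 & exists Y, [/\ g Y, Y <> 0 &
    forall H, a H -> brk H Y = B X H *: Y]]].

End RootSystems.

Section CartanDecomposition.
Context {R : realType} {G : topGroupType} {n : nat} (rho : G -> 'M[R]_n).
Context (theta : G -> G).

Definition cartan_fixed : set G := [set x | theta x = x].

Definition cartan_minus : set 'M[R]_n :=
  [set X | lie rho setT X /\
    forall t : R, theta (gexp rho (t *: X)) = gexp rho (- t *: X)].

Definition polar (p : G * 'M[R]_n) : G := (p.1 * gexp rho p.2)%g.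

(* A bijection of manifolds under which the smooth functions correspond to each
   other is a diffeomorphism. *)
Definition polar_diffeomorphism : Prop :=
  (forall x : G, exists! p, (cartan_fixed `*` cartan_minus) p /\ polar p = x) /\
  (forall f : G -> R, smooth setT (@group_flows R G) f <->
    smooth (cartan_fixed `*` cartan_minus)
           (product_flows cartan_fixed cartan_minus) (fun p => f (polar p))).

End CartanDecomposition.

Record real_reductive (R : realType) := RealReductive {
  rgroup :> topGroupType;
  rdim : nat;
  rho : rgroup -> 'M[R]_rdim;
  theta : rgroup -> rgroup;
  form : 'M[R]_rdim -> 'M[R]_rdim -> R;
  asub : set 'M[R]_rdim;
  posroots : set 'M[R]_rdim;
  rho_faithful : faithful_representation rho;
  r_lie : lie_group rho;
  r_reductive : reductive (lie rho setT);
  r_inner : forall x, inner_automorphism (lie rho setT) (Ad rho x);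
  r_cartan : forall h, cartan_subalgebra (lie rho setT) h ->
    forall x y, (forall X, h X -> Ad rho x X = X) ->
      (forall X, h X -> Ad rho y X = X) -> (x * y = y * x)%g;
  theta_mul : forall x y, theta (x * y)%g = (theta x * theta y)%g;
  theta_continuous : continuous theta;
  thetaK : involutive theta;
  K_compact : compact (cartan_fixed theta);
  K_maximal : forall C, subgroup C -> compact C ->
    cartan_fixed theta `<=` C -> C = cartan_fixed theta;
  cartan_decomposition : forall X, lie rho setT X ->
    exists Y Z, [/\ lie rho (cartan_fixed theta) Y,
                    cartan_minus rho theta Z & X = Y + Z];
  r_polar : polar_diffeomorphism rho theta;
  form_linear : forall (c : R) X Y Z, lie rho setT X -> lie rho setT Y ->
    lie rho setT Z -> form (c *: X + Y) Z = c * form X Z + form Y Z;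
  form_sym : forall X Y, lie rho setT X -> lie rho setT Y ->
    form X Y = form Y X;
  form_nondegenerate : forall X, lie rho setT X ->
    (forall Y, lie rho setT Y -> form X Y = 0) -> X = 0;
  form_invariant : forall x X Y, lie rho setT X -> lie rho setT Y ->
    form (Ad rho x X) (Ad rho x Y) = form X Y;
  form_pos : forall X, cartan_minus rho theta X -> X <> 0 -> 0 < form X X;
  form_neg : forall X, lie rho (cartan_fixed theta) X -> X <> 0 ->
    form X X < 0;
  asub_subspace : subspace asub;
  asub_minus : asub `<=` cartan_minus rho theta;
  asub_abelian : forall X Y, asub X -> asub Y -> brk X Y = 0;
  asub_maximal : forall X, cartan_minus rho theta X ->
    (forall Y, asub Y -> brk X Y = 0) -> asub X;
  posroots_positive :
    positive_system (restricted_root form (lie rho setT) asub) posroots }.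

Section Structure.
Context {R : realType} (G : real_reductive R).
Local Notation rho := (@rho R G).
Local Notation B := (@form R G).
Local Notation mx := ('M[R]_(rdim G)).
Implicit Types (P : set G) (w x l : G).

Definition gK : set G := cartan_fixed (@theta R G).
Definition gs : set mx := cartan_minus rho (@theta R G).
Definition gA : set G := gexp rho @` @asub R G.
Definition gM : set G :=
  [set x | gK x /\ forall X, asub X -> Ad rho x X = X].

(* The sum of the positive restricted root spaces. *)
Definition nsub : set mx :=
  [set X | exists Ys : seq mx, X = \sum_(Y <- Ys) Y /\
    forall Y, Y \in Ys -> lie rho setT Y /\ exists2 al, posroots al &
      forall H, asub H -> brk H Y = B al H *: Y].

(* G = K A N is the Iwasawa decomposition attached to [asub], [posroots]. *)
Definition gN : set G := gexp rho @` nsub.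

Definition standard_parabolic P : Prop :=
  [/\ closed P, subgroup P & [/\ gM `<=` P, gA `<=` P & gN `<=` P]].

Definition levi P : set G := [set x | P x /\ P (theta x)].

(* The largest normal subgroup of [P] contained in [N]. *)
Definition unipotent_radical P : set G :=
  [set x | forall p, P p -> gN (p * x * p^-1)%g].

Definition leviM P : set G :=
  [set x | levi P x /\ forall H, closed H -> subgroup H -> H `<=` levi P ->
    (forall C, subgroup C -> compact C -> C `<=` levi P -> C `<=` H) -> H x].

Definition leviA P : set G :=
  [set x | gA x /\ forall l, levi P l -> (x * l = l * x)%g].

Definition aP P : set mx := lie rho (leviA P).

Definition modulus P l : R :=
  absdet_on (lie rho (unipotent_radical P)) (Ad rho l).

Definition normKa P : set G := [set w | gK w /\ Ad rho w @` aP P = aP P].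

Definition centrKa P : set G :=
  [set w | gK w /\ forall X, aP P X -> Ad rho w X = X].

(** * Unitary representations *)

Definition unitary_representation (S : set G) (H : hilbert R)
    (sigma : G -> H -> H) : Prop :=
  [/\ forall x, S x -> unitary_on setT setT (sigma x),
      forall v, sigma 1%g v = v,
      forall x y v, S x -> S y -> sigma (x * y)%g v = sigma x (sigma y v) &
      forall v, {within S, continuous (fun x => sigma x v)}].

Definition irreducible (S : set G) (H : hilbert R) (sigma : G -> H -> H) :
    Prop :=
  (exists v : H, v <> 0) /\
  forall V : set H, closed V -> V 0 ->
    (forall (c : R[i]) u v, V u -> V v -> V (c *: u + v)) ->
    (forall x v, S x -> V v -> V (sigma x v)) ->
    V = [set 0] \/ V = setT.

Definition square_integrable_rep (S : set G) (H : hilbert R)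
    (sigma : G -> H -> H) : Prop :=
  exists nu : borel_measure G R,
    left_haar S (fun x y : G => (x * y)%g) nu /\
    forall u v : H, square_integrable nu S (fun x => hdot (sigma x u) v).

Definition discrete_pair P (H : hilbert R) (sigma : G -> H -> H) : Prop :=
  [/\ standard_parabolic P, unitary_representation (leviM P) sigma,
      irreducible (leviM P) sigma & square_integrable_rep (leviM P) sigma].

Definition unitary_equivalence (S : set G) (H1 H2 : hilbert R)
    (s1 : G -> H1 -> H1) (s2 : G -> H2 -> H2) (U : H1 -> H2) : Prop :=
  unitary_on setT setT U /\ forall x v, S x -> U (s1 x v) = s2 x (U v).

Definition twist (H : Type) w (sigma : G -> H -> H) : G -> H -> H :=
  fun x => sigma (w^-1 * x * w)%g.

Definition associate P1 (H1 : hilbert R) (s1 : G -> H1 -> H1)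
    P2 (H2 : hilbert R) (s2 : G -> H2 -> H2) : Prop :=
  exists k : G, [/\ gK k,
    (fun x : G => (k * x * k^-1)%g) @` levi P1 = levi P2 &
    exists U, unitary_equivalence (leviM P2) (twist k s1) s2 U].

End Structure.

Arguments gK {R} G.
Arguments gs {R} G.

(** * Principal series and intertwining operators *)

Definition sl2 (R : realType) : set 'M[R]_2 := [set X | \tr X = 0].
Definition SL2 (R : realType) : set 'M[R]_2 := [set X | \det X = 1].
Definition sl2_diag (R : realType) : 'M[R]_2 :=
  \matrix_(i, j) (if i == j then (-1) ^+ i else 0).
Definition SL2_rot (R : realType) : 'M[R]_2 :=
  \matrix_(i, j) (if i == j then 0 else (-1) ^+ (i < j)%N).

(* [sl2_map] and [SL2_map] are the morphisms phi_j and Phi_j; [knapp_stein w tau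
   nu] is the normalized operator Ind H_tau -> Ind H_{w(tau)} for tau in the
   orbit of [sigma] under N_K(a_P).  All the spaces Ind H_tau are realized
   inside the single Hilbert space [space] = L^2(K, H_sigma), in which
   [cls phi] is the class of the square-integrable function [phi]. *)
Record series_data (R : realType) (G : real_reductive R) := SeriesData {
  parab : set G;
  fiber : hilbert R;
  sigma : G -> fiber -> fiber;
  space : hilbert R;
  cls : (G -> fiber) -> space;
  knapp_stein :
    G -> (G -> fiber -> fiber) -> 'M[R]_(rdim G) -> space -> space;
  roots : set 'M[R]_(rdim G);
  pos : set 'M[R]_(rdim G);
  rank : nat;
  sl2_map : 'I_rank -> 'M[R]_2 -> 'M[R]_(rdim G);
  SL2_map : 'I_rank -> 'M[R]_2 -> G;
  fundom : set 'M[R]_(rdim G) }.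

Section Series.
Context {R : realType} {G : real_reductive R} (muK : borel_measure G R).
Context (D : series_data G).
Local Notation rho := (@rho R G).
Local Notation B := (@form R G).
Local Notation mx := ('M[R]_(rdim G)).
Local Notation P := (parab D).
Local Notation H := (fiber D).
Local Notation E := (space D).
Local Notation sigma := (@sigma R G D).
Local Notation cls := (@cls R G D).
Local Notation ks := (@knapp_stein R G D).
Local Notation K := (gK G).
Local Notation slmap := (@sl2_map R G D).
Local Notation SLmap := (@SL2_map R G D).
Implicit Types (tau : G -> H -> H) (phi : G -> H) (nu : mx) (w : G).

Definition L2K phi : Prop :=
  (forall v : H, cmeasurable K (fun k => hdot (phi k) v)) /\
  (\int[muK]_(k in K) (rnorm (phi k) ^+ 2)%:E < +oo)%E.

Definition L2K_space : Prop :=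
  [/\ forall x : E, exists2 phi, L2K phi & cls phi = x,
      forall (c : R[i]) phi psi, L2K phi -> L2K psi ->
        cls (fun k => c *: phi k + psi k) = c *: cls phi + cls psi &
      forall phi psi, L2K phi -> L2K psi ->
        hdot (cls phi) (cls psi) =
        cintegral muK K (fun k => hdot (phi k) (psi k))].

Definition covariant tau phi : Prop :=
  L2K phi /\ forall k l, K k -> K l -> levi P l ->
    phi (k * l)%g = tau (l^-1)%g (phi k).

Definition Ind tau : set E := cls @` covariant tau.

Definition representative tau (x : E) : G -> H :=
  xget (fun=> 0) [set phi | covariant tau phi /\ cls phi = x].

Definition expi (r : R) : R[i] := (cos r +i* sin r)%C.

(* The value at [k] of the left translate by [g] of the extension of [phi] to
   G = K M_P A_P N_P. *)
Definition translate tau nu (g : G) phi (k : G) : H :=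
  xget 0 [set v | exists k' m X u,
    [/\ K k', leviM P m, aP P X & unipotent_radical P u] /\
    [/\ (g^-1 * k = k' * (m * gexp rho X) * u)%g &
        v = (expi (- B nu X)
               * ((Num.sqrt (modulus P (m * gexp rho X)%g))^-1)%:C%C)
              *: tau (m^-1)%g (phi k')]].

Definition principal_series tau nu (g : G) (x : E) : E :=
  cls (translate tau nu g (representative tau x)).

Definition orbit_rep tau : Prop :=
  exists2 u, normKa P u & tau = twist u sigma.

Definition knapp_stein_family : Prop :=
  (forall w tau nu, normKa P w -> orbit_rep tau -> aP P nu ->
    unitary_on (Ind tau) (Ind (twist w tau)) (ks w tau nu) /\
    forall g x, Ind tau x ->
      ks w tau nu (principal_series tau nu g x) =
      principal_series (twist w tau) (Ad rho w nu) g (ks w tau nu x)) /\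
  (forall w tau x, normKa P w -> orbit_rep tau -> Ind tau x ->
    {within aP P, continuous (fun nu => ks w tau nu x)}) /\
  (forall w1 w2 tau nu x, normKa P w1 -> normKa P w2 -> orbit_rep tau ->
    aP P nu -> Ind tau x ->
    ks w1 (twist w2 tau) (Ad rho w2 nu) (ks w2 tau nu x) =
    ks (w1 * w2)%g tau nu x).

(* The groups W_sigma, W_{0,sigma}, R_sigma and S_sigma are given by the sets
   of their representatives in N_K(a_P). *)
Definition equivalence_at w (U : H -> H) : Prop :=
  unitary_equivalence (leviM P) (twist w sigma) sigma U.

Definition Wsigma : set G :=
  [set w | normKa P w /\ exists U, equivalence_at w U].

Definition self_intertwiner w (U : H -> H) nu (x : E) : E :=
  cls (fun k => U (representative (twist w sigma) (ks w sigma nu x) k)).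

Definition W0sigma : set G :=
  [set w | normKa P w /\ exists U (c : R[i]), equivalence_at w U /\
    forall x, Ind sigma x -> self_intertwiner w U 0 x = c *: x].

Definition Rsigma : set G :=
  [set w | Wsigma w /\ forall al, pos D al -> pos D (Ad rho w al)].

Definition sl2_element (j : 'I_(rank D)) : G := SLmap j (SL2_rot R).

(* The generators are involutions, so no inverses are needed. *)
Definition Ssigma : set G :=
  [set w | normKa P w /\ exists js : seq 'I_(rank D), forall nu, aP P nu ->
    Ad rho w nu = foldr (fun j => Ad rho (sl2_element j)) nu js].

Definition chamber : set mx :=
  [set nu | aP P nu /\ forall al, pos D al -> 0 <= B al nu].

Definition root_data : Prop :=
  [/\ roots D `<=` aP P, reduced_root_system B (roots D),
      forall w, W0sigma w -> exists als : seq mx,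
        (forall al, al \in als -> roots D al) /\
        forall nu, aP P nu -> Ad rho w nu = foldr (reflection B) nu als,
      forall als : seq mx, (forall al, al \in als -> roots D al) ->
        exists2 w, W0sigma w &
          forall nu, aP P nu -> Ad rho w nu = foldr (reflection B) nu als &
      positive_system (roots D) (pos D)].

Definition sl2_data : Prop :=
  (forall j (c : R) (X Y : 'M[R]_2), sl2 X -> sl2 Y ->
    [/\ lie rho setT (slmap j X),
        slmap j (c *: X + Y) = c *: slmap j X + slmap j Y &
        slmap j (brk X Y) = brk (slmap j X) (slmap j Y)]) /\
  (forall i j (X Y : 'M[R]_2), i != j -> sl2 X -> sl2 Y ->
    brk (slmap i X) (slmap j Y) = 0) /\
  (forall j, {within SL2 (R := R), continuous (SLmap j)} /\
    forall x y, SL2 x -> SL2 y ->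
      SLmap j (x *m y) = (SLmap j x * SLmap j y)%g) /\
  (forall j (c : R -> 'M[R]_2) (X : 'M[R]_2),
    continuous c -> (forall t, SL2 (c t)) ->
    (forall s t, c (s + t) = c s *m c t) ->
    is_derive (0 : R) (1 : R) c X ->
    forall t, SLmap j (c t) = gexp rho (t *: slmap j X)) /\
  (forall j, aP P (slmap j (sl2_diag R)) /\
    forall X Y, sl2 X -> aP P Y -> B (slmap j (sl2_diag R)) Y = 0 ->
      brk (slmap j X) Y = 0) /\
  (forall j, normKa P (sl2_element j)).

Definition R_group_data : Prop :=
  [/\ forall i j nu, aP P nu ->
        Ad rho (sl2_element i) (Ad rho (sl2_element j) nu) =
        Ad rho (sl2_element j) (Ad rho (sl2_element i) nu),
      Rsigma `<=` Ssigma,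
      forall w, Wsigma w -> exists w0 r,
        [/\ W0sigma w0, Rsigma r & w = (w0 * r)%g],
      forall w, W0sigma w -> Rsigma w -> centrKa P w &
      forall w w0, Wsigma w -> W0sigma w0 -> W0sigma (w * w0 * w^-1)%g].

Definition fundamental_domain : Prop :=
  (exists Ys : set mx, Ys `<=` aP P /\
    fundom D = [set nu | aP P nu /\ forall Y, Ys Y -> 0 <= B Y nu]) /\
  (forall nu, aP P nu ->
    exists! nu', fundom D nu' /\ exists2 w, Ssigma w & nu = Ad rho w nu').

Definition series_spec : Prop :=
  [/\ discrete_pair P sigma, L2K_space, knapp_stein_family &
      [/\ root_data, sl2_data, R_group_data & fundamental_domain]].

(* The operators B_{w,nu,t}. *)
Definition rescaling_op w nu (t : R) (x : E) : E :=
  let tau := twist (w^-1)%g sigma in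
  ks w tau nu (adjoint_on (Ind tau) (ks w tau (t^-1 *: nu)) x).

End Series.

Arguments Ind {R G} muK D tau.
Arguments principal_series {R G} muK D tau nu g x.
Arguments self_intertwiner {R G} muK D w U nu x.
Arguments rescaling_op {R G} muK D w nu t x.

(** * The reduced C*-algebra of G and its rescaling automorphisms *)

Section Reduced.
Context {R : realType} (G : real_reductive R).
Local Notation rho := (@rho R G).
Local Notation mx := ('M[R]_(rdim G)).

Definition mulG (x y : G) : G := (x * y)%g.
Definition invG (x : G) : G := (x^-1)%g.

Definition test_G : set (G -> R[i]) := smooth_cs setT (@group_flows R G).

Definition haar_G (mu : borel_measure G R) : Prop := left_haar setT mulG mu.

Definition haar_K (muK : borel_measure G R) : Prop :=
  left_haar (gK G) mulG muK /\ muK (gK G) = 1%E.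

Definition reduced_G (mu : borel_measure G R) (A : cstar R)
    (iota : (G -> R[i]) -> A) : Prop :=
  reduced_cstar setT mulG invG mu test_G iota.

Section Plancherel.
Context (muK mu : borel_measure G R) (A : cstar R) (iota : (G -> R[i]) -> A).
Context (I : Type) (D : I -> series_data G).

(* One representative of each associate class. *)
Definition series_representatives : Prop :=
  (forall i, series_spec muK (D i)) /\
  (forall P (H : hilbert R) (sg : G -> H -> H), discrete_pair P sg ->
    exists! i, associate (parab (D i)) (@sigma R G (D i)) P sg).

Definition op_family := forall i, mx -> space (D i) -> space (D i).

Local Notation IndS i := (Ind muK (D i) (@sigma R G (D i))).

(* The c_0-direct sum of the C_0(chamber, compact operators)^{R_sigma}. *)
Definition c0_family (F : op_family) : Prop :=
  [/\ forall i nu, chamber (D i) nu -> compact_on (IndS i) (F i nu),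
      forall i nu (e : R), chamber (D i) nu -> 0 < e ->
        exists2 d : R, 0 < d & forall nu', chamber (D i) nu' ->
          `|nu' - nu| < d ->
          opnorm_le (IndS i) (fun x => F i nu' x - F i nu x) e,
      forall i (e : R), 0 < e -> exists r : R, forall nu,
        chamber (D i) nu -> r < `|nu| -> opnorm_le (IndS i) (F i nu) e,
      forall i w U nu x, Rsigma (D i) w -> equivalence_at (D := D i) w U ->
        chamber (D i) nu -> IndS i x ->
        let T := self_intertwiner muK (D i) w U nu in
        F i (Ad rho w nu) x = T (F i nu (adjoint_on (IndS i) T x)) &
      forall e : R, 0 < e -> exists2 J : set I, finite_set J &
        forall i nu, ~ J i -> chamber (D i) nu ->
          opnorm_le (IndS i) (F i nu) e].

(* [Phi a i nu] is the operator by which [a] acts in pi_{P,sigma,nu}, for the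
   i-th pair (P, sigma). *)
Definition plancherel_iso (Phi : A -> op_family) : Prop :=
  [/\ forall f i nu x y, test_G f -> chamber (D i) nu -> IndS i x ->
        IndS i y ->
        hdot (Phi (iota f) i nu x) y =
        cintegral mu setT (fun g =>
          f g * hdot (principal_series muK (D i) (@sigma R G (D i)) nu g x) y),
      forall i nu x y a b (c : R[i]), chamber (D i) nu -> IndS i x ->
        IndS i y ->
        [/\ Phi (c *: a + b) i nu x = c *: Phi a i nu x + Phi b i nu x,
            Phi (cmul a b) i nu x = Phi a i nu (Phi b i nu x) &
            hdot (Phi (cadj a) i nu x) y = hdot x (Phi a i nu y)],
      forall a (c : R), 0 <= c -> (rnorm a <= c <->
        forall i nu, chamber (D i) nu -> opnorm_le (IndS i) (Phi a i nu) c),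
      forall a, c0_family (Phi a) &
      forall F, c0_family F -> exists a, forall i nu x,
        chamber (D i) nu -> IndS i x -> Phi a i nu x = F i nu x].

Definition rescaling_automorphism (Phi : A -> op_family) (t : R)
    (alpha : A -> A) : Prop :=
  star_iso alpha /\
  forall a i w nu x, Ssigma (D i) w -> fundom (D i) nu ->
    chamber (D i) (Ad rho w nu) -> IndS i x ->
    let T := rescaling_op muK (D i) w nu t in
    Phi (alpha a) i (Ad rho w nu) x =
    T (Phi a i (t^-1 *: Ad rho w nu) (adjoint_on (IndS i) T x)).

End Plancherel.

(** * Deformation to the normal cone *)

Local Notation K := (gK G).
Local Notation s := (gs G).

Definition dimGK : nat := mxdim s.

(* G_0 is the set K x s; its element (k, X) is the product k X in the
   semidirect product of K and s. *)
Definition G0set : set (G * mx) := K `*` s.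
Definition mul0 (p q : G * mx) : G * mx :=
  ((p.1 * q.1)%g, Ad rho (q.1^-1)%g p.2 + q.2).
Definition inv0 (p : G * mx) : G * mx := ((p.1^-1)%g, - Ad rho p.1 p.2).
Definition test_G0 : set (G * mx -> R[i]) :=
  smooth_cs G0set (product_flows K s).

(* The measure |t|^{-dim(G/K)} dg. *)
Definition haar_scaled (mu : borel_measure G R) (t : R) : borel_measure G R :=
  mscale (`|t|^-1 ^+ dimGK)%:nng mu.

(* [xi t], for t <> 0, and [xi0] are the restrictions to the groups G_t and G_0
   of one smooth compactly supported function on the deformation space. *)
Definition smooth_family (xi : R -> G -> R[i]) (xi0 : G * mx -> R[i]) : Prop :=
  smooth_cs (G0set `*` setT) (product_time_flows K s)
    (fun q : G * mx * R =>
      if q.2 == 0 then xi0 q.1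
      else xi q.2 (q.1.1 * gexp rho (q.2 *: q.1.2))%g).

Definition haar_G0 (mu : borel_measure G R) (mu0 : borel_measure (G * mx)%type R) :
    Prop :=
  left_haar G0set mul0 mu0 /\
  forall xi xi0, smooth_family xi xi0 ->
    (fun t : R => cintegral (haar_scaled mu t) setT (xi t) : R[i]^o) @ 0^'
      --> (cintegral mu0 G0set xi0 : R[i]^o).

Definition reduced_G0 (mu0 : borel_measure (G * mx)%type R) (A : cstar R)
    (iota : (G * mx -> R[i]) -> A) : Prop :=
  reduced_cstar G0set mul0 inv0 mu0 test_G0 iota.

End Reduced.

Arguments test_G {R} G.

(** * Continuous fields over [0, oo) *)

Section Fields.
Context {R : realType}.

(* The fibre is [A0] at 0 and [At t] at t > 0; the component [a.2 t] of a
   section is irrelevant for t <= 0. *)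
Definition fsection (A0 : cstar R) (At : R -> cstar R) : Type :=
  (A0 * (forall t, At t))%type.

Section Field.
Context (A0 : cstar R) (At : R -> cstar R).
Implicit Types (a b : fsection A0 At) (Gam : set (fsection A0 At)).

Definition fnorm a (t : R) : R := if t == 0 then rnorm a.1 else rnorm (a.2 t).

Definition fcomb (c : R[i]) a b : fsection A0 At :=
  (c *: a.1 + b.1, fun t => c *: a.2 t + b.2 t).
Definition fmul a b : fsection A0 At :=
  (cmul a.1 b.1, fun t => cmul (a.2 t) (b.2 t)).
Definition fadj a : fsection A0 At := (cadj a.1, fun t => cadj (a.2 t)).

Definition continuous_field Gam : Prop :=
  [/\ (exists a, Gam a) /\
        forall (c : R[i]) a b, Gam a -> Gam b -> Gam (fcomb c a b),
      (forall a b, Gam a -> Gam b -> Gam (fmul a b)) /\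
        forall a, Gam a -> Gam (fadj a),
      (forall x : A0, exists2 a, Gam a & a.1 = x) /\
        forall t (x : At t), 0 < t -> exists2 a, Gam a & a.2 t = x,
      forall a, Gam a -> {within `[0, +oo[, continuous (fnorm a)} &
      forall a, (forall t0 e : R, 0 <= t0 -> 0 < e ->
          exists2 b, Gam b & exists2 d : R, 0 < d & forall t, 0 <= t ->
            `|t - t0| < d -> fnorm (fcomb (-1) b a) t <= e) ->
        Gam a].

End Field.

Definition field_iso (A0 B0 : cstar R) (At Bt : R -> cstar R)
    (GamA : set (fsection A0 At)) (GamB : set (fsection B0 Bt))
    (h0 : A0 -> B0) (h : forall t, At t -> Bt t) : Prop :=
  [/\ star_iso h0, forall t, 0 < t -> star_iso (h t) &
      forall a, GamA a <-> GamB (h0 a.1, fun t => h t (a.2 t))].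

Definition mapping_cone (A0 A : cstar R) (alpha : A0 -> A) :
    set (fsection A0 (fun=> A)) :=
  [set a | {within `[0, +oo[, continuous
             (fun t : R => if t == 0 then alpha a.1 else a.2 t)}].

End Fields.

Section DeformationField.
Context {R : realType} {G : real_reductive R}.
Local Notation mx := ('M[R]_(rdim G)).
Context (A0 : cstar R) (At : R -> cstar R).
Context (iota0 : (G * mx -> R[i]) -> A0).
Context (iotat : forall t : R, (G -> R[i]) -> At t).

Definition deformation_section : set (fsection A0 At) :=
  [set a | forall t0 e : R, 0 <= t0 -> 0 < e ->
    exists xi xi0, smooth_family xi xi0 /\
    exists2 d : R, 0 < d & forall t, 0 <= t -> `|t - t0| < d ->
      fnorm (fcomb (-1) (iota0 xi0, fun t => iotat t (xi t)) a) t <= e].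

Context (A : cstar R) (iota : (G -> R[i]) -> A).

Definition fiber_identification (t : R) (lambda : At t -> A) : Prop :=
  star_iso lambda /\
  forall f, test_G G f ->
    lambda (iotat t f) = iota (fun g => ((`|t|^-1 ^+ dimGK G)%:C)%C * f g).

Definition mackey_embedding (alphat : R -> A -> A)
    (lambda : forall t, At t -> A) (alpha : A0 -> A) : Prop :=
  star_hom alpha /\
  forall a, deformation_section a ->
    (fun t : R => alphat t (lambda t (a.2 t))) @ 0^'+ --> alpha a.1.

End DeformationField.

Arguments fiber_identification {R G At} iotat {A} iota t lambda.

(* Main.v *)
(* Write f(t) = alpha_t(lambda_t(a_t)) for t > 0 and f(0) = alpha(a_0).  The
   Mackey embedding is a pointwise limit of isometries, hence isometric, and
   [a] is approximated near t by [b] as well as f_a is by f_b.  So everything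
   reduces to the continuity of f at t > 0 for a section of the deformation
   field, and to two separate statements:

   - For a in C*_r(G), alpha_t(a) is continuous in t.  With
     U(nu) = A_{w, w^-1(sigma), nu}, the rescaled operator at w(nu) is
     U(nu) H(t^-1 nu) U(nu)^*, where H(nu) = U(nu)^* a(w(nu)) U(nu).  The outer
     unitary does not depend on t, and H is norm continuous because U is
     strongly continuous while a(nu) and its adjoint are compact.  Continuity
     is uniform on the compact parts of the chamber (a_P is closed, being the
     subspace of the fixed points of L_P in the Lie algebra of A), and
     everything is small outside finitely many of them.

   - For xi smooth with compact support, t^-d xi_t is continuous in C*_r(G):
     for functions supported in a fixed compact set, the reduced norm is
     bounded by a multiple of the supremum norm (Cauchy-Schwarz and Tonelli),
     and in the polar coordinates k exp(tX) the functions xi_t form a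
     continuous family with a common compact support.

   Conversely, a section with f continuous is approximated near each t by a
   section of the deformation field through the same point. *)
Require Import Defs.
From HB Require Import structures.
From mathcomp Require Import all_boot all_order all_algebra.
From mathcomp Require Import all_classical all_reals all_analysis.
From mathcomp Require Import complex measurable_realfun lra ring.
Import Order.TTheory GRing.Theory Num.Theory.
Import numFieldNormedType.Exports.
Local Open Scope classical_set_scope.
Local Open Scope ring_scope.
Set Implicit Arguments.
Unset Strict Implicit.

(** * Norms, Hilbert spaces and unitary operators *)

Section RealNorm.
Context {R : realType} {V : normedModType R[i]}.
Implicit Types (u v : V) (r : R).

Lemma rnormE v : `|v| = (rnorm v)%:C%C.
Proof. by rewrite /rnorm RRe_real // ger0_real. Qed.

Lemma rnorm_ge0 v : 0 <= rnorm v.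
Proof. by rewrite -lecR -rnormE normr_ge0. Qed.

Lemma rnorm0 : rnorm (0 : V) = 0.
Proof. by rewrite /rnorm normr0. Qed.

Lemma rnorm0_eq0 v : rnorm v = 0 -> v = 0.
Proof. by move=> v0; apply/eqP; rewrite -normr_eq0 rnormE v0. Qed.

Lemma rnormD u v : rnorm (u + v) <= rnorm u + rnorm v.
Proof. by rewrite -lecR rmorphD /= -!rnormE ler_normD. Qed.

Lemma rnormN v : rnorm (- v) = rnorm v.
Proof. by rewrite /rnorm normrN. Qed.

Lemma rnormB u v : rnorm (u - v) = rnorm (v - u).
Proof. by rewrite /rnorm distrC. Qed.

Lemma rnorm_dist w u v : rnorm (u - v) <= rnorm (u - w) + rnorm (w - v).
Proof. by have -> : u - v = (u - w) + (w - v);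
  [rewrite addrA subrK | exact: rnormD]. Qed.

Lemma rnormZ r v : rnorm (r%:C%C *: v) = `|r| * rnorm v.
Proof.
apply: complexI; rewrite -rnormE normrZ rnormE rmorphM /=; congr (_ * _).
by rewrite normc_def /= expr0n addr0 sqrtr_sqr.
Qed.

(** A positive element of [R[i]] is real, so convergence for the complex-valued norm is tested by
    real bounds alone. *)
Lemma cvg_rnormP {T} (F : set_system T) {FF : Filter F} (f : T -> V) (l : V) :
  f @ F --> l <-> forall e : R, 0 < e ->
    \forall x \near F, rnorm (f x - l) <= e.
Proof.
split=> [/cvgrPdist_le cvf e e0|cvf].
  have e0' : 0 < e%:C%C :> R[i] by rewrite ltcR.
  near=> x; rewrite rnormB -lecR -rnormE; near: x; exact: cvf.
apply/cvgrPdist_le => e e0.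
have eE : (complex.Re e)%:C%C = e by rewrite RRe_real // gtr0_real.
have {}e0 : 0 < complex.Re e by rewrite -ltcR eE.
near=> x; rewrite -eE rnormE lecR rnormB; near: x; exact: cvf.
Unshelve. all: by end_near. Qed.

Lemma within_rnormP {T : topologicalType} (S : set T) (f : T -> V) :
  {within S, continuous f} <-> forall x, S x -> forall e : R, 0 < e ->
    \forall y \near x, S y -> rnorm (f y - f x) <= e.
Proof.
split=> [/subspace_continuousP cf x Sx e e0|cf].
  by have /cvg_rnormP/(_ e e0) := cf x Sx; rewrite near_withinE.
apply/subspace_continuousP => x Sx; apply/cvg_rnormP => e e0.
by rewrite near_withinE; exact: cf.
Qed.

Lemma nbhs_rnorm (v : V) (r : R) : 0 < r ->
  \forall u \near v, rnorm (u - v) < r.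
Proof.
move=> r0; have r0' : 0 < (r / 2)%:C%C :> R[i] by rewrite ltcR divr_gt0.
have /cvg_rnormP/(_ (r / 2)) : (id : V -> V) @ v --> v by exact: cvg_id.
move=> /(_ (divr_gt0 r0 (ltr0Sn R 1))); apply: filterS => u /le_lt_trans; apply.
by rewrite ltr_pdivrMr // ltr_pMr // ltr1n.
Qed.

End RealNorm.

Section Hilbert.
Context {R : realType} {E : hilbert R}.
Implicit Types (u v w : E) (c : R[i]).

Lemma hdotDl u v w : hdot (u + v) w = hdot u w + hdot v w.
Proof. by have := hdotl 1 u v w; rewrite scale1r mul1r. Qed.

Lemma hdot0l w : hdot 0 w = 0.
Proof. by have := hdotDl 0 0 w; rewrite addr0 -[LHS]addr0 => /addrI. Qed.

Lemma hdotZl c u w : hdot (c *: u) w = c * hdot u w.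
Proof. by have := hdotl c u 0 w; rewrite !addr0 hdot0l addr0. Qed.

Lemma hdotBl u v w : hdot (u - v) w = hdot u w - hdot v w.
Proof. by rewrite hdotDl -scaleN1r hdotZl mulN1r. Qed.

Lemma hdotBr u v w : hdot w (u - v) = hdot w u - hdot w v.
Proof. by rewrite hdotC hdotBl rmorphB /= -!hdotC. Qed.

Lemma hdotZr c u w : hdot w (c *: u) = c^* * hdot w u.
Proof. by rewrite hdotC hdotZl rmorphM /= -hdotC. Qed.

Lemma hdot_eq0 u : hdot u u = 0 -> u = 0.
Proof. by rewrite hdot_norm => /eqP; rewrite expf_eq0 normr_eq0 => /eqP. Qed.

Lemma cauchy_schwarz u v : `|hdot u v| <= `|u| * `|v|.
Proof.
have [->|v0] := eqVneq v 0; first by rewrite hdotC hdot0l rmorph0 !normr0 mulr0.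
have vv0 : 0 < `|v| ^+ 2 by rewrite exprn_gt0 // normr_gt0.
(* [c *: v] is the orthogonal projection of [u] on the line of [v]; the inequality is the
   nonnegativity of the squared norm of [u - c *: v]. *)
set c := hdot u v / `|v| ^+ 2.
have : 0 <= hdot (u - c *: v) (u - c *: v) by rewrite hdot_norm exprn_ge0.
rewrite hdotBl !hdotBr !hdotZl !hdotZr (hdotC u v) !hdot_norm.
have -> : c^* = (hdot u v)^* / `|v| ^+ 2.
  have e2 : (`|v| ^+ 2)^* = `|v| ^+ 2 by exact/conj_Creal/ger0_real/ltW.
  by rewrite /c rmorphM /= fmorphV /= e2.
rewrite /c.
have -> : `|u| ^+ 2 - (hdot u v)^* / `|v| ^+ 2 * hdot u v -
  (hdot u v / `|v| ^+ 2 * (hdot u v)^* -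
    (hdot u v / `|v| ^+ 2) * ((hdot u v)^* / `|v| ^+ 2 * `|v| ^+ 2)) =
  `|u| ^+ 2 - `|hdot u v| ^+ 2 / `|v| ^+ 2.
  rewrite normCK.
  by field; rewrite normr_eq0.
rewrite subr_ge0 ler_pdivrMr // -exprMn ler_sqr // nnegrE //.
Qed.

End Hilbert.

Section Unitary.
Context {R : realType} {E1 E2 : hilbert R}.
Implicit Types (V : set E1) (W : set E2) (U : E1 -> E2).

Lemma norm_sq_inj (E : hilbert R) (E' : hilbert R) (u : E) (v : E') :
  hdot u u = hdot v v -> rnorm u = rnorm v.
Proof.
rewrite !hdot_norm !rnormE => /eqP; rewrite eqrXn2 ?lecR ?rnorm_ge0 //.
by move=> /eqP /complexI.
Qed.

Lemma unitary_dist V W U x y : unitary_on V W U -> V x -> V y ->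
  rnorm (U x - U y) = rnorm (x - y).
Proof.
move=> [_ _ UU] Vx Vy; apply: norm_sq_inj.
by rewrite !hdotBl !hdotBr !UU.
Qed.

Lemma unitary_norm V W U x : unitary_on V W U -> V x -> rnorm (U x) = rnorm x.
Proof. by move=> [_ _ UU] Vx; apply: norm_sq_inj; exact: UU. Qed.

Lemma unitary_img V W U x : unitary_on V W U -> V x -> W (U x).
Proof. by move=> [_ <- _] Vx; exists x. Qed.

(* Uniqueness of the adjoint needs no linearity of [V]. *)
Lemma adjoint_onE V (T : E1 -> E2) y x : V x ->
  (forall z, V z -> hdot (T z) y = hdot z x) -> adjoint_on V T y = x.
Proof.
move=> Vx Hx; rewrite /adjoint_on; case: xgetP => [x' _ [Vx' Hx']|/(_ x)];
  last first.
  by case.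
have e z : V z -> hdot z x' = hdot z x by move=> Vz; rewrite -Hx' // -Hx.
apply/eqP; rewrite -subr_eq0; apply/eqP/hdot_eq0.
by rewrite hdotBl !hdotBr !e // !subrr.
Qed.

(** Between [V] and [W] the adjoint of a surjective isometry is its inverse, hence an isometry as
    well; the next lemmas use it in this form. *)
Lemma unitary_adjointK V W U x : unitary_on V W U -> V x ->
  adjoint_on V U (U x) = x.
Proof. by move=> [_ _ UU] Vx; apply: adjoint_onE => // z Vz; exact: UU. Qed.

Lemma unitaryK V W U y : unitary_on V W U -> W y ->
  V (adjoint_on V U y) /\ U (adjoint_on V U y) = y.
Proof.
by move=> hU; case: (hU) => _ <- _ [x Vx <-]; rewrite (unitary_adjointK hU).
Qed.

Lemma unitary_adj_dot V W U x y : unitary_on V W U -> V x -> W y ->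
  hdot (U x) y = hdot x (adjoint_on V U y).
Proof.
by move=> hU Vx Wy; case: (unitaryK hU Wy) => Va {1}<-; case: hU => _ _ ->.
Qed.

Lemma unitary_adj_dist V W U x y : unitary_on V W U -> W x -> W y ->
  rnorm (adjoint_on V U x - adjoint_on V U y) = rnorm (x - y).
Proof.
move=> hU Wx Wy; case: (unitaryK hU Wx) => Vx Ux;
  case: (unitaryK hU Wy) => Vy Uy.
by rewrite -(unitary_dist hU) // Ux Uy.
Qed.

Lemma unitary_adj_norm V W U x : unitary_on V W U -> W x ->
  rnorm (adjoint_on V U x) = rnorm x.
Proof.
by move=> hU Wx; case: (unitaryK hU Wx) => Vx Ux;
  rewrite -(unitary_norm hU) // Ux.
Qed.

End Unitary.

(* [V] and [W] stand for spaces [Ind muK D tau], which are not known to be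
   closed under sums: the norm integrated in [L2K] need not be measurable when
   the fiber is not separable.  Only dilations are used. *)
Section StrongConjugation.
Context {R : realType} {E1 E2 : hilbert R} {T : topologicalType}.
Context (V : set E1) (W : set E2) (Z : set T) (U : T -> E1 -> E2).
Hypothesis W0 : W 0.
Hypothesis WZ : forall (r : R) x, 0 < r -> W x -> W (r%:C%C *: x).
Hypothesis U_unitary : forall m, Z m -> unitary_on V W (U m).
Hypothesis U_strong : forall x, V x -> {within Z, continuous (fun m => U m x)}.

(** The adjoints are isometries on [W], so near a point of the closure of [C] their variation is
    governed by a single vector; compactness then gives uniformity on [C]. *)
Lemma adjoint_uniform (C : set E2) m0 (e : R) : C `<=` W ->
  compact (closure C) -> Z m0 -> 0 < e ->
  \forall m \near m0, Z m -> forall x, C x ->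
    rnorm (adjoint_on V (U m) x - adjoint_on V (U m0) x) <= e.
Proof.
move=> CW /compact_near_coveringP cC Zm0 e0.
have e3 : 0 < e / 3 by rewrite divr_gt0.
have near_cov : forall x, closure C x -> \forall x' \near x & m \near m0, 
   Z m -> C x' -> rnorm (adjoint_on V (U m) x' - adjoint_on V (U m0) x') <= e.
  move=> x Cx.
  (* The limit point [x] may lie outside [W], where the adjoint is not controlled; a nearby [p] in
     [C] replaces it. *)
  have [p Cp xp] : exists2 p, C p & rnorm (p - x) < e / 6.
    have /Cx[p []] : nbhs x [set p | rnorm (p - x) < e / 6].
      by apply: nbhs_rnorm; rewrite divr_gt0.
    by exists p.
  have [Va Ua] := unitaryK (U_unitary Zm0) (CW _ Cp).
  have e6 : 0 < e / 6 by rewrite divr_gt0.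
  have /within_rnormP/(_ m0 Zm0 _ e3) := U_strong Va.
  move=> /= near1.
  have Wp := CW _ Cp.
  near=> y m => /= Zm Cy.
  have Wy := CW _ Cy.
  have Hm : rnorm (U m (adjoint_on V (U m0) p) - U m0 (adjoint_on V (U m0) p))
    <= e / 3.
    by move: Zm; near: m; exact: near1.
  have yp : rnorm (y - p) <= e / 3.
    apply: (le_trans (rnorm_dist x _ _)).
    rewrite (rnormB x) (_ : e / 3 = e / 6 + e / 6); last by field.
    rewrite lerD ?(ltW xp) //.
    by apply: ltW; near: y; exact: nbhs_rnorm.
  apply: (le_trans (rnorm_dist (adjoint_on V (U m) p) _ _)).
  rewrite (unitary_adj_dist (U_unitary Zm)) //.
  rewrite (_ : e = e / 3 + (e / 3 + e / 3)); last by field.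
  apply: lerD => //.
  apply: (le_trans (rnorm_dist (adjoint_on V (U m0) p) _ _)).
  rewrite [X in _ + X <= _](unitary_adj_dist (U_unitary Zm0)) //.
  apply: lerD; last by rewrite rnormB.
  (* With [a] the preimage of [p] under [U m0], applying [U m] turns the distance into that of
     [U m0 a] and [U m a], which is small by strong continuity at [a]. *)
  rewrite -[X in _ - X](unitary_adjointK (U_unitary Zm)) //.
  rewrite (unitary_adj_dist (U_unitary Zm)) //;
    last exact: (unitary_img (U_unitary Zm)).
  by rewrite -{1}Ua rnormB.
have {}near_cov := cC T (nbhs m0) (fun m x => Z m -> C x ->
   rnorm (adjoint_on V (U m) x - adjoint_on V (U m0) x) <= e) (nbhs_filter m0)
     near_cov.
apply: filterS near_cov => m Hm Zm x Cx; apply: Hm => //; exact: subset_closure.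
Unshelve. all: by end_near. Qed.

(** [V] is not assumed stable under dilation, so linearity of [U m] cannot be applied to a multiple
    of the preimage of [y]. Instead the squared norm of the difference of the two sides is expanded,
    and every product is moved through [U m]. *)
Lemma adjointZ m (r : R) y : Z m -> 0 < r -> W y ->
  adjoint_on V (U m) (r%:C%C *: y) = r%:C%C *: adjoint_on V (U m) y.
Proof.
move=> Zm r0 Wy; have hU := U_unitary Zm.
have [Va Ua] := unitaryK hU Wy; have [Vb Ub] := unitaryK hU (WZ r0 Wy).
apply/eqP; rewrite -subr_eq0; apply/eqP/hdot_eq0.
case: (hU) => _ _ UU.
by rewrite hdotBl !hdotBr !hdotZl !hdotZr -!UU // Ua Ub !hdotZl !hdotZr; ring.
Qed.

(** A compact operator maps the unit ball to a set with compact closure, to which [adjoint_uniform]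
    applies; homogeneity extends the bound to all vectors. *)
Lemma adjoint_compact_uniform (F : E2 -> E2) m0 (e : R) : compact_on W F ->
  Z m0 -> 0 < e ->
  \forall m \near m0, Z m -> forall x, W x ->
    rnorm (adjoint_on V (U m) (F x) - adjoint_on V (U m0) (F x)) <= e * rnorm x.
Proof.
move=> [Flin FW Fcomp] Zm0 e0.
have F0 : F 0 = 0.
  have := Flin 1 0 0 W0 W0; rewrite scaler0 addr0 scale1r -[LHS]addr0.
  by move/addrI.
have CW : F @` (W `&` [set x | rnorm x <= 1]) `<=` W.
  by move=> _ [x [Wx _] <-]; apply: FW; exists x.
apply: filterS (adjoint_uniform CW Fcomp Zm0 e0) => m Hm Zm x Wx.
have [x0|x0] := eqVneq x 0.
  rewrite x0; suff adj0 k : Z k -> adjoint_on V (U k) 0 = 0.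
    by rewrite F0 !adj0 // subrr !rnorm0 mulr0.
  move=> Zk; apply: rnorm0_eq0.
  by rewrite (unitary_adj_norm (U_unitary Zk) W0) rnorm0.
have nx0 : 0 < rnorm x.
  by rewrite lt_def rnorm_ge0 andbT; apply: contra_neq x0 => /rnorm0_eq0.
pose x' := ((rnorm x)^-1)%:C%C *: x.
have Wx' : W x' by apply: WZ => //; rewrite invr_gt0.
have xE : x = (rnorm x)%:C%C *: x'.
  by rewrite scalerA -rmorphM /= mulfV ?gt_eqF // scale1r.
have FE : F x = (rnorm x)%:C%C *: F x'.
  by rewrite {1}xE; have := Flin (rnorm x)%:C%C x' 0 Wx' W0; rewrite F0 !addr0.
have Wf : W (F x') by apply: FW; exists x'.
rewrite FE !adjointZ // -scalerBr rnormZ ger0_norm ?rnorm_ge0 // mulrC ler_pM2r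
  //.
apply: Hm => //; exists x' => //; split=> //=.
by rewrite rnormZ ger0_norm ?invr_ge0 ?rnorm_ge0 // mulVf // gt_eqF.
Qed.

Variables (Z' : set T) (F : T -> E2 -> E2) (G : E2 -> E2) (m0 : T) (M : R).
Hypothesis Z'Z : Z' `<=` Z.
Hypothesis Z'm0 : Z' m0.
Hypothesis FW : forall m x, Z' m -> W x -> W (F m x).
Hypothesis F_cont : forall e : R, 0 < e -> \forall m \near m0, Z' m ->
  forall x, W x -> rnorm (F m x - F m0 x) <= e * rnorm x.
Hypothesis F_compact : compact_on W (F m0).
Hypothesis G_compact : compact_on W G.
Hypothesis FG : forall x y, W x -> W y -> hdot (F m0 x) y = hdot x (G y).
Hypothesis M0 : 0 <= M.
Hypothesis F_le : forall x, W x -> rnorm (F m0 x) <= M * rnorm x.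

(* The product of [F (U m z) - F (U m0 z)] with [r] is that of [z] with the
   variation of [adjoint_on V (U m) (G r)], so that strong continuity of the
   adjoints on the compact images of [F] and [G] suffices. *)
Lemma conj_continuous (e : R) : 0 < e -> \forall m \near m0, Z' m ->
  forall z, V z ->
    rnorm (adjoint_on V (U m) (F m (U m z)) -
           adjoint_on V (U m0) (F m0 (U m0 z))) <= e * rnorm z.
Proof.
move=> e0; have Zm0 := Z'Z Z'm0.
have e3 : 0 < e / 3 by rewrite divr_gt0.
(* The squared norm of [p - q] below is at most [2 * d * M * rnorm z ^+ 2], which this [d] brings
   under [(e / 3 * rnorm z) ^+ 2]; [M + 1] avoids a zero denominator. *)
pose d := (e / 3) ^+ 2 / (2 * (M + 1)).
have M1 : 0 < M + 1 by rewrite ltr_wpDl.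
have d0 : 0 < d by rewrite divr_gt0 ?exprn_gt0 // mulr_gt0.
have near1 := F_cont e3.
have near2 := adjoint_compact_uniform F_compact Zm0 e3.
have near3 := adjoint_compact_uniform G_compact Zm0 d0.
apply: filterS3 near1 near2 near3 => m H1 H2 H3 Z'm z Vz; have Zm := Z'Z Z'm.
have hU := U_unitary Zm; have hU0 := U_unitary Zm0.
set y := U m z; have Wy : W y := unitary_img hU Vz.
set y0 := U m0 z; have Wy0 : W y0 := unitary_img hU0 Vz.
have ny : rnorm y = rnorm z := unitary_norm hU Vz.
have ny0 : rnorm y0 = rnorm z := unitary_norm hU0 Vz.
set p := F m0 y; set q := F m0 y0.
have Wp : W p := FW Z'm0 Wy; have Wq : W q := FW Z'm0 Wy0.
have s1 : rnorm (adjoint_on V (U m) (F m y) - adjoint_on V (U m) p) <= e / 3 *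
  rnorm z.
  rewrite (unitary_adj_dist hU (FW Z'm Wy) Wp) -ny.
  exact: H1.
have s2 : rnorm (adjoint_on V (U m) p - adjoint_on V (U m0) p) <= e / 3 * rnorm
  z.
  by rewrite -ny; exact: H2.
have dot r : W r -> rnorm r <= M * rnorm z ->
    `|hdot (p - q) r| <= (d * M * rnorm z ^+ 2)%:C%C.
  move=> Wr nr; rewrite hdotBl !FG //.
  have WG : W (G r) by case: G_compact => _ + _; apply; exists r.
  rewrite (unitary_adj_dot hU) // (unitary_adj_dot hU0) // -hdotBr.
  apply: (le_trans (cauchy_schwarz _ _)); rewrite !rnormE -rmorphM lecR /=.
  have := H3 Zm _ Wr; move=> /(ler_wpM2l (rnorm_ge0 z)) /le_trans; apply.
  rewrite (_ : _ * (d * _) = d * rnorm z * rnorm r); last by ring.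
  rewrite (_ : _ * _ ^+ 2 = d * rnorm z * (M * rnorm z)); last by ring.
  by apply: ler_wpM2l => //; rewrite mulr_ge0 ?rnorm_ge0 // ltW.
have np : rnorm p <= M * rnorm z by rewrite -ny; exact: F_le.
have nq : rnorm q <= M * rnorm z by rewrite -ny0; exact: F_le.
have s3 : rnorm (p - q) <= e / 3 * rnorm z.
  rewrite -ler_sqr ?nnegrE ?rnorm_ge0 ?mulr_ge0 ?rnorm_ge0 ?(ltW e0) //.
  (* The square is the product of [p - q] with [p] minus its product with [q], each bounded by
     [dot]. *)
  have : rnorm (p - q) ^+ 2 <= d * M * rnorm z ^+ 2 + d * M * rnorm z ^+ 2.
    rewrite -lecR rmorphXn /= -rnormE -hdot_norm [X in X <= _]hdotBr.
    rewrite -[X in X <= _]ger0_norm;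
      last by rewrite -hdotBr hdot_norm exprn_ge0.
    by rewrite rmorphD /= (le_trans (ler_normB _ _)) // lerD ?dot.
  move=> /le_trans; apply.
  rewrite -mulrDl exprMn; apply: ler_wpM2r;
    first by rewrite exprn_ge0 ?rnorm_ge0.
  have -> : d * M + d * M = (e / 3) ^+ 2 * (M / (M + 1)).
    by rewrite /d; field; rewrite gt_eqF.
  by rewrite ler_piMr ?exprn_ge0 ?(ltW e3) // ler_pdivrMr // mul1r lerDl.
apply: (le_trans (rnorm_dist (adjoint_on V (U m) p) _ _)).
apply: (@le_trans _ _ (e / 3 * rnorm z + (e / 3 * rnorm z + e / 3 * rnorm z)));
  last first.
  by rewrite -!mulrDl; apply: ler_wpM2r; [exact: rnorm_ge0 | lra].
apply: lerD => //.
apply: (le_trans (rnorm_dist (adjoint_on V (U m0) p) _ _)); apply: lerD => //.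
by rewrite (unitary_adj_dist hU0).
Qed.
End StrongConjugation.

(** * Finite-dimensional linear algebra *)

Section LinearMaps.
Context {R : realType} {m n : nat}.

Lemma mx_cvgP {T} (F : set_system T) {FF : Filter F} (f : T -> 'M[R]_(m, n))
    (l : 'M[R]_(m, n)) :
  f @ F --> l <-> forall i j, (fun x => f x i j) @ F --> l i j.
Proof.
split=> [fl i j|fl].
  exact: (cvg_comp _ _ fl (@coord_continuous _ _ _ i j l)).
apply/cvg_ballP => e e0.
have H : \forall x \near F, forall i j, ball (l i j) e (f x i j).
  apply: filter_forall => i; apply: filter_forall => j.
  by move/cvg_ballP: (fl i j); apply.
by apply: filterS H => x H; split.
Qed.

Lemma linear_mx_continuous (V : normedModType R) (f : 'M[R]_(m, n) -> V) :
  (forall (c : R) X Y, f (c *: X + Y) = c *: f X + f Y) -> continuous f.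
Proof.
move=> flin.
have f0 : f 0 = 0.
  by have := flin 1 0 0; rewrite !scale1r addr0 -[LHS]addr0 => /addrI.
have fD X Y : f (X + Y) = f X + f Y by have := flin 1 X Y; rewrite !scale1r.
have fZ c X : f (c *: X) = c *: f X by have := flin c X 0;
  rewrite !addr0 f0 addr0.
have fE : f = fun X => \sum_i \sum_j X i j *: f (delta_mx i j).
  apply/funext => X; rewrite {1}[X]matrix_sum_delta (big_morph f fD f0).
  by apply: eq_bigr => i _; rewrite (big_morph f fD f0); apply: eq_bigr.
rewrite fE.
apply: (continuous_big (@add_continuous _)) => i _.
apply: (continuous_big (@add_continuous _)) => j _ X.
apply: continuousZr_tmp; exact: coord_continuous.
Qed.

End LinearMaps.

Section Subspaces.
Context {R : realType} {n : nat}.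
Implicit Types (V : set 'M[R]_n).

(** Among the vector spaces contained in [V], one of maximal dimension is all of [V], since a vector
    of [V] outside it would enlarge it. *)
Lemma subspace_vspace V : Defs.subspace V ->
  exists U : {vspace 'M[R]_n}, forall X, X \in U <-> V X.
Proof.
move=> [V0 Vlin].
pose P k := `[< exists U : {vspace 'M[R]_n}, (forall X, X \in U ->
  V X) /\ \dim U = k >].
have P0 : exists k, P k.
  exists 0%N; apply/asboolP; exists 0%VS; split; last exact: dimv0.
  by move=> X; rewrite memv0 => /eqP ->.
have Pub k : P k -> (k <= \dim {: 'M[R]_n})%N.
  by move=> /asboolP[U [_ <-]]; exact: (dimvS (subvf U)).
case: (ex_maxnP P0 Pub) => k /asboolP[U [UV Uk]] kmax.
exists U; move=> X; split; first exact: UV.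
move=> VX; apply: contrapT => /negP XU.
have : P (\dim (U + <[X]>)%VS).
  apply/asboolP; exists (U + <[X]>)%VS;
    split => // Y /memv_addP[u uU [v /vlineP[c ->] ->]].
  by rewrite addrC; apply: Vlin => //; exact: UV.
move=> /kmax; rewrite -Uk leqNgt => /negP; apply.
have sub : (U <= U + <[X]>)%VS by exact: addvSl.
rewrite ltn_neqAle dimvS // andbT; apply: contra XU => /eqP e.
have /eqP -> : U == (U + <[X]>)%VS by rewrite eqEdim sub e leqnn.
by rewrite (subvP (addvSr U _)) // memv_line.
Qed.

Lemma subspace_projection V : Defs.subspace V -> exists p : 'M[R]_n -> 'M[R]_n,
  [/\ forall (c : R) X Y, p (c *: X + Y) = c *: p X + p Y,
      forall X, V (p X) & forall X, V X -> p X = X].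
Proof.
move=> /subspace_vspace[U UV]; exists (projv U); split.
- by move=> c X Y; rewrite linearP.
- by move=> X; apply/UV; exact: memv_proj.
- by move=> X /UV XU; rewrite projv_id.
Qed.

(** [V] is the zero set of the continuous map [p X - X], for a linear projection [p] onto [V]. *)
Lemma subspace_closed V : Defs.subspace V -> closed V.
Proof.
move=> /subspace_projection[p [plin pV pid]].
have -> : V = (fun X => p X - X) @^-1` [set 0].
  apply/seteqP; split=> X /=; first by move=> /pid ->; rewrite subrr.
  by move=> /eqP; rewrite subr_eq0 => /eqP <-.
apply: closed_comp; last
  exact/accessible_closed_set1/hausdorff_accessible/norm_hausdorff.
move=> X _; apply: linear_mx_continuous => c Y Z.
by rewrite plin scalerBr opprD addrACA.
Qed.

(** Heine-Borel, carried over from row vectors by [vec_mx]. *)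
Lemma mx_bounded_closed_compact V (r : R) : closed V ->
  (forall X, V X -> `|X| <= r) -> compact V.
Proof.
move=> cV bV.
have vlin (c : R) (x y : 'rV[R]_(n * n)) :
  vec_mx (c *: x + y) = c *: vec_mx x + vec_mx y :> 'M[R]_n.
  by rewrite linearP.
have vcont : continuous (vec_mx : 'rV[R]_(n * n) ->
  'M[R]_n) by exact: linear_mx_continuous.
have -> : V = vec_mx @` (vec_mx @^-1` V).
  apply/seteqP; split=> [X VX|_ [x Vx <-]] //.
  by exists (mxvec X); rewrite /preimage /= mxvecK.
apply: continuous_compact; first exact: continuous_subspaceT.
apply: bounded_closed_compact; last by apply: closed_comp.
exists `|r|; split; first exact: num_real.
move=> M rM x /= /bV vx; apply: (le_trans _ (ltW rM)).
rewrite [leLHS]mx_normrE; apply/bigmax_leP => /=; split=> // -[i j] _ /=.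
rewrite ord1; case: (mxvec_indexP j) => k l.
have -> : x 0 (mxvec_index k l) = vec_mx x k l by rewrite mxE.
apply: (le_trans _ (le_trans vx (ler_norm r))).
rewrite [leRHS]mx_normrE.
exact: (le_bigmax _ (fun ij : 'I_n * 'I_n => `|vec_mx x ij.1 ij.2|) (k, l)).
Qed.

End Subspaces.

(** * One-parameter subgroups *)

Section OneParameter.
Context {R : realType} {n : nat}.
Implicit Types (X Y : 'M[R]_n) (f g : R -> 'M[R]_n).

Lemma is_derive_cvgP (W : normedModType R) (f : R -> W) (s : R) (d : W) :
  is_derive s (1 : R) f d <-> (fun h => h^-1 *: (f (h + s) - f s)) @ 0^' --> d.
Proof.
have e : (fun h : R => h^-1 *: (f (h + s) - f s)) =
    (fun h => h^-1 *: ((f \o shift s) (h *: (1 : R)) - f s)).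
  by apply/funext => h /=; rewrite /GRing.scale /= mulr1.
split=> [[df <-]|]; first by rewrite e.
rewrite e => fd; have df : derivable f s 1 by apply/cvg_ex; exists d.
by apply: (DeriveDef df); exact: cvg_lim.
Qed.

Lemma is_derive_linear (V W : normedModType R) (L : V -> W) (f : R -> V) s d :
  (forall (c : R) x y, L (c *: x + y) = c *: L x + L y) -> continuous L ->
  is_derive s (1 : R) f d -> is_derive s (1 : R) (L \o f) (L d).
Proof.
move=> Llin Lc /is_derive_cvgP fd; apply/is_derive_cvgP.
have -> : (fun h => h^-1 *: ((L \o f) (h + s) - (L \o f) s)) =
    L \o (fun h => h^-1 *: (f (h + s) - f s)).
  apply/funext => h /=.
  have L0 : L 0 = 0.
    by have := Llin 1 0 0; rewrite !scale1r addr0 -[LHS]addr0 => /addrI.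
  have LZ c x : L (c *: x) = c *: L x by have := Llin c x 0;
    rewrite !addr0 L0 addr0.
  have LB x y : L (x - y) = L x - L y.
    by have := Llin (-1) y x; rewrite !scaleN1r addrC => ->; rewrite addrC.
  by rewrite LZ LB.
exact: (cvg_comp _ _ fd (Lc d)).
Qed.

Lemma is_derive_entry f s X i j : is_derive s (1 : R) f X ->
  is_derive s (1 : R) (fun t => f t i j) (X i j).
Proof.
apply: (@is_derive_linear _ _ (fun M : 'M[R]_n => M i j)) => [c x y|].
  by rewrite !mxE.
exact: coord_continuous.
Qed.

Lemma is_derive_mulmx f g s X Y i j :
  is_derive s (1 : R) f X -> is_derive s (1 : R) g Y ->
  is_derive s (1 : R) (fun t => (f t *m g t) i j) ((X *m g s + f s *m Y) i j).
Proof.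
move=> fX gY.
have -> : (fun t => (f t *m g t) i j) =
    \sum_k ((fun t => f t i k) * (fun t => g t k j)).
  by apply/funext => t; rewrite mxE fct_sumE.
have -> : (X *m g s + f s *m Y) i j =
    \sum_k (f s i k *: Y k j + g s k j *: X i k).
  rewrite !mxE -big_split /=; apply: eq_bigr => k _.
  by rewrite addrC [g s k j *: _]mulrC.
by apply: is_derive_sum => k; apply: is_deriveM; exact: is_derive_entry.
Qed.

Variables (f : R -> 'M[R]_n) (X : 'M[R]_n).
Hypothesis fD : forall s t, f (s + t) = f s *m f t.
Hypothesis f0 : f 0 = 1%:M.
Hypothesis fX : is_derive (0 : R) (1 : R) f X.

Lemma hom_derive_l s : is_derive s (1 : R) f (X *m f s).
Proof.
have lin (c : R) (x y : 'M[R]_n) :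
  (c *: x + y) *m f s = c *: (x *m f s) + y *m f s.
  by rewrite mulmxDl scalemxAl.
move: (is_derive_linear lin (linear_mx_continuous lin) fX) => /is_derive_cvgP H.
apply/is_derive_cvgP; move: H.
by under eq_fun do rewrite /= addr0 f0 mul1mx -fD.
Qed.

Lemma hom_derive_r s : is_derive s (1 : R) f (f s *m X).
Proof.
have lin (c : R) (x y : 'M[R]_n) :
  f s *m (c *: x + y) = c *: (f s *m x) + f s *m y.
  by rewrite mulmxDr scalemxAr.
move: (is_derive_linear lin (linear_mx_continuous lin) fX) => /is_derive_cvgP H.
apply/is_derive_cvgP; move: H.
by under eq_fun do rewrite /= addr0 f0 mulmx1 -fD [s + _]addrC.
Qed.

Lemma hom_derive_scale (r : R) : is_derive (0 : R) (1 :
  R) (fun t => f (r * t)) (r *: X).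
Proof.
apply/is_derive_cvgP; apply/mx_cvgP => i j.
have H : is_derive (0 : R) (1 : R) ((fun t => f t i j) \o (fun t => r * t)) (X i
  j * r).
  apply: is_derive1_comp; first by rewrite mulr0; exact: is_derive_entry.
  have := @is_deriveZ R R R id r 0 1 1 (is_derive_id _ _).
  by rewrite /GRing.scale /= mulr1.
move/is_derive_cvgP: H => /=; rewrite [X i j * r]mulrC !mxE.
by under [X in _ -> X]eq_cvg do rewrite !mxE.
Qed.

End OneParameter.

Section OneParameterUnique.
Context {R : realType} {n : nat}.
Implicit Types (X Y : 'M[R]_n) (f g : R -> 'M[R]_n).

Let hom f := (forall s t, f (s + t) = f s *m f t) /\ f 0 = 1%:M.

Let homV f : hom f -> forall t, f (- t) *m f t = 1%:M /\ f t *m f (- t) = 1%:M.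
Proof. by move=> [fD f0] t; rewrite -!fD subrr addrC subrr. Qed.

Let hom_opp f : hom f -> hom (fun t => f (-1 * t)).
Proof. by move=> [fD f0]; split=> [s t|]; rewrite ?mulr0 // mulrDr fD. Qed.

(** The product of [f (- t)] and [g t] has derivative [f (- t) *m (- X + X) *m g t], which vanishes,
    so it keeps its value 1 at 0. *)
Lemma hom_unique f g X : hom f -> hom g ->
  is_derive (0 : R) (1 : R) f X -> is_derive (0 : R) (1 : R) g X -> f = g.
Proof.
move=> hf hg fX gX; case: (hom_opp hf) => oD o0; case: (hg) => gD g0.
case: (hf) => fD f0.
have oX := hom_derive_scale fX (-1).
pose p t := f (-1 * t) *m g t.
have p0 i j t : is_derive t (1 : R) (fun t => p t i j) 0.
  have := is_derive_mulmx i j (hom_derive_r oD o0 oX t) (hom_derive_l gD g0 gX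
    t).
  rewrite scaleN1r mulmxN mulNmx -mulmxA addNr.
  by rewrite mxE.
have p1 t : p t = 1%:M.
  transitivity (p 0); last by rewrite /p mulr0 f0 g0 mul1mx.
  by apply/matrixP => i j; exact: (is_derive_0_is_cst t 0 (p0 i j)).
apply/funext => t; have [_ fV] := homV hf t.
by rewrite -[f t]mulmx1 -(p1 t) /p mulN1r mulmxA fV mul1mx.
Qed.

(** Conjugating [Y] by [f t] gives a function of [t] with zero derivative, hence constantly [Y]. *)
Lemma hom_commute f X Y : hom f -> is_derive (0 : R) (1 : R) f X ->
  X *m Y = Y *m X -> forall t, f t *m Y = Y *m f t.
Proof.
move=> hf fX XY; case: (hom_opp hf) => oD o0; case: (hf) => fD f0.
have oX := hom_derive_scale fX (-1).
have YX t : is_derive t (1 : R) (fun t => Y *m f (-1 * t)) (Y *m (-1 *: X *m f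
  (-1 * t))).
  have lin (c : R) (x y : 'M[R]_n) : Y *m (c *: x + y) = c *: (Y *m x) + Y *m y.
    by rewrite mulmxDr scalemxAr.
  exact: (is_derive_linear lin (linear_mx_continuous lin) (hom_derive_l oD o0 oX
    t)).
pose p t := f t *m (Y *m f (-1 * t)).
have p0 i j t : is_derive t (1 : R) (fun t => p t i j) 0.
  have := is_derive_mulmx i j (hom_derive_r fD f0 fX t) (YX t).
  rewrite -mulmxA -mulmxDr scaleN1r mulNmx mulmxN !mulmxA XY subrr mulmx0.
  by rewrite mxE.
move=> t; have p1 : p t = Y.
  transitivity (p 0); last by rewrite /p mulr0 f0 mul1mx mulmx1.
  by apply/matrixP => i j; exact: (is_derive_0_is_cst t 0 (p0 i j)).
have [fV _] := homV hf t.
by rewrite -[in RHS]p1 /p mulN1r -!mulmxA fV mulmx1.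
Qed.

End OneParameterUnique.

(** * The exponential map, the adjoint action and the Lie algebra of A_P *)

Section GroupExponential.
Context {R : realType} (G : real_reductive R).
Local Notation rho := (@rho R G).
Local Notation B := (@Defs.form R G).
Local Notation mx := ('M[R]_(rdim G)).
Implicit Types (x y l w : G) (X Y : mx) (c : R -> G) (P : set G).

Lemma rho1 : rho 1%g = 1%:M. Proof. by case: (rho_faithful G). Qed.
Lemma rhoM x y : rho (x * y)%g = rho x *m rho y. Proof. by case: (rho_faithful
  G). Qed.
Lemma rho_inj : injective rho. Proof. by case: (rho_faithful G). Qed.
Lemma rho_continuous : continuous rho. Proof. by case: (rho_faithful G). Qed.

Lemma rhoVK x : rho x^-1%g *m rho x = 1%:M.
Proof. by rewrite -rhoM mulVg rho1. Qed.
Lemma rhoKV x : rho x *m rho x^-1%g = 1%:M.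
Proof. by rewrite -rhoM mulgV rho1. Qed.

Lemma Ad_linear x (c : R) X Y : Ad rho x (c *: X + Y) = c *: Ad rho x X + Ad rho
  x Y.
Proof. by rewrite /Ad mulmxDr mulmxDl -scalemxAr -scalemxAl. Qed.

Lemma AdZ x (c : R) X : Ad rho x (c *: X) = c *: Ad rho x X.
Proof. by rewrite /Ad -scalemxAr -scalemxAl. Qed.

Lemma Ad_continuous x : continuous (Ad rho x).
Proof. by apply: linear_mx_continuous => c X Y; exact: Ad_linear. Qed.

Lemma Ad1 X : Ad rho 1%g X = X.
Proof. by rewrite /Ad invg1 rho1 mul1mx mulmx1. Qed.

Lemma AdM x y X : Ad rho (x * y)%g X = Ad rho x (Ad rho y X).
Proof. by rewrite /Ad invgM !rhoM !mulmxA. Qed.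

Lemma AdK x X : Ad rho x^-1%g (Ad rho x X) = X.
Proof. by rewrite -AdM mulVg Ad1. Qed.

Lemma AdKV x X : Ad rho x (Ad rho x^-1%g X) = X.
Proof. by rewrite -AdM mulgV Ad1. Qed.

Lemma Ad_fix x X : Ad rho x X = X <-> rho x *m X = X *m rho x.
Proof.
rewrite /Ad; split=> [{2}<-|->]; last by rewrite -mulmxA rhoKV mulmx1.
by rewrite -!mulmxA rhoVK mulmx1.
Qed.

Lemma one_param0 c : one_param c -> c 0 = 1%g.
Proof. by move=> [_ cD]; have := cD 0 0;
  rewrite addr0 -{1}[c 0]mulg1 => /mulgI. Qed.

Lemma one_paramN c t : one_param c -> c (- t) = (c t)^-1%g.
Proof.
move=> oc; have [_ cD] := oc.
by apply: (mulgI (c t)); rewrite -cD subrr mulgV one_param0.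
Qed.

Lemma rho_one_param c : one_param c ->
  (forall s t, rho (c (s + t)) = rho (c s) *m rho (c t)) /\ rho (c 0) = 1%:M.
Proof. by move=> oc; rewrite one_param0 // rho1; case: oc => _ cD;
  split=> // s t; rewrite cD rhoM. Qed.

Lemma generated_unique c c' X :
  generated_by rho c X -> generated_by rho c' X -> c = c'.
Proof.
move=> [oc cX] [oc' cX'].
have := hom_unique (rho_one_param oc) (rho_one_param oc') cX cX'.
by move=> /funeqP e; apply/funext => t; apply: rho_inj; exact: e.
Qed.

Lemma generated_scale c X (r : R) : generated_by rho c X ->
  generated_by rho (fun t => c (r * t)) (r *: X).
Proof.
move=> [oc cX]; split; first split; last exact: (hom_derive_scale cX).
  move=> t; apply: continuous_comp; last by case: oc => cc _; exact: cc.
  exact: mulrl_continuous.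
by move=> s t; case: oc => _ cD; rewrite mulrDr cD.
Qed.

Lemma gexp_generated c X : generated_by rho c X -> gexp rho X = c 1.
Proof.
move=> gc; apply: xget_unique; first by exists c.
by move=> _ [c' [gc' <-]]; rewrite (generated_unique gc gc').
Qed.

Lemma gexp_one_param c X : generated_by rho c X ->
  forall t, c t = gexp rho (t *: X).
Proof. by move=> gc t; rewrite (gexp_generated (generated_scale t gc)) mulr1.
  Qed.

Lemma generated_conj c X l : generated_by rho c X ->
  generated_by rho (fun t => (l * c t * l^-1)%g) (Ad rho l X).
Proof.
move=> [oc cX]; split; first split.
- move=> t; have [cc _] := oc.
  have c1 : continuous (fun x : G => (l * x * l^-1)%g).
    move=> x.
    have l1 : (fun x : G => (l * x)%g) @ x --> (l * x)%g.
      exact: (cvg_comp (fun y : G => (l, y)) (fun p : G * G => (p.1 * p.2)%g)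
        (cvg_pair (cvg_cst l) cvg_id) (topmul_continuous (l, x))).
    exact: (cvg_comp (fun y : G => ((l * y)%g, l^-1%g)) (fun p :
      G * G => (p.1 * p.2)%g)
        (cvg_pair l1 (cvg_cst _)) (topmul_continuous ((l * x)%g, l^-1%g))).
  exact: (continuous_comp (cc t) (c1 _)).
- move=> s t; have [_ cD] := oc.
  by rewrite cD !mulgA mulgVK.
have := is_derive_linear (Ad_linear l) (@Ad_continuous l) cX.
by congr is_derive; apply/funext => t /=; rewrite /Ad !rhoM.
Qed.

Lemma asub_generated X : asub X -> exists c, generated_by rho c X.
Proof. by move=> /asub_minus[[c [gc _]] _]; exists c. Qed.

Lemma asubZ (t : R) X : asub X -> asub (t *: X).
Proof. by case: (asub_subspace G) => a0 alin aX; have := alin t X 0 aX a0;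
  rewrite addr0. Qed.

Lemma gexp_commute X Y : asub X -> X *m Y = Y *m X ->
  rho (gexp rho X) *m Y = Y *m rho (gexp rho X).
Proof.
move=> /asub_generated[c gc] XY; rewrite (gexp_generated gc).
by case: gc => oc cX; exact: (hom_commute (rho_one_param oc) cX XY).
Qed.

Lemma asub_comm X Y : asub X -> asub Y -> X *m Y = Y *m X.
Proof. by move=> aX aY; have /eqP := asub_abelian aX aY;
  rewrite subr_eq0 => /eqP. Qed.

Lemma theta_gA x : gA x -> theta x = x^-1%g.
Proof.
move=> [X aX <-]; have [c gc] := asub_generated aX.
have [_ /(_ 1)] := asub_minus aX; rewrite scale1r => ->.
rewrite -(gexp_one_param gc) -[X in gexp _ X]scale1r -(gexp_one_param gc).
by case: gc => oc _; rewrite one_paramN.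
Qed.

(** Differentiating at 0, the generator of a one-parameter group in A_P commutes with whatever the
    group commutes with. Conversely, if [Ad l] fixes the generator, then [l] commutes with the
    group, by uniqueness of one-parameter groups. In this form [aP P] is visibly a linear
    subspace. *)
Lemma aPE P : aP P = [set X | asub X /\ forall l, levi P l -> Ad rho l X = X].
Proof.
apply/seteqP; split=> X.
  move=> [c [gc cP]]; have [oc cX] := gc; have gE := gexp_one_param gc.
  have [rD r0] := rho_one_param oc.
  have X_comm Y : (forall t, rho (c t) *m Y = Y *m rho (c t)) ->
    X *m Y = Y *m X.
    move=> cY.
    have lin1 (r : R) (x y : mx) : (r *: x + y) *m Y = r *: (x *m Y) + y *m Y.
      by rewrite mulmxDl scalemxAl.
    have lin2 (r : R) (x y : mx) : Y *m (r *: x + y) = r *: (Y *m x) + Y *m y.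
      by rewrite mulmxDr scalemxAr.
    have d1 := is_derive_linear lin1 (linear_mx_continuous lin1) cX.
    have d2 := is_derive_linear lin2 (linear_mx_continuous lin2) cX.
    case: d1 => _ <-; case: d2 => _ <-; congr (derive _ 0 (1 : R)).
    by apply/funext => t /=; exact: cY.
  split.
    (* [theta] inverts A, which puts the generator in s; it commutes with [asub], and maximality
       does the rest. *)
    apply: asub_maximal.
      split; first by exists c.
      move=> t; rewrite -!gE theta_gA ?one_paramN //; by case: (cP t).
    move=> Y aY; apply/eqP; rewrite subr_eq0; apply/eqP; apply: X_comm => t.
    have [[Z aZ <-] _] := cP t; apply: gexp_commute => //; exact: asub_comm.
  move=> l Pl; apply/Ad_fix; apply/esym/X_comm => t.
  by rewrite -!rhoM; case: (cP t) => _ ->.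
move=> /= [aX lX]; have [c gc] := asub_generated aX.
exists c; split => // t; split.
  by exists (t *: X); [exact: asubZ | rewrite -(gexp_one_param gc)].
move=> l Pl; have := generated_conj l gc; rewrite lX // => gl.
by rewrite [in LHS](generated_unique gc gl) mulgVK.
Qed.

End GroupExponential.

(** Since the maps commute and have order dividing 4 on [A], a word acts through the number of
    occurrences of each letter modulo 4. Each letter of [r] contributes a factor ['I_4] to the index
    type. *)
Lemma abelian_words_finite (I : eqType) (X : Type) (A : set X) (T : I -> X ->
  X) :
  (forall j x, A x -> A (T j x)) ->
  (forall i j x, A x -> T i (T j x) = T j (T i x)) ->
  (forall j x, A x -> iter 4 (T j) x = x) ->
  forall r : seq I, exists (J : finType) (L : J -> X -> X),
    forall js, all (mem r) js -> exists k, forall x, A x ->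
      foldr T x js = L k x.
Proof.
move=> TA TC T4; elim=> [|j r [J [L JL]]].
  exists unit, (fun _ x => x) => -[|//] _; by exists tt.
exists ('I_4 * J)%type, (fun (k :
  'I_4 * J) x => iter k.1 (T j) (L k.2 x)) => js jsr.
have fA x s : A x -> A (foldr T x s).
  by move=> Ax; elim: s => //= i s IH; exact: TA.
have iA x k : A x -> A (iter k (T j) x).
  by move=> Ax; elim: k => //= k IH; exact: TA.
have iC x i k : A x -> T i (iter k (T j) x) = iter k (T j) (T i x).
  by move=> Ax; elim: k => //= k IH; rewrite TC ?IH //; exact: iA.
(* All occurrences of [j] are moved to the outside of the word. *)
have split_js x : A x -> foldr T x js =
    iter (count_mem j js) (T j) (foldr T x [seq i <- js | i != j]).
  move=> Ax; elim: js {jsr} => //= i s ->; case: eqVneq => [->|ij] //=.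
  by rewrite iC //; exact: fA.
have imod x k : A x -> iter k (T j) x = iter (k %% 4) (T j) x.
  move=> Ax; rewrite {1}(divn_eq k 4); elim: (k %/ 4)%N => [|q IH];
    first by rewrite mul0n.
  by rewrite mulSn -addnA iterD T4 //; exact: iA.
have [|k kL] := JL [seq i <- js | i != j].
  apply/allP => i; rewrite mem_filter => /andP[ij] /(allP jsr).
  by move=> /=; rewrite inE (negPf ij).
have lt4 : (count_mem j js %% 4 < 4)%N by rewrite ltn_mod.
exists (Ordinal lt4, k) => x Ax /=.
by rewrite split_js // (imod _ _ (fA _ _ Ax)) kL.
Qed.

(** * The subspace a_P and its normalizer in K *)

Section Parabolic.
Context {R : realType} (G : real_reductive R).
Local Notation rho := (@rho R G).
Local Notation B := (@Defs.form R G).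
Local Notation mx := ('M[R]_(rdim G)).
Implicit Types (x y l w : G) (X Y : mx) (P : set G).

Lemma aP_subspace P : Defs.subspace (aP P).
Proof.
case: (asub_subspace G) => a0 alin; rewrite aPE; split=> /=.
  by split=> // l _; rewrite /Ad mulmx0 mul0mx.
move=> c X Y [aX lX] [aY lY]; split=> [|l Pl]; first exact: alin.
by rewrite Ad_linear lX // lY.
Qed.

Lemma aP_closed P : closed (aP P).
Proof. exact: (subspace_closed (aP_subspace P)). Qed.

Lemma aPZ P (t : R) X : aP P X -> aP P (t *: X).
Proof.
by case: (aP_subspace P) => a0 alin aX; have := alin t X 0 aX a0; rewrite addr0.
Qed.

Lemma aP_lie P X : aP P X -> lie rho setT X.
Proof. by rewrite aPE => -[/asub_minus[lX _] _]. Qed.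

Lemma form_linear_r P (c : R) X Y Z : aP P X -> aP P Y -> aP P Z ->
  B Z (c *: X + Y) = c * B Z X + B Z Y.
Proof.
move=> aX aY aZ.
have aXY : aP P (c *: X + Y) by case: (aP_subspace P) => _; apply.
by rewrite form_sym ?form_linear 1?form_sym ?[B Y _]form_sym //;
  apply: (@aP_lie P).
Qed.

Lemma theta1 : @theta R G 1%g = 1%g.
Proof.
by have := theta_mul (1%g : G) 1%g;
  rewrite mulg1 -{1}[theta _]mulg1 => /mulgI/esym.
Qed.

Lemma thetaV x : theta x^-1%g = (theta x)^-1%g :> G.
Proof. by apply: (mulgI (theta x)); rewrite -theta_mul !mulgV theta1. Qed.

Lemma gK_inv x : gK G x -> gK G x^-1%g.
Proof. by rewrite /gK /cartan_fixed /= thetaV => ->. Qed.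

Lemma gK_mul x y : gK G x -> gK G y -> gK G (x * y)%g.
Proof. by rewrite /gK /cartan_fixed /= theta_mul => -> ->. Qed.

Lemma normKa_inv P w : normKa P w -> normKa P w^-1%g.
Proof.
move=> [Kw wP]; split; first exact: gK_inv.
apply/seteqP; split=> X.
  by case=> Y PY <-; move: PY; rewrite -{1}wP => -[Z PZ <-]; rewrite AdK.
by move=> PX; exists (Ad rho w X); rewrite ?AdK // -wP; exists X.
Qed.

Lemma normKa_aP P w X : normKa P w -> aP P X -> aP P (Ad rho w X).
Proof. by move=> [_ wP] PX; rewrite -wP; exists X. Qed.

End Parabolic.

(** * Finiteness of the action of [Ssigma] on a_P *)

Section FiniteSsigma.
Context {R : realType} (G : real_reductive R) (muK : borel_measure G R).
Context (D : series_data G).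
Local Notation rho := (@rho R G).
Local Notation mx := ('M[R]_(rdim G)).
Hypothesis Dsl2 : sl2_data D.
Hypothesis DR : R_group_data muK D.
Hypothesis Dfund : fundamental_domain D.

Lemma SL2_rot_order : SL2_rot R *m SL2_rot R *m (SL2_rot R *m SL2_rot R) = 1%:M.
Proof.
have -> : SL2_rot R *m SL2_rot R = (-1)%:M.
  by apply/matrixP => i j; rewrite !mxE !big_ord_recl big_ord0 !mxE;
     case: i => -[|[|//]] ?; case: j => -[|[|//]] ?; rewrite /= ?expr0 ?expr1;
       ring.
by rewrite -scalar_mxM mulrNN mulr1.
Qed.

(** [sl2_element j] is the image under a group morphism of the quarter turn of SL(2), whose fourth
    power is 1. *)
Lemma sl2_element_order j X : Ad rho (sl2_element (D := D) j)
  (Ad rho (sl2_element j) (Ad rho (sl2_element j) (Ad rho (sl2_element j) X))) =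
    X.
Proof.
have [_ [_ [SLM _]]] := Dsl2; have [_ {}SLM] := SLM j.
have r1 : SL2 (SL2_rot R).
  rewrite /SL2 /= (expand_det_row _ 0) !big_ord_recl big_ord0 /cofactor
    !det_mx11 !mxE /=.
  by rewrite ?expr0 ?expr1; ring.
have r2 : SL2 (SL2_rot R *m SL2_rot R) by rewrite /SL2 /= det_mulmx r1 mulr1.
have s1 : SL2 (1%:M : 'M[R]_2) by rewrite /SL2 /= det1.
have SL1 : SL2_map (s:=D) j 1%:M = 1%g.
  by have := SLM _ _ s1 s1; rewrite mulmx1 -{1}[SL2_map _ _]mulg1 =>
    /mulgI/esym.
have e : (sl2_element (D := D) j * sl2_element j * (sl2_element j * sl2_element
  j))%g = 1%g.
  by rewrite /sl2_element -!SLM // SL2_rot_order.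
by rewrite -!AdM -mulgA e Ad1.
Qed.

(** Estimates for the rescaled operators are made one representative [w] at a time; finitely many
    representatives, whose translates of [fundom D] cover a_P, make them uniform in [nu]. *)
Lemma fundom_finite : exists (J : finType) (wk : J ->
  G), forall nu, aP (parab D) nu ->
  exists k, Ssigma D (wk k) /\ fundom D (Ad rho (wk k)^-1%g nu).
Proof.
have [_ [_ [_ [_ [_ sN]]]]] := Dsl2; have [sC _ _ _ _] := DR.
have [J [L JL]] := abelian_words_finite
  (T := fun j => Ad rho (sl2_element (D := D) j)) (A := aP (parab D))
  (fun j x => normKa_aP (sN j)) sC (fun j x _ => sl2_element_order j x)
  (enum 'I_(rank D)).
pose valid k (w : G) := Ssigma D w /\
  forall nu, aP (parab D) nu -> Ad rho w nu = L k nu.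
(* The value at [k] is an element of [Ssigma] acting as the word [L k], or the default 1 if there is
   none; the index chosen below always has one. *)
exists J, (fun k => xget 1%g [set w | valid k w]) => nu Pnu.
have [_ /(_ _ Pnu)[nu' [[nuF [w Sw nuE]] _]]] := Dfund.
have [Nw [js wjs]] := Sw.
have [|k kL] := JL js; first by apply/allP => j _; rewrite /= mem_enum.
have vw : valid k w by split=> // mu Pmu; rewrite wjs ?kL.
exists k; have [Sk Lk] := xgetI 1%g (vw : [set w | valid k w] w); split=> //.
have Pnu' : aP (parab D) nu'.
  by rewrite -[nu'](AdK w) -nuE; apply: normKa_aP Pnu; exact: normKa_inv.
by rewrite nuE; case: vw => _ ->; rewrite // -Lk // AdK.
Qed.

End FiniteSsigma.

(** * Principal series spaces *)

Section LowerIntegral.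
Context d (T : measurableType d) (R : realType) (mu : {measure set T ->
  \bar R}).
Local Open Scope ereal_scope.
Import HBNNSimple.

(* The integral of a nonnegative function is the supremum of the integrals of
   the simple functions below it, so these two need no measurability. *)
Lemma ge0_le_integral_nm (D : set T) (f g : T -> \bar R) :
  (forall x, D x -> 0 <= f x) -> (forall x, D x -> f x <= g x) ->
  \int[mu]_(x in D) f x <= \int[mu]_(x in D) g x.
Proof.
move=> f0 fg.
have g0 x : D x -> 0 <= g x by move=> Dx; exact: le_trans (f0 x Dx) (fg x Dx).
rewrite !ge0_integralE //; apply: le_ereal_sup => _ [h /= hf <-].
exists h => //= x; apply: (le_trans (hf x)); rewrite !patchE.
by case: ifPn => // /set_mem; exact: fg.
Qed.

Lemma ge0_integralZl_nm (D : set T) (f : T -> R) (k : R) : (0 < k)%R ->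
  (forall x, D x -> 0 <= f x)%R ->
  \int[mu]_(x in D) (k * f x)%:E <= k%:E * \int[mu]_(x in D) (f x)%:E.
Proof.
move=> k0 f0.
have kV0 : (0 <= k^-1)%R by rewrite invr_ge0 ltW.
rewrite ge0_integralE; last by move=> x Dx; rewrite lee_fin mulr_ge0 ?f0 // ltW.
apply/ge_ereal_sup => _ [h /= hf <-].
have -> : sintegral mu h = k%:E * sintegral mu (scale_nnsfun h kV0).
  rewrite (sintegralrM mu k^-1 h) muleA -EFinM mulfV ?mul1e //.
  by rewrite gt_eqF.
rewrite lee_pmul2l //; rewrite ge0_integralE; last by move=> x Dx;
  rewrite lee_fin f0.
apply: ereal_sup_ubound; exists (scale_nnsfun h kV0) => //= x.
have := hf x; rewrite !patchE; case: ifPn => _.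
  by rewrite !lee_fin ler_pdivrMl.
rewrite !lee_fin => hx; rewrite mulr_ge0_le0 //.
Qed.
End LowerIntegral.

Section Induced.
Context {R : realType} (G : real_reductive R) (muK : borel_measure G R).
Context (D : series_data G).
Hypothesis Dpair : discrete_pair (parab D) (@sigma R G D).
Hypothesis DL2 : L2K_space muK D.
Local Notation P := (parab D).
Local Notation sigma := (@sigma R G D).

Lemma L2K0 : L2K muK (D := D) (fun=> 0).
Proof.
split=> [v|].
  by split; rewrite hdot0l; exact: measurable_cst.
rewrite (eq_integral (cst 0%E)) ?integral0 // => k _.
by rewrite rnorm0 expr0n.
Qed.

Lemma L2KZ (r : R) phi : 0 < r -> L2K muK (D := D) phi ->
  L2K muK (D := D) (fun k => r%:C%C *: phi k).
Proof.
move=> r0 [mphi iphi]; split=> [v|].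
  have [m1 m2] := mphi v.
  split.
    rewrite (_ : (fun x => _) = fun k :
      borel G => r * complex.Re (hdot (phi k) v)).
      exact: measurable_funM.
    by apply/funext => k; rewrite hdotZl; case: (hdot _ _) => a b /=;
      rewrite mul0r subr0.
  rewrite (_ : (fun x => _) = fun k :
    borel G => r * complex.Im (hdot (phi k) v)).
    exact: measurable_funM.
  by apply/funext => k; rewrite hdotZl; case: (hdot _ _) => a b /=;
    rewrite mul0r addr0.
(* Only scalar products of [phi] with fixed vectors are given as measurable, so the integral of the
   squared norm is handled by the lemmas on lower integrals. *)
apply: (@le_lt_trans _ _ (\int[muK]_(k in gK G) (r ^+ 2 * (rnorm (phi k)) ^+
  2)%:E)%E).
  apply: ge0_le_integral_nm => k _; rewrite lee_fin ?exprn_ge0 ?rnorm_ge0 //.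
  by rewrite rnormZ exprMn real_normK ?num_real.
have f0 (k : borel G) : gK G k -> 0 <= rnorm (phi k) ^+ 2.
  by rewrite exprn_ge0 ?rnorm_ge0.
apply: (le_lt_trans (ge0_integralZl_nm muK (exprn_gt0 2 r0) f0)).
by rewrite lte_mul_pinfty // lee_fin exprn_ge0 // ltW.
Qed.

Lemma K_levi_leviM l : gK G l -> levi P l -> leviM P l.
Proof.
move=> Kl Ll; split=> // H _ _ _ /(_ (gK G `&` levi P)); apply; last by [].
- have [[cP [P1 PM PV] _] _ _ _] := Dpair; split.
  + by split; [exact: theta1 | split; rewrite ?theta1].
  + move=> x y [Kx [Px Px']] [Ky [Py Py']]; split; first exact: gK_mul.
    by split; rewrite ?theta_mul; exact: PM.
  + move=> x [Kx [Px Px']]; split; first exact: gK_inv.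
    by split; rewrite ?thetaV; exact: PV.
- have [[cP _ _] _ _ _] := Dpair.
  apply: compact_closedI; first exact: K_compact.
  apply: closedI => //; apply: closed_comp cP => x _; exact: theta_continuous.
- by move=> x [].
Qed.

Lemma levi_inv l : levi P l -> levi P l^-1%g.
Proof.
have [[_ [_ _ PV] _] _ _ _] := Dpair.
by move=> [Px Px']; split; rewrite ?thetaV; exact: PV.
Qed.

Lemma sigma_linear l (c : R[i]) u v : gK G l -> levi P l ->
  sigma l^-1%g (c *: u + v) = c *: sigma l^-1%g u + sigma l^-1%g v.
Proof.
move=> Kl Ll; have [_ [sU _ _ _] _ _] := Dpair.
by have [-> //] := sU _ (K_levi_leviM (gK_inv Kl) (levi_inv Ll)).
Qed.

Lemma sigma0 l : gK G l -> levi P l -> sigma l^-1%g 0 = 0.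
Proof.
move=> Kl Ll; have := sigma_linear 1 0 0 Kl Ll.
by rewrite !scale1r addr0 -[LHS]addr0 => /addrI.
Qed.

Lemma cls0 : cls (s:=D) (fun=> 0) = 0.
Proof.
have [_ lin _] := DL2; have := lin 1 _ _ L2K0 L2K0.
rewrite (_ : (fun k => _) = fun=> 0); last by apply/funext => k;
  rewrite scaler0 addr0.
by rewrite scale1r -{1}[cls _]addr0 => /addrI/esym.
Qed.

Lemma Ind0 : Ind muK D sigma 0.
Proof.
exists (fun=> 0); last exact: cls0.
by split=> [|k l Kk Kl Ll]; [exact: L2K0 | rewrite sigma0].
Qed.

Lemma IndZ (r : R) x : 0 < r -> Ind muK D sigma x ->
  Ind muK D sigma (r%:C%C *: x).
Proof.
move=> r0 [phi [Lphi cphi] <-]; exists (fun k => r%:C%C *: phi k).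
  split=> [|k l Kk Kl Ll]; first exact: L2KZ.
  by have := sigma_linear r%:C%C (phi k) 0 Kl Ll; rewrite sigma0 // !addr0 cphi.
have [_ lin _] := DL2; have := lin r%:C%C _ _ Lphi L2K0.
rewrite cls0 addr0 => <-; congr cls; by apply/funext => k; rewrite addr0.
Qed.

End Induced.

(** * Continuity of the rescaling automorphisms *)

Lemma near_finite_set {T : Type} (F : set_system T) {FF : Filter F} (I : Type)
    (J : set I) (P : I -> T -> Prop) : finite_set J ->
  (forall i, J i -> \forall x \near F, P i x) ->
  \forall x \near F, forall i, J i -> P i x.
Proof.
(* [I] is a bare type; [{classic I}] gives it the equality needed to enumerate [J]. *)
move=> /(@finite_seqP {classic I})[s ->].
elim: s => [|i s IH] H; first by apply: nearW => x i.
have H1 := H i (mem_head i s).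
have H2 : \forall x \near F, forall j, [set` s] j -> P j x.
  by apply: IH => j sj; apply: H; rewrite /= inE (sj : j \in s) orbT.
apply: filterS2 H1 H2 => x Pi Ps j /=.
by rewrite inE => /predU1P[->//|]; exact: Ps.
Qed.

Section Rescaling.
Context {R : realType} (G : real_reductive R) (muK mu : borel_measure G R).
Context (A : cstar R) (iota : (G -> R[i]) -> A).
Context (I : Type) (D : I -> series_data G) (Phi : A -> op_family D).
Arguments Phi : clear implicits.
Hypothesis HD : series_representatives muK D.
Hypothesis HPhi : plancherel_iso muK mu iota Phi.
Local Notation rho := (@rho R G).
Local Notation B := (@Defs.form R G).
Local Notation mx := ('M[R]_(rdim G)).
Local Notation IndS i := (Ind muK (D i) (@sigma R G (D i))).

Let spec i : series_spec muK (D i). Proof. by case: HD => + _; apply. Qed.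

Lemma chamber_aP i nu : chamber (D i) nu -> aP (parab (D i)) nu.
Proof. by case. Qed.

Let pos_aP i al : pos (D i) al -> aP (parab (D i)) al.
Proof. by case: (spec i) => _ _ _ [[rP _ _ _ [pr _ _ _]] _ _ _] /pr /rP. Qed.

Lemma chamberZ i (t : R) nu : 0 < t -> chamber (D i) nu ->
  chamber (D i) (t *: nu).
Proof.
move=> t0 [Pnu nuc]; split=> [|al pal]; first exact: aPZ.
have [a0 _] := aP_subspace (parab (D i)).
have := form_linear_r t Pnu a0 (pos_aP pal).
have B0 : B al 0 = 0.
  by have := form_linear_r 1 a0 a0 (pos_aP pal);
    rewrite scaler0 addr0 mul1r -[LHS]addr0 => /addrI.
by rewrite !addr0 B0 addr0 => ->; rewrite mulr_ge0 ?nuc // ltW.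
Qed.

Lemma chamber_ball_compact i (r : R) :
  compact (chamber (D i) `&` [set nu | `|nu| <= r]).
Proof.
apply: (@mx_bounded_closed_compact _ _ _ r); last by move=> X [].
have [p [plin pP pid]] := subspace_projection (aP_subspace (parab (D i))).
(* [B al] is known to be linear only on a_P; composed with the projection [p] it becomes linear,
   hence continuous, on all matrices. *)
have -> : chamber (D i) `&` [set nu | `|nu| <= r] =
  (aP (parab (D i)) `&` \bigcap_(al in pos (D i)) [set nu | 0 <= B al (p nu)])
    `&`
  [set nu | `|nu| <= r].
  apply/seteqP; split=> nu [[Pnu nuc] nur]; split=> //; split=> // al pal.
    by rewrite /= pid //; exact: nuc.
  by have := nuc al pal; rewrite /= pid.
apply: closedI; first apply: closedI; first exact: aP_closed.
  apply: closed_bigI => al pal.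
  apply: (@closed_comp _ _ (fun nu => B al (p nu)) [set x | 0 <= x]);
    last exact: closed_ge.
  move=> x _; apply: linear_mx_continuous => c X Y; rewrite plin.
  by apply: form_linear_r (pP X) (pP Y) (pos_aP pal).
apply: (@closed_comp _ _ (fun nu : mx => `|nu|) [set x | x <= r]);
  last exact: closed_le.
by move=> x _; exact: norm_continuous.
Qed.

(** * The rescaled operators for one representative [w] in [Ssigma] *)

Section FixedRepresentative.
Context (i : I) (w : G) (Sw : Ssigma (D i) w).
Local Notation P := (parab (D i)).
Local Notation tau := (twist w^-1%g (@sigma R G (D i))).
Local Notation U := (knapp_stein (s:=D i) w tau).
Local Notation V := (Ind muK (D i) tau).
Local Notation W := (IndS i).

Let Nw : normKa P w. Proof. by case: Sw. Qed.

Let tauK : twist w tau = @sigma R G (D i).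
Proof.
apply/funext => x; rewrite /twist invgK; congr sigma.
by rewrite !mulgA mulgV mul1g -mulgA mulgV mulg1.
Qed.

Let tau_orbit : orbit_rep (D:=D i) tau.
Proof. by exists w^-1%g => //; exact: normKa_inv. Qed.

Lemma intertwiner_unitary nu : aP P nu -> unitary_on V W (U nu).
Proof.
move=> Pnu; have [_ _ [ks1 _] _] := spec i.
by have [+ _] := ks1 w tau nu Nw tau_orbit Pnu; rewrite tauK.
Qed.

Lemma intertwiner_strong x : V x ->
  {within aP P, continuous (fun nu => U nu x)}.
Proof. by move=> Vx; have [_ _ [_ [ks2 _]] _] := spec i; exact: ks2. Qed.

(* Transport of [Phi a i] to the fixed space [V] by the intertwiners, which
   turns the rescaled operators into dilates of one function. *)
Definition transported (a : A) (nu : mx) (z : Defs.space (D i)) :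
    Defs.space (D i) :=
  adjoint_on V (U nu) (Phi a i (Ad rho w nu) (U nu z)).

Lemma Phi_Ind a nu x : chamber (D i) nu -> W x -> W (Phi a i nu x).
Proof.
move=> cnu Wx; have [_ _ _ c0 _] := HPhi.
by have [/(_ i nu cnu)[_ FW _] _ _ _ _] := c0 a; apply: FW; exists x.
Qed.

Lemma Phi_norm a nu x : chamber (D i) nu -> W x ->
  rnorm (Phi a i nu x) <= rnorm a * rnorm x.
Proof.
move=> cnu Wx; have [_ _ nrm _ _] := HPhi.
by have [/(_ (lexx _)) H _] := nrm a _ (rnorm_ge0 a); exact: H.
Qed.

(** This is [conj_continuous] for the operators of [a], which are compact and norm continuous in
    [nu]; the compact operator of [cadj a] is the adjoint at [nu0]. *)
Lemma transported_continuous a nu0 (e : R) : aP P nu0 ->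
  chamber (D i) (Ad rho w nu0) ->
  0 < e -> \forall nu \near nu0, aP P nu /\ chamber (D i) (Ad rho w nu) ->
  forall z, V z -> rnorm (transported a nu z - transported a nu0 z) <= e * rnorm
    z.
Proof.
move=> Pnu0 cnu0 e0; have [dp DL2 _ _] := spec i.
have [_ alg _ c0 _] := HPhi.
have c0a := c0 a; have [cpt cont _ _ _] := c0a.
have [cpt' _ _ _ _] := c0 (cadj a).
apply: (@conj_continuous _ _ _ _ V W (aP P) (fun nu => U nu) (Ind0 dp DL2)
  (IndZ dp DL2) intertwiner_unitary intertwiner_strong
  [set nu | aP P nu /\ chamber (D i) (Ad rho w nu)]
  (fun nu => Phi a i (Ad rho w nu)) (Phi (cadj a) i (Ad rho w nu0)) nu0 (rnorm
    a)) => //.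
- by move=> nu [].
- by move=> nu x [_ cnu]; exact: Phi_Ind.
- move=> e' e'0; have [d d0 Hd] := cont i _ e' cnu0 e'0.
  have : \forall nu \near nu0, `|Ad rho w nu - Ad rho w nu0| < d.
    have /cvgrPdist_lt/(_ _ d0) := @Ad_continuous _ _ w nu0.
    by apply: filterS => nu; rewrite distrC.
  by apply: filterS => nu nud [_ cnu] x Wx; exact: Hd.
- exact: cpt.
- exact: cpt'.
- move=> x y Wx Wy.
  have [_ _ H] := alg i _ y x a 0 0 cnu0 Wy Wx.
  by rewrite hdotC -H -hdotC.
- exact: rnorm_ge0.
- by move=> x Wx; exact: Phi_norm.
Qed.

Lemma transported_norm a nu z : aP P nu -> chamber (D i) (Ad rho w nu) -> V z ->
  rnorm (transported a nu z) = rnorm (Phi a i (Ad rho w nu) (U nu z)).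
Proof.
move=> Pnu cnu Vz; have Un := intertwiner_unitary Pnu.
by rewrite /transported (unitary_adj_norm Un) //;
  exact: Phi_Ind (unitary_img Un Vz).
Qed.

Lemma transported_uniform a (r t0 e : R) : 0 < t0 -> 0 < e ->
  \forall t \near t0, forall nu, chamber (D i) nu -> `|nu| <= r ->
    forall z, V z ->
    rnorm (transported a (t^-1 *: Ad rho w^-1%g nu) z -
           transported a (t0^-1 *: Ad rho w^-1%g nu) z) <= e * rnorm z.
Proof.
move=> t00 e0.
have e2 : 0 < e / 2 by rewrite divr_gt0.
pose s (t : R) (nu : mx) := t^-1 *: Ad rho w^-1%g nu.
have s_ok t nu : 0 < t -> chamber (D i) nu ->
    aP P (s t nu) /\ chamber (D i) (Ad rho w (s t nu)).
  move=> t1 cnu; split.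
    by apply: aPZ; apply: normKa_aP (normKa_inv Nw) _; exact: chamber_aP.
  by rewrite AdZ AdKV; apply: chamberZ => //; rewrite invr_gt0.
have /compact_near_coveringP cov := @chamber_ball_compact i r.
have {}cov := cov R (nbhs t0) (fun t nu => chamber (D i) nu -> forall z, V z ->
    rnorm (transported a (s t nu) z - transported a (s t0 nu) z) <= e * rnorm z)
      (nbhs_filter t0).
have : \forall t \near t0, chamber (D i) `&` [set nu | `|nu| <= r] `<=`
   (fun nu => chamber (D i) nu -> forall z, V z ->
    rnorm (transported a (s t nu) z - transported a (s t0 nu) z) <= e * rnorm
      z).
  apply: cov => nu0 [cnu0 _].
  have [Ps cs] := s_ok t0 nu0 t00 cnu0.
  have Hc := transported_continuous a Ps cs e2.
  have sc : (fun p : mx * R => s p.2 p.1) @ (nu0, t0) --> s t0 nu0.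
    apply: cvgZ; first by apply: cvgV; rewrite ?gt_eqF //; exact: cvg_snd.
    by apply: (cvg_comp fst (Ad rho w^-1%g));
      [exact: cvg_fst | exact: Ad_continuous].
  have sc0 : (fun p : mx * R => s t0 p.1) @ (nu0, t0) --> s t0 nu0.
    apply: cvgZ; first exact: cvg_cst.
    by apply: (cvg_comp fst (Ad rho w^-1%g));
      [exact: cvg_fst | exact: Ad_continuous].
  have tpos : \forall p \near (nu0, t0), 0 < p.2 :> R.
    have : \forall t \near t0, 0 < t by exact: lt_nbhsr.
    exact: (cvg_snd (F := nbhs nu0) (G := nbhs t0)).
  suff E : \forall p \near (nu0, t0), chamber (D i) p.1 -> forall z, V z ->
      rnorm (transported a (s p.2 p.1) z - transported a (s t0 p.1) z) <= e *
        rnorm z.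
    exact: E.
  (* Both dilates of [nu], by [t] and by [t0], are compared with the fixed point [s t0 nu0], at a
     cost of [e / 2] each. *)
  have near1 := sc _ Hc; have near2 := sc0 _ Hc.
  apply: filterS3 tpos near1 near2 => -[nu t] /= t1 H1 H2 cnu z Vz.
  apply: (le_trans (rnorm_dist (transported a (s t0 nu0) z) _ _)).
  rewrite (rnormB (transported a (s t0 nu0) z)).
  rewrite (_ : e * _ = e / 2 * rnorm z + e / 2 * rnorm z); last by field.
  by apply: lerD; [apply: H1|apply: H2] => //; exact: s_ok.
by apply: filterS => t Ht nu cnu nur z Vz; exact: Ht.
Qed.

(** Of the two factors of [rescaling_op], the one at the dilated point is absorbed in [transported];
    the other, evaluated at [Ad w^-1 nu], does not involve [t]. *)
Lemma rescaled_transported (alphat : R -> A -> A) a t nu x :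
  0 < t -> rescaling_automorphism muK Phi t (alphat t) ->
  chamber (D i) nu -> fundom (D i) (Ad rho w^-1%g nu) -> W x ->
  let z := adjoint_on V (U (Ad rho w^-1%g nu)) x in
  V z /\ rnorm z = rnorm x /\
  Phi (alphat t a) i nu x =
  U (Ad rho w^-1%g nu) (transported a (t^-1 *: Ad rho w^-1%g nu) z).
Proof.
move=> t0 [_ Ha] cnu fnu Wx z.
have Pnu : aP P (Ad rho w^-1%g nu).
  by apply: normKa_aP (normKa_inv Nw) _; exact: chamber_aP.
have Ps : aP P (t^-1 *: Ad rho w^-1%g nu) by exact: aPZ.
have U1 := intertwiner_unitary Pnu; have U2 := intertwiner_unitary Ps.
have [Vz Uz] := unitaryK U1 Wx.
split=> //; split; first exact: (unitary_adj_norm U1).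
have cnu' : chamber (D i) (Ad rho w (Ad rho w^-1%g nu)) by rewrite AdKV.
have := Ha a i w _ x Sw fnu cnu' Wx; rewrite /= AdKV => ->.
(* [rescaling_op] is a unitary after the inverse of another, so its adjoint undoes the first and
   applies the second. *)
have -> : adjoint_on W (rescaling_op muK (D i) w (Ad rho w^-1%g nu) t) x =
    U (t^-1 *: Ad rho w^-1%g nu) z.
  have Wu : W (U (t^-1 *: Ad rho w^-1%g nu) z) by exact: unitary_img U2 Vz.
  apply: adjoint_onE => // y Wy; rewrite /rescaling_op.
  have [Vy Uy] := unitaryK U2 Wy.
  by rewrite (unitary_adj_dot U1) // -[in RHS]Uy; case: U2 => _ _ ->.
by rewrite /rescaling_op /transported AdZ AdKV.
Qed.

End FixedRepresentative.

Variable alphat : R -> A -> A.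
Hypothesis Halphat : forall t, 0 < t ->
  rescaling_automorphism muK Phi t (alphat t).

Lemma fundom_index i : exists (J : finType) (wk : J -> G),
  forall nu, aP (parab (D i)) nu ->
  exists k, Ssigma (D i) (wk k) /\ fundom (D i) (Ad rho (wk k)^-1%g nu).
Proof. by have [_ _ _ [_ s r f]] := spec i; exact: (fundom_finite s r f). Qed.

(** Up to unitaries, the operator of [alphat t a] at [nu] is that of [a] at [t^-1 *: nu], so the
    decay of [a] passes to [alphat t a]. *)
Lemma rescaling_norm a t i nu x : 0 < t -> chamber (D i) nu -> IndS i x ->
  exists2 y, IndS i y & rnorm y = rnorm x /\
    rnorm (Phi (alphat t a) i nu x) = rnorm (Phi a i (t^-1 *: nu) y).
Proof.
move=> t0 cnu Wx; have [J [wk wkP]] := fundom_index i.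
have [k [Sk fk]] := wkP nu (chamber_aP cnu).
have [Vz [nz ->]] := rescaled_transported Sk a t0 (Halphat t0) cnu fk Wx.
have Nk : normKa (parab (D i)) (wk k) by case: Sk.
have P1 : aP (parab (D i)) (Ad rho (wk k)^-1%g nu).
  by apply: normKa_aP (normKa_inv Nk) _; exact: chamber_aP.
have P2 := aPZ t^-1 P1.
have c2 : chamber (D i) (Ad rho (wk k) (t^-1 *: Ad rho (wk k)^-1%g nu)).
  by rewrite AdZ AdKV; apply: chamberZ => //; rewrite invr_gt0.
have U1 := intertwiner_unitary Sk P1; have U2 := intertwiner_unitary Sk P2.
have Wz := unitary_img U2 Vz.
exists (knapp_stein (s:=D i) (wk k) (twist (wk k)^-1%g (@sigma R G (D i)))
   (t^-1 *: Ad rho (wk k)^-1%g nu)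
   (adjoint_on (Ind muK (D i) (twist (wk k)^-1%g (@sigma R G (D i))))
     (knapp_stein (s:=D i) (wk k) (twist (wk k)^-1%g (@sigma R G (D i)))
       (Ad rho (wk k)^-1%g nu)) x)) => //.
split; first by rewrite (unitary_norm U2 Vz).
have Vt : Ind muK (D i) (twist (wk k)^-1%g (@sigma R G (D i)))
    (transported (wk k) a (t^-1 *: Ad rho (wk k)^-1%g nu)
      (adjoint_on (Ind muK (D i) (twist (wk k)^-1%g (@sigma R G (D i))))
        (knapp_stein (s:=D i) (wk k) (twist (wk k)^-1%g (@sigma R G (D i)))
          (Ad rho (wk k)^-1%g nu)) x)).
  by have [] := unitaryK U2 (Phi_Ind a c2 Wz).
by rewrite (unitary_norm U1 Vt) transported_norm // AdZ AdKV.
Qed.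

(** For each [nu] the same representative serves [t] and [t0], so the common outer unitary drops out
    of the difference; the finitely many estimates for the transported operators then hold
    simultaneously. *)
Lemma rescaling_uniform a i (r t0 e : R) : 0 < t0 -> 0 < e ->
  \forall t \near t0, forall nu x, chamber (D i) nu -> `|nu| <= r -> IndS i x ->
    rnorm (Phi (alphat t a) i nu x - Phi (alphat t0 a) i nu x) <= e * rnorm x.
Proof.
move=> t00 e0; have [J [wk wkP]] := fundom_index i.
have tpos : \forall t \near t0, 0 < t by exact: lt_nbhsr.
pose Q k t := Ssigma (D i) (wk k) ->
  forall nu, chamber (D i) nu -> `|nu| <= r -> forall z,
  Ind muK (D i) (twist (wk k)^-1%g (@sigma R G (D i))) z ->
  rnorm (transported (wk k) a (t^-1 *: Ad rho (wk k)^-1%g nu) z -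
         transported (wk k) a (t0^-1 *: Ad rho (wk k)^-1%g nu) z) <= e * rnorm
           z.
have unif : \forall t \near t0, forall k, Q k t.
  apply: (@filter_forall R J Q (nbhs t0) (nbhs_filter t0)) => k;
    have [Sk|NSk] := pselect (Ssigma (D i) (wk k)).
    by apply: filterS (transported_uniform Sk a r t00 e0) => t Ht _.
  by apply: nearW => t /NSk.
apply: filterS2 tpos unif => t t1 Ht nu x cnu nur Wx.
have [k [Sk fk]] := wkP nu (chamber_aP cnu).
have [Vz [nz ->]] := rescaled_transported Sk a t1 (Halphat t1) cnu fk Wx.
have [_ [_ ->]] := rescaled_transported Sk a t00 (Halphat t00) cnu fk Wx.
have Nk : normKa (parab (D i)) (wk k) by case: Sk.
have P1 : aP (parab (D i)) (Ad rho (wk k)^-1%g nu).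
  by apply: normKa_aP (normKa_inv Nk) _; exact: chamber_aP.
have c2 s : 0 < s -> chamber (D i) (Ad rho (wk k) (s^-1 *: Ad rho (wk k)^-1%g
  nu)).
  by move=> s0; rewrite AdZ AdKV; apply: chamberZ => //; rewrite invr_gt0.
have tV s z : 0 < s -> Ind muK (D i) (twist (wk k)^-1%g (@sigma R G (D i))) z ->
   Ind muK (D i) (twist (wk k)^-1%g (@sigma R G (D i)))
    (transported (wk k) a (s^-1 *: Ad rho (wk k)^-1%g nu) z).
  move=> s0 Vz'; have U2 := intertwiner_unitary Sk (aPZ s^-1 P1).
  by have [] := unitaryK U2 (Phi_Ind a (c2 s s0) (unitary_img U2 Vz')).
rewrite (unitary_dist (intertwiner_unitary Sk P1) (tV t _ t1 Vz) (tV t0 _ t00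
  Vz)) -nz.
exact: Ht.
Qed.

Lemma rescaling_continuous a (t0 e : R) : 0 < t0 -> 0 < e ->
  \forall t \near t0, rnorm (alphat t a - alphat t0 a) <= e.
Proof.
move=> t00 e0; have [_ alg nrm c0 _] := HPhi.
have e2 : 0 < e / 2 by rewrite divr_gt0.
have [_ _ decay _ fin] := c0 a.
have [J finJ HJ] := fin _ e2.
have tpos : \forall t \near t0, 0 < t by exact: lt_nbhsr.
have t2 : \forall t \near t0, t < 2 * t0 by apply: lt_nbhsl; lra.
have small t i nu x : 0 < t -> chamber (D i) nu -> IndS i x ->
    opnorm_le (IndS i) (Phi a i (t^-1 *: nu)) (e / 2) ->
    rnorm (Phi (alphat t a) i nu x) <= e / 2 * rnorm x.
  move=> t1 cnu Wx op; have [y Wy [<- ->]] := rescaling_norm a t1 cnu Wx.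
  exact: op.
pose Q i t := 0 < t -> t < 2 * t0 -> forall nu x, chamber (D i) nu ->
  IndS i x ->
  rnorm (Phi (alphat t a) i nu x - Phi (alphat t0 a) i nu x) <= e * rnorm x.
have unifJ : \forall t \near t0, forall i, J i -> Q i t.
  apply: (@near_finite_set R (nbhs t0) (nbhs_filter t0) I J Q finJ) => i Ji;
    have [r Hr] := decay i _ e2.
  (* If [|nu|] exceeds this radius, then [s^-1 *: nu] has norm above [r] for all positive
     [s < 2 * t0], so the decay bound holds at [t] and at [t0]. The absolute value allows for a
     negative [r]. *)
  apply: filterS (rescaling_uniform a i (`|r| * (2 * t0)) t00 e0) => t Ht t1 tt0
    nu x cnu Wx.
  have [nur|nur] := leP `|nu| (`|r| * (2 * t0)); first exact: Ht.
  have big s : 0 < s -> s < 2 * t0 ->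
    opnorm_le (IndS i) (Phi a i (s^-1 *: nu)) (e / 2).
    move=> s0 s2; apply: Hr; first by apply: chamberZ; rewrite // invr_gt0.
    rewrite normrZ gtr0_norm ?invr_gt0 // mulrC ltr_pdivlMr //.
    apply: le_lt_trans nur; apply: (@le_trans _ _ (`|r| * s)).
      by rewrite ler_wpM2r ?ler_norm // ltW.
    by rewrite ler_wpM2l // ltW.
  apply: (le_trans (rnorm_dist 0 _ _)); rewrite subr0 sub0r rnormN.
  rewrite (_ : e * _ = e / 2 * rnorm x + e / 2 * rnorm x); last by field.
  by apply: lerD; apply: small => //; apply: big => //; lra.
apply: filterS3 tpos t2 unifJ => t t1 tt0 Ht.
have -> : alphat t a - alphat t0 a = (-1) *: alphat t0 a + alphat t a.
  by rewrite scaleN1r addrC.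
(* The norm of [A] is tested on all the operators of the Plancherel isomorphism: [unifJ] covers [i]
   in [J], and for the other indices both terms are small. *)
apply/(nrm _ _ (ltW e0)) => i nu cnu x Wx.
have [-> _ _] := alg i nu x x (alphat t0 a) (alphat t a) (-1) cnu Wx Wx.
rewrite scaleN1r addrC.
have [Ji|NJi] := pselect (J i); first exact: Ht.
apply: (le_trans (rnorm_dist 0 _ _)); rewrite subr0 sub0r rnormN.
rewrite (_ : e * _ = e / 2 * rnorm x + e / 2 * rnorm x); last by field.
by apply: lerD; apply: small => //; apply: HJ => //; apply: chamberZ;
  rewrite // invr_gt0.
Qed.

End Rescaling.

(** * Borel sets of G and bounds on the reduced norm *)

Section MatrixMeasurable.
Context {R : realType} {d : measure_display} {T : measurableType d} {m n : nat}.

(** An open set of matrices is a countable union of boxes with rational centres and radii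
    [1 / (k + 1)], whose preimages are finite intersections of preimages of intervals. *)
Lemma measurable_open_mx (F : T -> 'M[R]_(m, n)) (O : set 'M[R]_(m, n)) :
  (forall i j, measurable_fun setT (fun x => F x i j)) -> open O ->
  measurable (F @^-1` O).
Proof.
move=> mF oO.
pose box (p : 'M[rat]_(m, n) * nat) : set 'M[R]_(m, n) :=
  [set X | forall i j, `|X i j - ratr (p.1 i j)| < p.2.+1%:R^-1].
have -> : F @^-1` O = \bigcup_(p in [set p | box p `<=` O]) F @^-1` (box p).
  apply/seteqP; split=> [x Ox|x [p pO px]]; last exact: pO.
  have /nbhs_ballP[e /= e0 eO] : nbhs (F x) O by exact: open_nbhs_nbhs.
  (* A box of radius below [e / 2] that contains [F x] lies in the ball of radius [e] about
     [F x]. *)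
  have [k ke] : exists k, k.+1%:R^-1 < e / 2.
    have e2 : 0 < e / 2 by rewrite divr_gt0.
    exists (Num.truncn (e / 2)^-1).
    by rewrite invf_plt ?posrE //; exact: truncnS_gt.
  pose q := \matrix_(i < m, j < n) xget 0 [set r :
    rat | `|F x i j - ratr r| < k.+1%:R^-1].
  have qF i j : `|F x i j - ratr (q i j)| < k.+1%:R^-1.
    rewrite mxE; apply: (@xgetPex _ 0 [set r :
      rat | `|F x i j - ratr r| < k.+1%:R^-1]).
    have : 0 < k.+1%:R^-1 :> R by rewrite invr_gt0.
    move: (k.+1%:R^-1) => a a0.
    have /rat_in_itvoo[r] : F x i j - a < F x i j + a by lra.
    rewrite in_itv /= => /andP[r1 r2]; exists r => /=.
    by rewrite ltr_norml; apply/andP; split; lra.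
  exists (q, k) => //= X Xq; apply: eO; split=> // i j.
  rewrite /ball /=; apply: (le_lt_trans (ler_distD (ratr (q i j)) _ _)).
  rewrite (splitr e); apply: ltrD; apply: lt_trans ke; first exact: qF.
  by rewrite distrC; exact: Xq.
rewrite bigcup_mkcond; apply: countable_bigcupT_measurable => [|p].
  exact: countableP.
case: ifPn => _; last exact: measurable0.
have -> : F @^-1` box p = \bigcap_(ij in [set: 'I_m * 'I_n])
    ((fun x => F x ij.1 ij.2) @^-1`
     (ball (ratr (p.1 ij.1 ij.2) : R) (p.2.+1%:R^-1))).
  apply/seteqP; split=> [x Fx [i j] _|x Fx i j]; rewrite /= /ball /=.
    by rewrite distrC; exact: Fx.
  by have := Fx (i, j) I; rewrite /= /ball /= distrC.
apply: fin_bigcap_measurable => [|ij _]; first exact: finite_finset.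
rewrite -[X in measurable X]setTI; apply: mF => //.
exact: measurable_ball.
Qed.
End MatrixMeasurable.

Section BorelGroup.
Context {R : realType} (G : real_reductive R).
Local Notation rho := (@rho R G).
Local Notation mx := ('M[R]_(rdim G)).

Lemma G_hausdorff : hausdorff_space G.
Proof.
move=> x y xy; apply: (@rho_inj _ G).
have : hausdorff_space mx by exact: norm_hausdorff.
apply => A B nA nB.
have [z [Az Bz]] := xy _ _ (@rho_continuous _ G x _ nA) (@rho_continuous _ G y _
  nB).
by exists (rho z).
Qed.

(** A countable cover of [G] by compact sets. The ball is taken in the whole Lie algebra, a closed
    subspace containing s, so polar decomposition still gives a cover. *)
Definition polar_piece (k : nat) : set G :=
  polar rho @` (gK G `*` (lie rho setT `&` [set X | `|X| <= k%:R])).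

Lemma polar_continuous : {within gK G `*` lie rho setT, continuous (polar rho)}.
Proof.
apply/subspace_continuousP => -[k X] [/= Kk lX].
have [_ _ /subspace_continuousP gc _] := r_lie G.
apply: (cvg_comp (fun p : G * mx => (p.1, gexp rho p.2)) (fun p :
  G * G => (p.1 * p.2)%g)
  _ (topmul_continuous (k, gexp rho X))).
apply: cvg_pair.
  move=> A nA.
  have H : \forall p \near (k, X), A p.1 by exact: (cvg_fst (F := nbhs k) (G :=
    nbhs X)).
  by apply: filterS H => p Ap _.
apply: (@cvg_comp _ _ _ (fun p : G * mx => p.2) (gexp rho) _ (within (lie rho
  setT) (nbhs X))); last exact: gc.
move=> A /=; rewrite /within /= => AX.
have : \forall p \near (k, X), lie rho setT p.2 -> A p.2.
  by apply: (@cvg_snd _ _ (nbhs k) (nbhs X) _ [set Y | lie rho setT Y -> A Y]).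
by apply: filterS => -[k' X'] /= H [_]; exact: H.
Qed.

Lemma lie_subspace : Defs.subspace (lie rho setT).
Proof. by case: (r_lie G). Qed.

Lemma polar_piece_compact k : compact (polar_piece k).
Proof.
apply: continuous_compact.
  apply: continuous_subspaceW polar_continuous => -[x X] [/= Kx [lX _]] //.
apply: compact_setX; first exact: K_compact.
apply: (@mx_bounded_closed_compact _ _ _ k%:R); last by move=> X [].
apply: closedI; first exact: subspace_closed lie_subspace.
apply: (@closed_comp _ _ (fun nu : mx => `|nu|) [set x | x <= k%:R]);
  last exact: closed_le.
by move=> x _; exact: norm_continuous.
Qed.

Lemma polar_piece_cover : \bigcup_k polar_piece k = setT.
Proof.
apply/seteqP; split=> // x _.
have [/(_ x)[[k X] [[[Kk [lX _]] xE] _]] _] := r_polar G.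
exists (Num.truncn `|X|).+1 => //; exists (k, X) => //; split=> //; split=> //=.
by apply: ltW; exact: truncnS_gt.
Qed.

(* [G] is a countable union of compact sets, so its Borel sets are the preimages
   of Borel sets under the continuous injection [rho]; this makes the group law
   measurable for the product sigma-algebra. *)
Lemma measurable_to_G {d} {T : measurableType d} (F : T -> G) :
  (forall i j, measurable_fun setT (fun x => rho (F x) i j)) ->
  measurable_fun setT (F : T -> borel G).
Proof.
move=> mF.
have mcpt C : compact C -> measurable (F @^-1` C).
  move=> cC; have -> : F @^-1` C = ~` ((rho \o F) @^-1` ~` (rho @` C)).
    apply/seteqP; split=> [x Cx|x] /=; first by apply; exists (F x).
    by move=> /contrapT[y Cy /rho_inj <-].
  apply: measurableC; apply: measurable_open_mx => //; rewrite openC.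
  apply: compact_closed; first exact: norm_hausdorff.
  apply: continuous_compact cC; apply: continuous_subspaceT;
    exact: rho_continuous.
apply: (@measurability _ _ T (borel G) setT F (@open G) erefl) => _ [U oU <-];
  rewrite setTI.
(* Within each compact piece, [U] is the complement of a compact set. *)
have -> : F @^-1` U = \bigcup_k (F @^-1` polar_piece k `\` F @^-1` (polar_piece
  k `\` U)).
  apply/seteqP; split=> [x Ux|x [k _ [Qx /not_andP[]//]]];
    last by move=> /contrapT.
  have [k _ kx] : (\bigcup_k polar_piece k) (F x) by rewrite polar_piece_cover.
  by exists k => //; split=> // -[].
apply: bigcup_measurable => k _; apply: measurableD; apply: mcpt.
  exact: polar_piece_compact.
rewrite setDE; apply: compact_closedI; first exact: polar_piece_compact.
by rewrite closedC.
Qed.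

Lemma continuous_measurable_G (f : G -> R) : continuous f ->
  measurable_fun setT (f : borel G -> R).
Proof.
move=> cf; apply: (measurability _ (RGenOpens.measurableE R)) => _ [_ [a [b ->]
  <-]].
rewrite setTI; apply: sub_sigma_algebra.
by move/continuousP: cf; apply; exact: interval_open.
Qed.

(** Tonelli's theorem needs measurability for the product sigma-algebra; it holds because the matrix
    entries are sums of products of functions of one variable each. *)
Lemma measurable_divl : measurable_fun setT
  ((fun p => p.1^-1 * p.2)%g : borel G * borel G -> borel G).
Proof.
apply: measurable_to_G => i j.
under eq_fun do rewrite rhoM mxE.
apply: measurable_sum => k; apply: measurable_funM.
  apply: (@measurableT_comp _ _ _ _ _ _ (fun x :
    borel G => rho x^-1%g i k) _ fst).
    apply: continuous_measurable_G => x.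
    apply: (cvg_comp (fun y : G => rho y^-1%g) (fun M : mx => M i k));
      last exact: coord_continuous.
    exact: (continuous_comp (@topinv_continuous G x) (@rho_continuous _ G _)).
  exact: measurable_fst.
apply: (@measurableT_comp _ _ _ _ _ _ (fun x : borel G => rho x k j) _ snd).
  apply: continuous_measurable_G => x.
  apply: (cvg_comp rho (fun M : mx => M k j));
    [exact: rho_continuous | exact: coord_continuous].
exact: measurable_snd.
Qed.

End BorelGroup.

Section CompactSupportBound.
Context {d} {T : measurableType d} {R : realType} (mu : {measure set T ->
  \bar R}).

(* AM-GM: 2 l |u| <= l^2 + u^2 on [C], integrated and optimized in [l]. *)
Lemma Rintegral_sq_le (C : set T) (M : R) (u : T -> R) :
  measurable C -> 0 < M -> (mu C <= M%:E)%E -> measurable_fun setT u ->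
  (forall x, ~ C x -> u x = 0) ->
  ((Rintegral mu setT u ^+ 2)%:E <= M%:E * \int[mu]_x (u x ^+ 2)%:E)%E.
Proof.
move=> mC M0 CM mu_ uC.
have mu2 : measurable_fun setT (fun x => (u x ^+ 2)%:E).
  by apply/measurable_EFinP; exact: measurable_funX.
have I0 : (0 <= \int[mu]_x (u x ^+ 2)%:E)%E.
  by apply: integral_ge0 => x _; rewrite lee_fin sqr_ge0.
case EI : (\int[mu]_x (u x ^+ 2)%:E)%E I0 => [s| |] //; last first.
  by move=> _; rewrite gt0_muley ?lte_fin // leey.
rewrite lee_fin => s0.
have mabs : measurable_fun setT (fun x => `|u x|%:E).
  by apply/measurable_EFinP; apply: measurableT_comp.
have key l : 0 < l -> ((2 * l)%:E * \int[mu]_x `|u x|%:E <= (l ^+ 2 * M +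
  s)%:E)%E.
  move=> l0; have l20 : (0 <= 2 * l) by rewrite mulr_ge0 // ltW.
  rewrite -ge0_integralZl //.
  have mC2 : measurable_fun setT (fun x => (l ^+ 2 * \1_C x)%:E).
    by apply/measurable_EFinP; apply: measurable_funM => //;
      exact: measurable_indic.
  apply: (@le_trans _ _ (\int[mu]_x ((l ^+ 2 * \1_C x)%:E + (u x ^+ 2)%:E))%E).
    apply: ge0_le_integral => //.
    - by move=> x _; rewrite lee_fin mulr_ge0.
    - exact: measurable_funeM.
    - exact: emeasurable_funD.
    move=> x _; rewrite -EFinM -EFinD lee_fin.
    have [Cx|NCx] := pselect (C x).
      rewrite indicE mem_set // mulr1 -subr_ge0 -(@real_normK _ (u x)) ?num_real
        //.
      rewrite (_ : _ - _ = (l - `|u x|) ^+ 2) ?sqr_ge0 //; ring.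
    by rewrite uC // normr0 mulr0 indicE memNset // mulr0 expr0n addr0.
  rewrite ge0_integralD //; last 2 first.
    by move=> x _; rewrite lee_fin mulr_ge0 // sqr_ge0.
    by move=> x _; rewrite lee_fin sqr_ge0.
  rewrite EI EFinD leeD2r // EFinM.
  under eq_integral do rewrite EFinM.
  rewrite ge0_integralZl //; last 2 first.
    by apply/measurable_EFinP; exact: measurable_indic.
    by rewrite lee_fin sqr_ge0.
  by rewrite integral_indic // setIT lee_wpmul2l // lee_fin sqr_ge0.
have J0 : (0 <= \int[mu]_x `|u x|%:E)%E by apply: integral_ge0 => x _;
  rewrite lee_fin.
(* An infinite integral of [|u|] would contradict [key] at [l = 1]. *)
case EJ : (\int[mu]_x `|u x|%:E)%E J0 => [b| |] //; last first.
  by move=> _; have := key 1 ltr01;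
    rewrite EJ mulr1 gt0_muley ?lte_fin // leye_eq.
rewrite lee_fin => b0.
have ab : `|Rintegral mu setT u| <= b.
  have := @le_abse_integral _ _ _ mu setT (EFin \o u) measurableT.
  move=> /(_ _); rewrite (_ : (\int[mu]_x `|(EFin \o u) x|)%E = b%:E);
    last by rewrite -EJ.
  rewrite /Rintegral => /(_ _); case: (\int[mu]_x _)%E => [c| |] /=;
    rewrite ?normr0 //.
  by rewrite lee_fin; apply; exact/measurable_EFinP.
rewrite -EFinM lee_fin -real_normK ?num_real //.
apply: (@le_trans _ _ (b ^+ 2)); first by rewrite ler_sqr ?nnegrE.
have [->|bn0] := eqVneq b 0; first by rewrite expr0n mulr_ge0 // ltW.
have bp : 0 < b by rewrite lt_def bn0.
(* [l = b / M] maximizes [2 * l * b - l ^+ 2 * M], with value [b ^+ 2 / M]. *)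
have := key (b / M) (divr_gt0 bp M0); rewrite EJ -EFinM lee_fin => H.
have : b ^+ 2 / M <= s.
  have e1 : 2 * (b / M) * b = 2 * (b ^+ 2 / M) by field; rewrite gt_eqF.
  have e2 : (b / M) ^+ 2 * M = b ^+ 2 / M by field; rewrite gt_eqF.
  by move: H; rewrite e1 e2; lra.
by rewrite ler_pdivrMr // mulrC.
Qed.

End CompactSupportBound.

(** * The reduced norm of functions supported in a compact set *)

Section ConvolutionBound.
Context {R : realType} (G : real_reductive R) (mu : borel_measure G R).
Hypothesis Hmu : haar_G mu.
Context (A : cstar R) (iota : (G -> R[i]) -> A).
Hypothesis HA : reduced_G mu iota.

Let mu_compact C : compact C -> (mu C < +oo)%E.
Proof. by case: Hmu => _ + _ _; apply. Qed.

Lemma compact_measurable_G (C : set G) : compact C ->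
  measurable (C : set (borel G)).
Proof.
move=> cC; rewrite -[C]setCK; apply: measurableC; apply: sub_sigma_algebra.
by rewrite openC; apply: compact_closed cC; exact: G_hausdorff.
Qed.

Lemma haar_sigma_finite : sigma_finite [set: borel G] mu.
Proof.
exists (@polar_piece R G); first by rewrite polar_piece_cover.
move=> k; have cQ := @polar_piece_compact R G k.
by split; [exact: compact_measurable_G | exact: mu_compact].
Qed.

Lemma continuous_measurable_GG (f : G -> G) : continuous f ->
  measurable_fun setT (f : borel G -> borel G).
Proof.
move=> cf; apply: (@measurability _ _ (borel G) (borel G) setT f (@open G)
  erefl) => _ [U oU <-].
rewrite setTI; apply: sub_sigma_algebra; by move/continuousP: cf; apply.
Qed.

Lemma mulr_continuous_G (g : G) : continuous (fun x : G => (x^-1 * g)%g).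
Proof.
move=> x; exact: (cvg_comp (fun y : G => (y^-1%g, g)) (fun p :
  G * G => (p.1 * p.2)%g)
    (cvg_pair (@topinv_continuous G x) (cvg_cst g)) (topmul_continuous (x^-1%g,
      g))).
Qed.

Lemma mull_continuous_G (g : G) : continuous (fun x : G => (g * x)%g).
Proof.
move=> x; exact: (cvg_comp (fun y : G => (g, y)) (fun p :
  G * G => (p.1 * p.2)%g)
    (cvg_pair (cvg_cst g) cvg_id) (topmul_continuous (g, x))).
Qed.

Lemma haar_translate (h : G -> \bar R) (x : G) :
  measurable_fun setT (h : borel G -> \bar R) -> (forall y, 0 <= h y)%E ->
  (\int[mu]_g h (x * g)%g = \int[mu]_g h g)%E.
Proof.
move=> mh h0.
have mx : measurable_fun setT ((fun g => x * g)%g : borel G -> borel G).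
  by apply: continuous_measurable_GG; exact: mull_continuous_G.
have := ge0_integral_pushforward mx mu measurableT mh (fun y _ => h0 y).
rewrite preimage_setT => <-; apply: eq_measure_integral => B mB _.
by case: Hmu => _ _ _ inv; rewrite /pushforward; exact: inv.
Qed.

Lemma test_cmeasurable f : test_G G f -> cmeasurable (T := G) setT f.
Proof.
move=> [smr smi _]; have [+ _] := smr 0%N; have [+ _] := smi 0%N.
by move=> ci cr; split; apply: continuous_measurable_G;
  apply/continuous_subspace_setT.
Qed.

Lemma sqmod_mul (z z' : R[i]) : sqmod (z * z') = sqmod z * sqmod z'.
Proof. by case: z => a b; case: z' => c d; rewrite /sqmod /=; ring. Qed.

Lemma sqmod_ge0 (z : R[i]) : 0 <= sqmod z.
Proof. by rewrite addr_ge0 // sqr_ge0. Qed.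

(** Cauchy-Schwarz on [C] bounds the squared modulus of the convolution at [g] by a multiple of the
    integral of [sqmod (h (x^-1 * g))] over [x] in [C]. Integrating in [g], Tonelli and left
    invariance leave the measure of [C] times the integral of [sqmod h]. *)
Lemma convolution_sq_le (C : set G) (S : R) f h : compact C -> 0 <= S ->
  cmeasurable setT f -> (forall x, ~ C x -> f x = 0) ->
    (forall x, sqmod (f x) <= S ^+ 2) ->
  square_integrable mu setT h ->
  (sqintegral mu setT (convolution setT (@mulG R G) (@invG R G) mu f h) <=
   ((S * (fine (mu C) + 1)) ^+ 2)%:E * sqintegral mu setT h)%E.
Proof.
move=> cC S0 [mfr mfi] fC fS [[mhr mhi] h2].
(* Adding 1 keeps [M] positive when [C] is a null set. *)
pose M := fine (mu C) + 1.
have mC := compact_measurable_G cC.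
have muC : mu C = (fine (mu C))%:E.
  by rewrite fineK // ge0_fin_numE ?mu_compact // measure_ge0.
have m0 : 0 <= fine (mu C) by apply: fine_ge0; exact: measure_ge0.
have M0 : 0 < M by rewrite ltr_wpDl.
have CM : (mu C <= M%:E)%E by rewrite muC lee_fin lerDl.
have mtr g : measurable_fun setT ((fun x => x^-1 * g)%g : borel G -> borel G).
  by apply: continuous_measurable_GG; exact: mulr_continuous_G.
have msq : measurable_fun setT ((fun x => sqmod (h x)) : borel G -> R).
  by apply: measurable_funD; exact: measurable_funX.
pose kern (p : borel G * borel G) : \bar R :=
  (\1_C p.1 * sqmod (h (p.1^-1 * p.2)%g))%:E.
have mkern : measurable_fun setT kern.
  apply/measurable_EFinP; apply: measurable_funM.
    by apply: (measurableT_comp _ measurable_fst); exact: measurable_indic.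
  exact: (measurableT_comp msq (@measurable_divl R G)).
have kern0 p : (0 <= kern p)%E by rewrite lee_fin mulr_ge0 // sqmod_ge0.
(* The Haar measure is repackaged with the sigma-finite structure required by Tonelli's theorem. *)
pose H1 := isSFinite.Build _ _ _ _ (sfinite_measure_sigma_finite
  haar_sigma_finite).
pose H2 := isSigmaFinite.Build _ _ _ _ haar_sigma_finite.
pose smu : {sigma_finite_measure set (borel G) -> \bar R} :=
  HB.pack_for (SigmaFiniteMeasure.type (borel G) R) (Measure.sort mu) H1 H2.
have smuE : mu = smu :> (set _ -> _) by [].
have pointwise g : ((sqmod (convolution setT (@mulG R G) (@invG R G) mu f h
  g))%:E <=
    (M * S ^+ 2)%:E * \int[mu]_x kern (x, g))%E.
  pose w (x : G) := f x * h (x^-1 * g)%g.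
  have w0 x : ~ C x -> w x = 0 by move=> NCx; rewrite /w fC // mul0r.
  have mwr : measurable_fun setT ((fun x => complex.Re (w x)) : borel G -> R).
    rewrite (_ : (fun x => _) = (fun x :
      borel G => complex.Re (f x) * complex.Re (h (x^-1 * g)%g)
        - complex.Im (f x) * complex.Im (h (x^-1 * g)%g))); last first.
      by apply/funext => x; rewrite /w; case: (f x) => a b; case: (h _) => c e.
    by apply: measurable_funB; apply: measurable_funM => //;
      [exact: (measurableT_comp mhr (mtr g))|exact: (measurableT_comp mhi (mtr
        g))].
  have mwi : measurable_fun setT ((fun x => complex.Im (w x)) : borel G -> R).
    rewrite (_ : (fun x => _) = (fun x :
      borel G => complex.Re (f x) * complex.Im (h (x^-1 * g)%g)
        + complex.Im (f x) * complex.Re (h (x^-1 * g)%g))); last first.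
      by apply/funext => x; rewrite /w; case: (f x) => a b; case: (h _) => c e.
    by apply: measurable_funD; apply: measurable_funM => //;
      [exact: (measurableT_comp mhi (mtr g))|exact: (measurableT_comp mhr (mtr
        g))].
  have b1 := Rintegral_sq_le mC M0 CM mwr (fun x NCx => congr1 (@complex.Re R)
    (w0 x NCx)).
  have b2 := Rintegral_sq_le mC M0 CM mwi (fun x NCx => congr1 (@complex.Im R)
    (w0 x NCx)).
  rewrite /sqmod /convolution /cintegral /= EFinD.
  apply: (le_trans (leeD b1 b2)).
  rewrite -ge0_muleDr; try by apply: integral_ge0 => x _;
    rewrite lee_fin sqr_ge0.
  rewrite EFinM -muleA lee_pmul2l ?lte_fin //.
  rewrite -ge0_integralD //; last 4 first.
  - by move=> x _; rewrite lee_fin sqr_ge0.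
  - by apply/measurable_EFinP; exact: measurable_funX.
  - by move=> x _; rewrite lee_fin sqr_ge0.
  - by apply/measurable_EFinP; exact: measurable_funX.
  have mk : measurable_fun setT (fun x : borel G => kern (x, g)).
suff : measurable_fun setT (kern \o (fun x : borel G => (x, g))) by [].
    by apply: measurableT_comp; [exact: mkern | exact: pair2_measurable].
  rewrite -ge0_integralZl //; last by rewrite lee_fin sqr_ge0.
  apply: ge0_le_integral_nm => x _;
    first by rewrite -EFinD lee_fin addr_ge0 ?sqr_ge0.
  rewrite /kern /= -EFinD -EFinM lee_fin -/(sqmod (w x)).
  have [Cx|NCx] := pselect (C x).
    by rewrite indicE mem_set // mul1r /w sqmod_mul ler_wpM2r ?sqmod_ge0.
  by rewrite w0 // /sqmod /= expr0n addr0 mulr_ge0 ?sqr_ge0 // mulr_ge0 //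
    sqmod_ge0.
have mG : measurable_fun setT (fun g : borel G => \int[mu]_x kern (x, g))%E.
  exact: (@measurable_fun_fubini_tonelli_G _ _ _ _ _ smu kern mkern kern0).
apply: (@le_trans _ _ (\int[mu]_g ((M * S ^+ 2)%:E * \int[mu]_x kern (x,
  g)))%E).
  by apply: ge0_le_integral_nm => g _ //; rewrite lee_fin sqmod_ge0.
rewrite ge0_integralZl //; last 2 first.
- by move=> g _; exact: integral_ge0.
- by rewrite lee_fin mulr_ge0 ?sqr_ge0 // ltW.
have -> : (\int[mu]_g \int[mu]_x kern (x, g) = \int[mu]_x \int[mu]_g kern (x,
  g))%E.
  exact/esym/(@fubini_tonelli _ _ _ _ _ smu smu kern mkern kern0).
have inner x : (\int[mu]_g kern (x, g) = (\1_C x)%:E * sqintegral mu setT h)%E.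
  rewrite /kern /=; under eq_integral do rewrite EFinM.
  rewrite ge0_integralZl //; last 2 first.
  - apply/measurable_EFinP.
    suff : measurable_fun setT ((fun y : borel G => sqmod (h y)) \o
        (fun g : borel G => (x^-1 * g)%g : borel G)) by [].
    apply: measurableT_comp; first exact: msq.
    by apply: continuous_measurable_GG; exact: mull_continuous_G.
  - by move=> g _; rewrite lee_fin sqmod_ge0.
  congr (_ * _)%E; rewrite (@haar_translate (fun g => (sqmod (h g))%:E)) //.
    exact/measurable_EFinP.
  by move=> y; rewrite lee_fin sqmod_ge0.
under eq_integral do rewrite inner.
have h0 : (0 <= sqintegral mu setT h)%E.
  by apply: integral_ge0 => x _; rewrite lee_fin sqmod_ge0.
rewrite ge0_integralZr //; last by apply/measurable_EFinP;
  exact: measurable_indic.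
rewrite integral_indic // setIT muleA; apply: lee_wpmul2r => //.
rewrite muC -EFinM lee_fin -/M exprMn -mulrA mulrC -mulrA.
rewrite ler_wpM2l ?sqr_ge0 // expr2 ler_wpM2r // ?(ltW M0) //.
by rewrite /M lerDl.
Qed.

Lemma iota_norm_le (C : set G) (S : R) f : test_G G f -> compact C -> 0 <= S ->
  (forall x, ~ C x -> f x = 0) -> (forall x, sqmod (f x) <= S ^+ 2) ->
  rnorm (iota f) <= S * (fine (mu C) + 1).
Proof.
move=> tf cC S0 fC fS; have [_ _ _ nrm _] := HA.
have m0 : 0 <= fine (mu C) by apply: fine_ge0; exact: measure_ge0.
apply/(nrm f _ tf); first by rewrite mulr_ge0 // addr_ge0.
by move=> h hL2; exact: (convolution_sq_le cC S0 (test_cmeasurable tf) fC fS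
  hL2).
Qed.

End ConvolutionBound.

(** * Smooth families *)

Section SmoothFunctions.
Context {R : realType}.

Lemma Ck_linear (T : topologicalType) (D : set (R -> T ->
  T)) k (a b : R) (f h : T -> R) :
  Ck setT D k f -> Ck setT D k h -> Ck setT D k (fun x => a * f x + b * h x).
Proof.
have cont (p q : T -> R) : {within setT, continuous p} ->
  {within setT, continuous q} ->
    {within setT, continuous (fun x => a * p x + b * q x)}.
  move=> /continuous_subspace_setT cp /continuous_subspace_setT cq.
  apply/continuous_subspace_setT => x; apply: cvgD; apply: cvgM;
    try exact: cvg_cst.
    exact: cp.
  exact: cq.
elim: k f h => [|k IH] f h /= [cf Df] [ch Dh]; first by split=> //; exact: cont.
split; first exact: cont.
move=> flow Dflow; have [df Cf] := Df _ Dflow; have [dh Ch] := Dh _ Dflow.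
have der x : is_derive (0 : R) (1 :
  R) (fun t => a * f (flow t x) + b * h (flow t x))
    (a * derive1 (fun t => f (flow t x)) 0 + b * derive1 (fun t => h (flow t x))
      0).
  rewrite !derive1E.
  have d1 := derivableP (df x I); have d2 := derivableP (dh x I).
  exact: (is_deriveD (is_deriveZ a d1) (is_deriveZ b d2)).
split=> [x _|]; first by have [] := der x.
rewrite (_ : (fun x => _) = fun x => a * derive1 (fun t => f (flow t x)) 0 +
   b * derive1 (fun t => h (flow t x)) 0); first exact: IH.
by apply/funext => x; rewrite derive1E; have [_ ->] := der x.
Qed.

(** As [j] carries each flow of [D] to a flow of [D'], a derivative of [f \o j] is a derivative of
    [f] composed with [j], and induction on [k] applies. *)
Lemma Ck_comp (T U : topologicalType) (S : set T) (S' : set U)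
    (D : set (R -> T -> T)) (D' : set (R -> U -> U)) (j : T -> U) k (f : U ->
      R) :
  {within S, continuous j} -> (forall x, S x -> S' (j x)) ->
  (forall flow, D flow -> exists2 flow', D' flow' &
     forall t x, j (flow t x) = flow' t (j x)) ->
  Ck S' D' k f -> Ck S D k (f \o j).
Proof.
move=> cj jS jD.
have cont (q : U -> R) : {within S', continuous q} ->
  {within S, continuous (q \o j)}.
  move=> /subspace_continuousP cq; apply/subspace_continuousP => x Sx A nA /=.
  have := cq (j x) (jS x Sx) A nA; rewrite /= /within /= => H.
  move/subspace_continuousP : cj => /(_ x Sx _ H); rewrite /= /within /=.
  move=> H2; have H3 : \forall y \near x, S y -> S' (j y) ->
    A (q (j y)) by exact: H2.
  suff : \forall y \near x, S y -> A (q (j y)) by [].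
  by apply: filterS H3 => y Hy Sy; apply: Hy => //; exact: jS.
elim: k f => [|k IH] f /= [cf Df]; first by split=> //; exact: cont.
split; first exact: cont.
move=> flow /jD[flow' D'flow' jflow]; have [df Cf] := Df _ D'flow'.
split=> [x Sx|].
  by under eq_fun do rewrite jflow; exact: df (jS _ Sx).
rewrite (_ : (fun x => _) = (fun y => derive1 (fun t => f (flow' t y)) 0) \o j).
  exact: IH.
by apply/funext => x /=; congr derive1; apply/funext => t; rewrite jflow.
Qed.

End SmoothFunctions.

(** * Restrictions of a smooth family to the groups G_t *)

Section SmoothFamily.
Context {R : realType} (G : real_reductive R).
Local Notation rho := (@rho R G).
Local Notation mx := ('M[R]_(rdim G)).
Local Notation KS := (gK G `*` gs G).

Lemma gs_lie X : gs G X -> lie rho setT X. Proof. by case. Qed.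

Lemma gsZ (t : R) X : gs G X -> gs G (t *: X).
Proof.
move=> [lX tX]; have [l0 llin] := lie_subspace G; split.
  by have := llin t X 0 lX l0; rewrite addr0.
by move=> u; rewrite !scalerA mulNr tX.
Qed.

Lemma test_linear (a b : R) (f h : G -> R[i]) : test_G G f -> test_G G h ->
  test_G G (fun x => a%:C%C * f x + b%:C%C * h x).
Proof.
move=> [fr fi [C1 [cC1 _ f0]]] [hr hi [C2 [cC2 _ h0]]].
have re (x : G) : complex.Re (a%:C%C * f x + b%:C%C * h x) = a * complex.Re (f
  x) + b * complex.Re (h x).
  by case: (f x) => ? ?; case: (h x) => ? ? /=; ring.
have im (x : G) : complex.Im (a%:C%C * f x + b%:C%C * h x) = a * complex.Im (f
  x) + b * complex.Im (h x).
  by case: (f x) => ? ?; case: (h x) => ? ? /=; ring.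
split.
- by move=> k; under eq_fun do rewrite re; exact: Ck_linear.
- by move=> k; under eq_fun do rewrite im; exact: Ck_linear.
exists (C1 `|` C2); split=> //; first exact: compactU.
by move=> x _ /not_orP[n1 n2]; rewrite f0 // h0 // !mulr0 addr0.
Qed.

Lemma test_scale (a : R) (f : G -> R[i]) : test_G G f ->
  test_G G (fun x => a%:C%C * f x).
Proof.
move=> tf; have := test_linear a 0 tf tf.
by under eq_fun do rewrite mul0r addr0.
Qed.

(** The point k exp(X) of G_t in the chart K x s x R of the deformation space: the chart multiplies
    the s-component by [t], whence the factor [t^-1]. *)
Definition slice (t : R) (p : G * mx) : G * mx * R := ((p.1, t^-1 *: p.2), t).

Lemma slice_continuous (p : G * mx) (t : R) : t != 0 ->
  (fun q : (G * mx) * R => slice q.2 q.1) @ (p, t) --> slice t p.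
Proof.
case: p => k X t0.
have l1 : (fun q : (G * mx) * R => q.1.1) @ ((k, X), t) --> k.
  by apply: (cvg_comp fst fst); [exact: cvg_fst | exact: cvg_fst].
have l2 : (fun q : (G * mx) * R => q.2^-1 *: q.1.2) @ ((k, X), t) --> t^-1 *: X.
  apply: cvgZ; first by apply: cvgV => //; exact: cvg_snd.
  by apply: (cvg_comp fst snd); [exact: cvg_fst | exact: cvg_snd].
have l3 : (fun q : (G * mx) * R => q.2) @ ((k, X), t) --> t by exact: cvg_snd.
exact: (cvg_pair (cvg_pair l1 l2) l3).
Qed.

Lemma slice_continuous1 (p : G * mx) (t : R) : t != 0 ->
  slice t @ p --> slice t p.
Proof.
case: p => k X t0.
have l1 : (fun q : G * mx => q.1) @ (k, X) --> k by exact: cvg_fst.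
have l2 : (fun q : G * mx => t^-1 *: q.2) @ (k, X) --> t^-1 *: X.
  by apply: cvgZ; [exact: cvg_cst | exact: cvg_snd].
exact: (cvg_pair (cvg_pair l1 l2) (cvg_cst t)).
Qed.

Lemma slice_smooth (t : R) (q : G * mx * R -> R) : t != 0 ->
  smooth (KS `*` setT) (product_time_flows (gK G) (gs G)) q ->
  smooth KS (product_flows (gK G) (gs G)) (q \o slice t).
Proof.
move=> t0 sq k; apply: Ck_comp (sq k).
- by apply: continuous_subspaceT => p; exact: slice_continuous1.
- by move=> [x X] [/= Kx sX]; split=> //; split=> //=; exact: gsZ.
move=> _ [c [Y [oc cK sY ->]]].
(* The slice carries the direction [Y] to [t^-1 *: Y], with zero velocity in the time coordinate. *)
exists (fun u q => (((q.1.1 * c u)%g, q.1.2 + u *: (t^-1 *: Y)), q.2 + u * 0)).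
  by exists c, (t^-1 *: Y), 0; split=> //; exact: gsZ.
move=> u [x X] /=; rewrite /slice /= mulr0 addr0 scalerDr !scalerA.
by rewrite [t^-1 * u]mulrC.
Qed.

Variables (xi : R -> G -> R[i]) (xi0 : G * mx -> R[i]).
Hypothesis Hxi : smooth_family xi xi0.

Let Q (q : G * mx * R) : R[i] :=
  if q.2 == 0 then xi0 q.1 else xi q.2 (q.1.1 * gexp rho (q.2 *: q.1.2))%g.

Lemma slice_polar (t : R) p : t != 0 -> Q (slice t p) = xi t (polar rho p).
Proof.
by move=> t0; rewrite /Q /slice /= (negPf t0) scalerA mulfV // scale1r.
Qed.

Lemma polar_KS x : exists2 p, KS p & polar rho p = x.
Proof. by have [/(_ x)[p [[Kp <-] _]] _] := r_polar G; exists p. Qed.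

Lemma polar_compact (C : set (G * mx)) : C `<=` KS -> compact C ->
  compact (polar rho @` C).
Proof.
move=> CK; apply: continuous_compact.
apply: continuous_subspaceW (@polar_continuous _ G) => p /CK[Kp sp].
by split=> //; exact: gs_lie.
Qed.

(** At time [t] the support in polar coordinates is the support in the chart with its s-component
    multiplied by [t]. As [t] runs through the compact interval from [t0 / 2] to [2 * t0], these
    sets stay in one compact image. *)
Lemma support_near (t0 : R) : 0 < t0 -> exists C : set (G * mx),
  [/\ compact C, C `<=` KS & \forall t \near t0, forall p, KS p -> ~ C p ->
    xi t (polar rho p) = 0].
Proof.
move=> t00; have [_ _ [C [cC CS Q0]]] := Hxi.
pose j (q : (G * mx * R) * R) : G * mx := (q.1.1.1, q.2 *: q.1.1.2).
exists (j @` (C `*` `[t0 / 2, 2 * t0]%classic)); split.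
- apply: continuous_compact; last by apply: compact_setX => //;
  exact: segment_compact.
  apply: continuous_subspaceT => -[[[k X] r] t].
  have l1 : (fun q : (G * mx * R) * R => q.1.1) @ (((k, X), r), t) --> (k, X).
    by apply: (cvg_comp fst fst); exact: cvg_fst.
  have l2 : (fun q : (G * mx * R) * R => q.1.1.1) @ (((k, X), r), t) --> k.
    by apply: (cvg_comp _ fst l1); exact: cvg_fst.
  have l3 : (fun q : (G * mx * R) * R => q.2 *: q.1.1.2) @ (((k, X), r),
    t) --> t *: X.
    apply: cvgZ; first exact: cvg_snd.
    by apply: (cvg_comp _ snd l1); exact: cvg_snd.
  exact: (cvg_pair l2 l3).
- move=> _ [[[[x X] r] t] [/CS[[/= Kx sX] _] _] <-].
  by split=> //=; exact: gsZ.
have n1 : \forall t \near t0, t0 / 2 < t by apply: lt_nbhsr; lra.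
have n2 : \forall t \near t0, t < 2 * t0 by apply: lt_nbhsl; lra.
apply: filterS2 n1 n2 => t t1 t2 p [Kp sp] NC.
have tn0 : t != 0 by rewrite gt_eqF //; lra.
rewrite -slice_polar //; apply: Q0; first by split=> //; split=> //=;
  exact: gsZ.
apply: contra_not NC => Cp; exists (slice t p, t); first split=> //=.
  by rewrite in_itv /= (ltW t1) (ltW t2).
by rewrite /j /= scalerA mulfV // scale1r -surjective_pairing.
Qed.

(** Smoothness on [G] is tested in polar coordinates, where [xi t] is a slice of the smooth function
    on the deformation space. *)
Lemma family_test (t : R) : 0 < t -> test_G G (xi t).
Proof.
move=> t0; have tn0 : t != 0 by rewrite gt_eqF.
have [sr si _] := Hxi; have [_ pol] := r_polar G.
split.
- apply/pol; rewrite (_ : (fun p => _) = (fun q => complex.Re (Q q)) \o slice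
  t).
    exact: slice_smooth.
  by apply/funext => p /=; rewrite slice_polar.
- apply/pol; rewrite (_ : (fun p => _) = (fun q => complex.Im (Q q)) \o slice
  t).
    exact: slice_smooth.
  by apply/funext => p /=; rewrite slice_polar.
have [C [cC CK /nbhs_singleton C0]] := support_near t0.
exists (polar rho @` C); split=> //; first exact: polar_compact.
move=> x _ NC; have [p Kp px] := polar_KS x; rewrite -px; apply: C0 => // Cp.
by apply: NC; exists p.
Qed.

(** Joint continuity in [(p, t)] at each point of the compact set [C], made uniform by compactness.
    The factor [c] will be the normalization in [lambda], and [q] the real or the imaginary part of
    the family. *)
Lemma slice_uniform (q : G * mx * R -> R) (c : R ->
  R) (C : set (G * mx)) (t0 e : R) :
  {within KS `*` setT, continuous q} -> {for t0, continuous c} ->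
  compact C -> C `<=` KS -> 0 < t0 -> 0 < e ->
  \forall t \near t0, forall p, C p ->
    `|c t * q (slice t p) - c t0 * q (slice t0 p)| <= e.
Proof.
move=> /subspace_continuousP cq cc /compact_near_coveringP cov CK t00 e0.
have t0n : t0 != 0 by rewrite gt_eqF.
have e2 : 0 < e / 2 by rewrite divr_gt0.
have {}cov := cov R (nbhs t0) (fun t p => C p ->
  `|c t * q (slice t p) - c t0 * q (slice t0 p)| <= e) (nbhs_filter t0).
have : \forall t \near t0, C `<=` (fun p => C p ->
    `|c t * q (slice t p) - c t0 * q (slice t0 p)| <= e).
  apply: cov => p0 Cp0.
  have sKS t p : C p -> (KS `*` setT) (slice t p).
    by move=> /CK[Kp sp]; split=> //; split=> //=; exact: gsZ.
  have := cq _ (sKS t0 _ Cp0) => cq0.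
  suff E : \forall p \near (p0, t0), C p.1 ->
      `|c p.2 * q (slice p.2 p.1) - c t0 * q (slice t0 p.1)| <= e.
    exact: E.
  have lim1 : (fun p : (G * mx) * R => c p.2 * q (slice p.2 p.1)) @
      within [set p | C p.1] (nbhs (p0, t0)) --> c t0 * q (slice t0 p0).
    apply: cvgM.
      move=> A /cc nA; have : \forall p \near (p0, t0), A (c p.2).
        by apply: (@cvg_snd _ _ (nbhs p0) (nbhs t0) _ [set t | A (c t)]).
      move=> H; suff : \forall p \near (p0, t0), C p.1 -> A (c p.2) by [].
      by apply: filterS H.
    move=> A /cq0; rewrite /= /within /= => nA.
    have H : \forall p \near (p0, t0), (KS `*` setT) (slice p.2 p.1) ->
      A (q (slice p.2 p.1)).
      exact: (@slice_continuous p0 t0 t0n _ nA).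
    suff : \forall p \near (p0, t0), C p.1 -> A (q (slice p.2 p.1)) by [].
    by apply: filterS H => p Hp Cp; apply: Hp; exact: sKS.
  have lim2 : (fun p : (G * mx) * R => c t0 * q (slice t0 p.1)) @
      within [set p | C p.1] (nbhs (p0, t0)) --> c t0 * q (slice t0 p0).
    apply: cvgM; first exact: cvg_cst.
    move=> A /cq0; rewrite /= /within /= => nA.
    have nA' := @slice_continuous1 p0 t0 t0n _ nA.
    have H : \forall p \near (p0, t0), (KS `*` setT) (slice t0 p.1) ->
      A (q (slice t0 p.1)).
      exact: (@cvg_fst _ _ (nbhs p0) (nbhs t0) _ _ nA').
    suff : \forall p \near (p0, t0), C p.1 -> A (q (slice t0 p.1)) by [].
    by apply: filterS H => p Hp Cp; apply: Hp; exact: sKS.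
  move/cvgrPdist_le: lim1 => /(_ _ e2); rewrite near_withinE => near1.
  move/cvgrPdist_le: lim2 => /(_ _ e2); rewrite near_withinE => near2.
  apply: filterS2 near1 near2 => p H1 H2 Cp.
  apply: (le_trans (ler_distD (c t0 * q (slice t0 p0)) _ _)).
  rewrite (splitr e); apply: lerD; last exact: H2.
  by rewrite distrC; exact: H1.
by apply: filterS => t Ht p Cp; exact: Ht.
Qed.

End SmoothFamily.

(** * Norm continuity of smooth families in C*_r(G) *)

Section FamilyContinuous.
Context {R : realType} (G : real_reductive R) (mu : borel_measure G R).
Hypothesis Hmu : haar_G mu.
Context (A : cstar R) (iota : (G -> R[i]) -> A).
Hypothesis HA : reduced_G mu iota.

Lemma family_continuous xi xi0 (t0 e : R) : smooth_family xi xi0 -> 0 < t0 ->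
  0 < e ->
  \forall t \near t0,
    rnorm (iota (fun g => ((`|t|^-1 ^+ dimGK G)%:C)%C * xi t g) -
           iota (fun g => ((`|t0|^-1 ^+ dimGK G)%:C)%C * xi t0 g)) <= e.
Proof.
move=> Hxi t00 e0; have [C [cC CK C0]] := support_near Hxi t00.
pose c (t : R) := `|t|^-1 ^+ dimGK G.
have cc : {for t0, continuous c}.
  apply: (continuous_comp (f := fun t : R => `|t|^-1) (g :=
    fun x => x ^+ dimGK G)).
    apply: cvgV; first by rewrite normr_eq0 gt_eqF.
    exact: norm_continuous.
  exact: exprn_continuous.
have [sr si _] := Hxi; have [cr _] := sr 0%N; have [ci _] := si 0%N.
pose C' := polar (@rho R G) @` C.
have cC' : compact C' := polar_compact CK cC.
pose m := fine (mu C') + 1.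
have m0 : 0 < m by rewrite ltr_wpDl // fine_ge0 // measure_ge0.
(* The real and imaginary parts of the difference will be at most [d], so its modulus is at most
   [2 * d] and its reduced norm at most [2 * d * m = e]. *)
pose d := e / (2 * m).
have d0 : 0 < d by rewrite divr_gt0 // mulr_gt0.
have near1 := slice_uniform cr cc cC CK t00 d0.
have near2 := slice_uniform ci cc cC CK t00 d0.
have tpos : \forall t \near t0, 0 < t by exact: lt_nbhsr.
have nearb : \forall t \near t0, 0 < t /\ forall p, (gK G `*` gs G) p ->
  ~ C p ->
    xi t (polar (@rho R G) p) = 0.
  by apply: filterS2 tpos C0 => t.
apply: filterS3 near1 near2 nearb => t H1 H2 [t1 H3].
have H30 := nbhs_singleton C0.
have test s : 0 < s -> test_G G (fun g => (c s)%:C%C * xi s g).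
  by move=> s0; apply: test_scale; exact: family_test Hxi _ s0.
pose f (g : G) := (-1) * ((c t0)%:C%C * xi t0 g) + (c t)%:C%C * xi t g.
have tf : test_G G f.
  have := test_linear (-1) 1 (test _ t00) (test _ t1).
  congr (test_G G); apply/funext => g; rewrite /f rmorphN rmorph1;
    congr (_ + _).
  by rewrite mul1r.
have [lin _ _ _ _] := HA.
rewrite -/(c t) -/(c t0).
have -> : iota (fun g => (c t)%:C%C * xi t g) - iota (fun g => (c t0)%:C%C * xi
  t0 g) = iota f.
  by rewrite lin ?scaleN1r 1?addrC //; exact: test.
have -> : e = 2 * d * m by rewrite /d; field; rewrite gt_eqF.
apply: (iota_norm_le Hmu HA tf cC').
- by rewrite mulr_ge0 // ltW.
- move=> x NC; have [p Kp px] := polar_KS x.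
  have NCp : ~ C p by move=> Cp; apply: NC; exists p.
  by rewrite /f -px H3 // H30 // !mulr0 addr0.
move=> x; have [p Kp px] := polar_KS x.
have [Cp|NCp] := pselect (C p); last first.
  rewrite /f -px H3 // H30 // !mulr0 addr0 /sqmod /= expr0n addr0.
  by rewrite exprn_ge0 // mulr_ge0 // ltW.
have tn : t != 0 by rewrite gt_eqF. have t0n : t0 != 0 by rewrite gt_eqF.
have := H1 p Cp; have := H2 p Cp.
rewrite /= (negPf tn) (negPf t0n) !scalerA !mulfV // !scale1r -[(p.1 *
  _)%g]/(polar (@rho R G) p) px.
have -> : sqmod (f x) = (c t * complex.Re (xi t x) - c t0 * complex.Re (xi t0
  x)) ^+ 2 +
   (c t * complex.Im (xi t x) - c t0 * complex.Im (xi t0 x)) ^+ 2.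
  by rewrite /sqmod /f; case: (xi t x) => ? ?; case: (xi t0 x) => ? ? /=; ring.
move: (_ - _) (_ - _) => u v Hu Hv.
have sq z : `|z| <= d -> z ^+ 2 <= d ^+ 2.
  by move=> zd; rewrite -real_normK ?num_real // ler_sqr ?nnegrE // ltW.
have h1 := sq _ Hu; have h2 := sq _ Hv; have h3 := sqr_ge0 d.
by rewrite exprMn (_ : 2 ^+ 2 = 4 :> R); [lra | ring].
Qed.

End FamilyContinuous.

(** * Mapping cone fields *)

Section StarAlgebras.
Context {R : realType}.
Implicit Types A B : cstar R.

Lemma star_homB A B (f : A -> B) x y : star_hom f -> f (x - y) = f x - f y.
Proof. by move=> [lin _ _]; have := lin (-1) y x; rewrite !scaleN1r addrC => ->;
  rewrite addrC. Qed.

Lemma star_hom0 A B (f : A -> B) : star_hom f -> f 0 = 0.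
Proof. by move=> fh; have := star_homB 0 0 fh; rewrite !subrr. Qed.

Lemma star_iso_norm A B (f : A -> B) x : star_iso f -> rnorm (f x) = rnorm x.
Proof. by move=> [_ _ fn]; rewrite /rnorm fn. Qed.

Lemma star_iso_dist A B (f : A -> B) x y : star_iso f ->
  rnorm (f x - f y) = rnorm (x - y).
Proof. by move=> fi; rewrite -(star_iso_norm _ fi); case: (fi) => fh _ _;
  rewrite star_homB. Qed.

Lemma star_iso_comp A B (C : cstar R) (f : A -> B) (g : B -> C) :
  star_iso f -> star_iso g -> star_iso (g \o f).
Proof.
move=> [[fl fm fa] fb fn] [[gl gm ga] gb gn]; split.
- by split=> *; rewrite /= ?fl ?fm ?fa ?gl ?gm ?ga.
- exact: bij_comp.
- by move=> x /=; rewrite gn fn.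
Qed.

Lemma star_iso_id A : star_iso (id : A -> A).
Proof. by split=> //; exists id. Qed.

Lemma rnorm_cmul A (x y : A) : rnorm (cmul x y) <= rnorm x * rnorm y.
Proof. by rewrite -lecR rmorphM /= -!rnormE cnormM. Qed.

Lemma rnorm_cadj A (x : A) : rnorm (cadj x) = rnorm x.
Proof.
have le (y : A) : rnorm y <= rnorm (cadj y).
  have [->|y0] := eqVneq (rnorm y) 0; first exact: rnorm_ge0.
  have yp : 0 < rnorm y by rewrite lt_def y0 rnorm_ge0.
  rewrite -(ler_pM2r yp); apply: le_trans (rnorm_cmul _ _).
  rewrite -lecR rmorphM /= -!rnormE -expr2 cnorm_star //.
by apply/eqP; rewrite eq_le le -{2}[x]cadjK le.
Qed.

Lemma cadjB A (x y : A) : cadj (x - y) = cadj x - cadj y.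
Proof.
have := cadjD (-1) y x; rewrite rmorphN rmorph1 !scaleN1r addrC => ->.
by rewrite addrC.
Qed.

Lemma cmulBl A (x y z : A) : cmul (x - y) z = cmul x z - cmul y z.
Proof. by have := cmulDl (-1) y x z; rewrite !scaleN1r addrC => ->;
  rewrite addrC. Qed.

Lemma cmulBr A (x y z : A) : cmul z (x - y) = cmul z x - cmul z y.
Proof. by have := cmulDr (-1) y x z; rewrite !scaleN1r addrC => ->;
  rewrite addrC. Qed.

Lemma cmul_continuous A (x y : A) : (fun p :
  A * A => cmul p.1 p.2) @ (x, y) --> cmul x y.
Proof.
apply/cvg_rnormP => e e0.
pose M := rnorm x + rnorm y + 2.
have M0 : 0 < M by rewrite ltr_wpDl // addr_ge0 // rnorm_ge0.
have d0 : 0 < e / (2 * M) by rewrite divr_gt0 // mulr_gt0.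
have n1 : \forall p \near (x, y), rnorm (p.1 - x) < e / (2 * M).
  exact: (@cvg_fst _ _ (nbhs x) (nbhs y) _ _ (nbhs_rnorm x d0)).
have n2 : \forall p \near (x, y), rnorm (p.2 - y) < e / (2 * M).
  exact: (@cvg_snd _ _ (nbhs x) (nbhs y) _ _ (nbhs_rnorm y d0)).
have n3 : \forall p \near (x, y), rnorm (p.2 - y) < 1.
  exact: (@cvg_snd _ _ (nbhs x) (nbhs y) _ _ (nbhs_rnorm y ltr01)).
apply: filterS3 n1 n2 n3 => -[u v] /= h1 h2 h3.
apply: (le_trans (rnorm_dist (cmul x v) _ _)); rewrite -cmulBl -cmulBr.
have nv : rnorm v <= M.
  have := rnormD (v - y) y; rewrite subrK => /le_trans; apply.
  by rewrite /M; have := rnorm_ge0 x; have := ltW h3; lra.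
have nx : rnorm x <= M by rewrite /M; have := rnorm_ge0 y; lra.
have -> : e = e / (2 * M) * M + M * (e / (2 * M)) by field; rewrite gt_eqF.
by apply: lerD; apply: (le_trans (rnorm_cmul _ _)); apply: ler_pM;
  rewrite ?rnorm_ge0 // ltW.
Qed.

Lemma cadj_continuous A (x : A) : (fun y : A => cadj y) @ x --> cadj x.
Proof.
apply/cvg_rnormP => e e0; apply: filterS (nbhs_rnorm x e0) => y yx.
by rewrite -cadjB rnorm_cadj ltW.
Qed.

Lemma rnorm_lip (V : normedModType R[i]) (u v : V) :
  `|rnorm u - rnorm v| <= rnorm (u - v).
Proof.
have h1 := rnormD (u - v) v; have h2 := rnormD (v - u) u.
rewrite subrK in h1; rewrite subrK rnormB in h2.
by rewrite ler_norml; apply/andP; split; lra.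
Qed.

Lemma rnorm_continuous (V : normedModType R[i]) (u : V) : (fun v :
  V => rnorm v) @ u --> rnorm u.
Proof.
apply/cvgrPdist_le => e e0; apply: filterS (nbhs_rnorm u e0) => v uv.
by rewrite distrC (le_trans (rnorm_lip _ _)) // ltW.
Qed.

End StarAlgebras.

Section MappingCone.
Context {R : realType} (A0 A : cstar R) (alpha : A0 -> A).
Hypothesis alpha_hom : star_hom alpha.
Hypothesis alpha_norm : forall x, rnorm (alpha x) = rnorm x.

Local Notation cone a := (fun t : R => if t == 0 then alpha a.1 else a.2 t).

Lemma cone_dist (a b : fsection A0 (fun=> A)) t :
  fnorm (fcomb (-1) b a) t = rnorm (cone a t - cone b t).
Proof.
rewrite /fnorm /fcomb /= !scaleN1r ![- _ + _]addrC; case: eqP => // _.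
by rewrite -star_homB // alpha_norm.
Qed.

Lemma mapping_cone_field : continuous_field (mapping_cone alpha).
Proof.
have [alin amul aadj] := alpha_hom.
have a0 := star_hom0 alpha_hom.
split.
- split.
    exists (0, fun=> 0); rewrite /mapping_cone /= a0.
    rewrite (_ : (fun t => _) = fun=> 0); first by move=> t; exact: cvg_cst.
    by apply/funext => t; case: eqP.
  move=> c a b /subspace_continuousP ca /subspace_continuousP cb.
  rewrite /mapping_cone /=.
  rewrite (_ : (fun t => _) = fun t => c *: cone a t + cone b t); last first.
    by apply/funext => t; case: eqP => // _; rewrite alin.
  apply/subspace_continuousP => t t0; apply: cvgD; last exact: cb.
  by apply: cvgZ; [exact: cvg_cst | exact: ca].
- split.
    move=> a b /subspace_continuousP ca /subspace_continuousP cb.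
    rewrite /mapping_cone /=.
    rewrite (_ : (fun t => _) = fun t => cmul (cone a t) (cone b t));
      last first.
      by apply/funext => t; case: eqP => // _; rewrite amul.
    apply/subspace_continuousP => t t0.
    exact: (cvg_comp _ (fun p : A * A => cmul p.1 p.2) (cvg_pair (ca t t0) (cb t
      t0))
      (@cmul_continuous _ _ _ _)).
  move=> a /subspace_continuousP ca; rewrite /mapping_cone /=.
  rewrite (_ : (fun t => _) = fun t => cadj (cone a t)); last first.
    by apply/funext => t; case: eqP => // _; rewrite aadj.
  apply/subspace_continuousP => t t0.
  exact: (cvg_comp _ (fun x : A => cadj x) (ca t t0) (@cadj_continuous _ _ _)).
- split.
    move=> x; exists (x, fun=> alpha x) => //; rewrite /mapping_cone /=.
    rewrite (_ : (fun t => _) = fun=> alpha x); first by move=> t;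
      exact: cvg_cst.
    by apply/funext => t; case: eqP.
  move=> t x t0; exists (0, fun s => (s / t)%:C%C *: x); last first.
    by rewrite /= mulfV ?gt_eqF // scale1r.
  rewrite /mapping_cone /= a0.
  rewrite (_ : (fun t => _) = fun s => (s / t)%:C%C *: x); last first.
    by apply/funext => s; case: eqP => // ->; rewrite mul0r scale0r.
  apply/within_rnormP => s _ e e0.
  have d0 : 0 < e * t / (rnorm x + 1) by rewrite divr_gt0 ?mulr_gt0 // ltr_wpDl
    ?rnorm_ge0.
  have /cvgrPdist_lt/(_ _ d0) : (id : R -> R) @ s --> s by exact: cvg_id.
  apply: filterS => u su _.
  rewrite -scalerBl -rmorphB /= -mulrBl rnormZ normrM normfV (gtr0_norm t0).
  have n1 : 0 < rnorm x + 1 by rewrite ltr_wpDl ?rnorm_ge0.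
  move: su; rewrite distrC ltr_pdivlMr // => su.
  rewrite mulrAC ler_pdivrMr //; apply: le_trans (ltW su).
  by rewrite ler_wpM2l // lerDl.
- move=> a /subspace_continuousP ca; apply/subspace_continuousP => t t0.
  rewrite (_ : fnorm a = fun t => rnorm (cone a t)); last first.
    by apply/funext => s; rewrite /fnorm; case: eqP => // _; rewrite alpha_norm.
  exact: (cvg_comp _ (fun x : A => rnorm x) (ca t t0) (@rnorm_continuous _ _
    _)).
move=> a Ha; apply/within_rnormP => t; rewrite /= in_itv /= andbT => t0 e e0.
have e3 : 0 < e / 3 by rewrite divr_gt0.
have [b /within_rnormP cb [d d0 Hd]] := Ha t _ t0 e3.
have tI : `[0, +oo[%classic t by rewrite /= in_itv /= andbT.
have near1 := cb t tI _ e3.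
have near2 : \forall s \near t, `|s - t| < d.
  have /cvgrPdist_lt/(_ _ d0) : (id : R -> R) @ t --> t by exact: cvg_id.
  by apply: filterS => s; rewrite distrC.
apply: filterS2 near1 near2 => s H1 H2 sI.
have s0 : 0 <= s by move: sI; rewrite /= in_itv /= andbT.
have h1 := Hd s s0 H2; rewrite cone_dist in h1.
have h2 := Hd t t0; rewrite subrr normr0 cone_dist in h2; have {}h2 := h2 d0.
have h3 := H1 sI.
apply: (le_trans (rnorm_dist (cone b s) _ _)).
rewrite (_ : e = e / 3 + (e / 3 + e / 3)); last by field.
apply: lerD => //; apply: (le_trans (rnorm_dist (cone b t) _ _));
  apply: lerD => //.
by rewrite rnormB.
Qed.

End MappingCone.

(** * The isomorphism *)

Section FieldIsomorphism.
Context {R : realType} (G : real_reductive R) (mu muK : borel_measure G R).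
Hypothesis Hmu : haar_G mu.
Context (A : cstar R) (iota : (G -> R[i]) -> A).
Hypothesis HA : reduced_G mu iota.
Context (At : R -> cstar R) (iotat : forall t : R, (G -> R[i]) -> At t).
Context (A0 : cstar R) (iota0 : (G * 'M[R]_(rdim G) -> R[i]) -> A0).
Hypothesis Hfield : continuous_field (deformation_section iota0 iotat).
Context (I : Type) (D : I -> series_data G).
Hypothesis HD : series_representatives muK D.
Context (Phi : A -> op_family D).
Hypothesis HPhi : plancherel_iso muK mu iota Phi.
Context (alphat : R -> A -> A).
Hypothesis Halphat : forall t : R, 0 < t ->
  rescaling_automorphism muK Phi t (alphat t).
Context (lambda : forall t : R, At t -> A).
Hypothesis Hlambda : forall t : R, 0 < t ->
  fiber_identification iotat iota t (lambda (t:=t)).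
Context (alpha : A0 -> A).
Hypothesis Halpha : mackey_embedding iota0 iotat alphat lambda alpha.

Local Notation Gam := (deformation_section iota0 iotat).

Let iso_alphat t : 0 < t -> star_iso (alphat t).
Proof. by move=> /Halphat[]. Qed.

Let iso_lambda t : 0 < t -> star_iso (lambda (t:=t)).
Proof. by move=> /Hlambda[]. Qed.

Let hom_alpha : star_hom alpha. Proof. by case: Halpha. Qed.

Definition transported_section (a : fsection A0 At) (t : R) : A :=
  if t == 0 then alpha a.1 else alphat t (lambda (a.2 t)).

Lemma mackey_embedding_norm x : rnorm (alpha x) = rnorm x.
Proof.
have [_ _ [ex _] cn _] := Hfield.
have [a Ga <-] := ex x; have [_ lim] := Halpha.
have /cvg_rnormP lim1 := lim a Ga.
have /subspace_continuousP cn1 := cn a Ga.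
have in0 : `[0, +oo[%classic (0 : R) by rewrite /= in_itv /= lexx.
have close e : 0 < e -> `|rnorm (alpha a.1) - rnorm a.1| <= e + e.
  move=> e0.
  have near1 : \forall t \near (0 : R), 0 < t ->
      rnorm (alphat t (lambda (a.2 t)) - alpha a.1) <= e.
    by have := lim1 e e0; rewrite near_withinE.
  have near2 : \forall t \near (0 : R), `[0, +oo[%classic t ->
    `|fnorm a 0 - fnorm a t| <= e.
    by have /cvgrPdist_le/(_ e e0) := cn1 0 in0; rewrite near_withinE.
  have [d /= d0 Hd] : \forall t \near (0 : R), (0 < t ->
      rnorm (alphat t (lambda (a.2 t)) - alpha a.1) <= e) /\
      (`[0, +oo[%classic t -> `|fnorm a 0 - fnorm a t| <= e).
    by apply: filterS2 near1 near2.
  have t0 : 0 < d / 2 by rewrite divr_gt0.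
  have [|H1 H2] := Hd (d / 2).
    by rewrite /= sub0r normrN gtr0_norm // ltr_pdivrMr // ltr_pMr // ltr1n.
  have := H2; rewrite /= in_itv /= (ltW t0) => /(_ isT).
  rewrite /fnorm eqxx (gt_eqF t0) => h2.
  have h1 := le_trans (rnorm_lip _ _) (H1 t0).
  rewrite (star_iso_norm _ (iso_alphat t0)) (star_iso_norm _ (iso_lambda t0)) in
    h1.
  apply: (le_trans (ler_distD (rnorm (a.2 (d / 2))) _ _)).
  by apply: lerD; rewrite distrC.
apply/eqP; rewrite -subr_eq0 -normr_le0; apply/ler_addgt0Pl => e e0.
by rewrite addr0 (splitr e); apply: close; rewrite divr_gt0.
Qed.

Lemma transported_section_continuous a : Gam a ->
  {within `[0, +oo[, continuous (transported_section a)}.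
Proof.
move=> Ga; apply/within_rnormP => x; rewrite /= in_itv /= andbT le_eqVlt.
move=> /predU1P[<-|x0] e e0.
  have [_ lim] := Halpha; have /cvg_rnormP/(_ e e0) := lim a Ga.
  rewrite near_withinE; apply: filterS => y Hy;
    rewrite in_itv /= andbT le_eqVlt.
  rewrite /transported_section eqxx => /predU1P[<-|y0].
    by rewrite eqxx subrr rnorm0 ltW.
  by rewrite (gt_eqF y0); exact: Hy.
have e4 : 0 < e / 4 by rewrite divr_gt0.
have [xi [xi0 [Hxi [d d0 Hd]]]] := Ga x _ (ltW x0) e4.
have ypos : \forall y \near x, 0 < y by exact: lt_nbhsr.
have dist y : 0 < y -> `|y - x| < d -> rnorm (a.2 y - iotat y (xi y)) <= e / 4.
  move=> y0 yd; have := Hd y (ltW y0) yd.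
  by rewrite /fnorm /fcomb /= (gt_eqF y0) scaleN1r addrC.
have yd : \forall y \near x, 0 < y /\ `|y - x| < d.
  have /cvgrPdist_lt/(_ _ d0) : (id : R -> R) @ x --> x by exact: cvg_id.
  by apply: filterS2 ypos => y y0; rewrite distrC.
have lxi y : 0 < y -> lambda (iotat y (xi y)) =
    iota (fun g => ((`|y|^-1 ^+ dimGK G)%:C)%C * xi y g).
  by move=> y0; have [_ ->] := Hlambda y0 => //; exact: family_test Hxi _ y0.
have near1 := family_continuous Hmu HA Hxi x0 e4.
have near2 := rescaling_continuous HD HPhi Halphat (lambda (iotat x (xi x))) x0
  e4.
apply: filterS3 yd near1 near2 => y [y0 yd1] H1 H2 _.
rewrite /transported_section (gt_eqF y0) (gt_eqF x0).
have ia := iso_alphat; have il := iso_lambda.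
apply: (le_trans (rnorm_dist (alphat y (lambda (iotat y (xi y)))) _ _)).
rewrite (_ : e = e / 4 + (e / 4 + (e / 4 + e / 4))); last by field.
apply: lerD.
  by rewrite (star_iso_dist _ _ (ia y y0)) (star_iso_dist _ _ (il y y0));
    exact: dist.
apply: (le_trans (rnorm_dist (alphat y (lambda (iotat x (xi x)))) _ _)).
apply: lerD.
  by rewrite (star_iso_dist _ _ (ia y y0)) !lxi.
apply: (le_trans (rnorm_dist (alphat x (lambda (iotat x (xi x)))) _ _)).
apply: lerD; first exact: H2.
rewrite (star_iso_dist _ _ (ia x x0)) (star_iso_dist _ _ (il x x0)) rnormB.
by apply: dist => //; rewrite subrr normr0.
Qed.

Lemma transported_section_dist a b t : 0 <= t ->
  fnorm (fcomb (-1) b a) t = rnorm (transported_section a t -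
    transported_section b t).
Proof.
rewrite /fnorm /fcomb /transported_section /= !scaleN1r ![- _ + _]addrC.
rewrite le_eqVlt => /predU1P[<-|t0].
  by rewrite eqxx -star_homB // mackey_embedding_norm.
by rewrite (gt_eqF t0) (star_iso_dist _ _ (iso_alphat t0)) (star_iso_dist _ _
  (iso_lambda t0)).
Qed.

Lemma transported_section_continuousV a :
  {within `[0, +oo[, continuous (transported_section a)} -> Gam a.
Proof.
move=> /within_rnormP ca; have [_ _ [ex0 ext] _ complete] := Hfield.
apply: complete => t0 e t00 e0.
have [b Gb eb] : exists2 b, Gam b & transported_section a t0 =
  transported_section b t0.
  move: t00; rewrite le_eqVlt => /predU1P[<-|t1].
    by have [b Gb eb] := ex0 a.1; exists b;
      rewrite // /transported_section eqxx eb.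
  have [b Gb eb] := ext t0 (a.2 t0) t1; exists b => //.
  by rewrite /transported_section (gt_eqF t1) eb.
exists b => //.
have e2 : 0 < e / 2 by rewrite divr_gt0.
have t0I : `[0, +oo[%classic t0 by rewrite /= in_itv /= t00.
have near1 := ca t0 t0I _ e2.
have /within_rnormP cb := transported_section_continuous Gb.
have near2 := cb t0 t0I _ e2.
have [d /= d0 Hd] : \forall t \near t0, `[0, +oo[%classic t ->
    rnorm (transported_section a t - transported_section b t) <= e.
  apply: filterS2 near1 near2 => t H1 H2 tI.
  apply: (le_trans (rnorm_dist (transported_section a t0) _ _)).
  rewrite (splitr e); apply: lerD; first exact: H1.
  by rewrite eb rnormB; exact: H2.
exists d => // t tge td; rewrite transported_section_dist //.
by apply: Hd; rewrite /= ?in_itv /= ?tge // distrC.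
Qed.

Lemma mackey_field_iso : continuous_field (mapping_cone alpha) /\
  field_iso Gam (mapping_cone alpha) id (fun t => alphat t \o lambda (t:=t)).
Proof.
split; first exact: (mapping_cone_field hom_alpha mackey_embedding_norm).
split; first exact: star_iso_id.
  by move=> t t0; exact: (star_iso_comp (iso_lambda t0) (iso_alphat t0)).
move=> a; split; first exact: transported_section_continuous.
exact: transported_section_continuousV.
Qed.

End FieldIsomorphism.

Unset Implicit Arguments.
Set Strict Implicit.

Theorem theorem7p2p1
  (R : realType) (G : real_reductive R)
  (* Haar measures on G, K and G_0 *)
  (mu : borel_measure G R) (Hmu : haar_G mu)
  (muK : borel_measure G R) (HmuK : haar_K muK)
  (mu0 : borel_measure (G * 'M[R]_(rdim G))%type R) (Hmu0 : haar_G0 mu mu0)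
  (* the reduced C*-algebras of G, of G_t for t > 0, and of G_0 *)
  (A : cstar R) (iota : (G -> R[i]) -> A) (HA : reduced_G mu iota)
  (At : R -> cstar R) (iotat : forall t : R, (G -> R[i]) -> At t)
  (HAt : forall t : R, 0 < t -> reduced_G (haar_scaled mu t) (iotat t))
  (A0 : cstar R) (iota0 : (G * 'M[R]_(rdim G) -> R[i]) -> A0)
  (HA0 : reduced_G0 mu0 iota0)
  (Hfield : continuous_field (deformation_section iota0 iotat))
  (* one representative (P, sigma) of each associate class, with its data *)
  (I : Type) (D : I -> series_data G) (HD : series_representatives muK D)
  (Phi : A -> op_family D) (HPhi : plancherel_iso muK mu iota Phi)
  (* the automorphisms alpha_t, the isomorphisms lambda_t, the embedding *)
  (alphat : R -> A -> A)
  (Halphat : forall t : R, 0 < t -> rescaling_automorphism muK Phi t (alphat t))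
  (lambda : forall t : R, At t -> A)
  (Hlambda : forall t : R, 0 < t ->
     fiber_identification iotat iota t (lambda t))
  (alpha : A0 -> A)
  (Halpha : mackey_embedding iota0 iotat alphat lambda alpha) :
  continuous_field (mapping_cone alpha) /\
  field_iso (deformation_section iota0 iotat) (mapping_cone alpha)
    id (fun t : R => alphat t \o lambda t).
Proof.
exact: (mackey_field_iso Hmu HA Hfield HD HPhi Halphat Hlambda Halpha).
Qed.
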